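(* Fix $d\in\mathbb{N}$. Let $p\in\mathbb{N}$, $L\in\mathbb{N}$ with $L\ge1$, $\epsilon>0$, $\mu>0$, and let $a$ be a symmetric-matrix-valued field on $\mathbb{R}^d/\mathbb{Z}^d$ such that, for constants $\lambda,\Lambda>1$, $\lambda^{-1}|\xi|^2\le\xi\cdot a(x)\xi\le\Lambda|\xi|^2$ for all $\xi\in\mathbb{R}^d$ and all $x$. Let $g$ be an $\mathbb{R}^d$-valued field on $\mathbb{R}^d/\mathbb{Z}^d$, and let $\nabla u$ (with $u\in H^1(\mathbb{R}^d/\mathbb{Z}^d)$) be the solution of $-\nabla\cdot(a\nabla u)=\nabla\cdot g$ on $\mathbb{R}^d/\mathbb{Z}^d$. Let $\hat{\boldsymbol a},\hat{\boldsymbol p},\hat{\boldsymbol g}$ be discretized data on the grid $\hat G_L$, with residual sizes $\nu_a,\nu_P,\nu_g$, and let $\hat{\boldsymbol\psi}^*_{\mu,L}$ be the minimizer of the discretized functional $\widehat{\boldsymbol{\mathcal J}}_\mu$, i.e. the solution of $(\hat{\boldsymbol a}*+\mu\hat{\boldsymbol p}\odot)\hat{\boldsymbol\psi}^*_{\mu,L}=-\hat{\boldsymbol g}$, with interpolate $\psi^*_{\mu,L}$ (all as defined in the context). Assume: (i) $a,g\in C^p$ satisfy $\sum_{p'=0}^p\epsilon^{p'}\big(\|\nabla^{p'}a\|_{L^\infty}+\|\nabla^{p'}g\|_{L^2}\big)\le C_p$ for a given constant $C_p$; (ii) $\lambda\nu_a+\lambda\mu\nu_P\le 1/2$. Then $$\|\psi^*_{\mu,L}-\nabla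 u\|_2\le C\Big((2^L\epsilon)^{-p}+\mu^{-1}+\nu_a+\mu\nu_P+\nu_g\Big),$$ where the constant $C$ depends only on $p$, $\lambda$, $\Lambda$ and $C_p$.
   Context: Grid and interpolation: $\hat G_L=\{2\pi m: m\in\{-2^{L-1},\dots,2^{L-1}-1\}^d\}$. For $\hat{\boldsymbol\phi}:\hat G_L\to\mathbb{C}^d$, its interpolate is $\phi(x)=2^{-Ld/2}\sum_{k\in\hat G_L}\hat{\boldsymbol\phi}_k\,e^{-\mathrm{i}k\cdot x}$, so that $\|\hat{\boldsymbol\phi}\|_{\ell^2}=2^{Ld/2}\|\phi\|_2$; $\|\cdot\|_2$ is the $L^2$ norm on $\mathbb{R}^d/\mathbb{Z}^d$ (of $\mathbb{C}^d$-valued fields). Discretized data: $\hat{\boldsymbol a}:\hat G_L\to\mathbb{C}^{d\times d}$, $\hat{\boldsymbol p}:\hat G_L\to\mathbb{C}^{d\times d}$, $\hat{\boldsymbol g}:\hat G_L\to\mathbb{C}^d$. The operator $\hat{\boldsymbol a}*$ is the discrete periodic convolution $(\hat{\boldsymbol a}*\hat{\boldsymbol\phi})_k=\sum_{k'\in\hat G_L}\hat{\boldsymbol a}_{k-k'}\hat{\boldsymbol\phi}_{k'}$ (indices modulo $2\pi 2^L$ in each coordinate), assumed Hermitian; $(\hat{\boldsymbol p}\odot\hat{\boldsymbol\phi})_k=\hat{\boldsymbol p}_k\hat{\boldsymbol\phi}_k$, where each $\hat{\boldsymbol p}_k$ is assumed to be a Hermitian $d\times d$ matrix. The discretized functional is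 $\widehat{\boldsymbol{\mathcal J}}_\mu(\hat{\boldsymbol\psi})=\frac12\hat{\boldsymbol\psi}^\dagger\cdot\hat{\boldsymbol a}*\hat{\boldsymbol\psi}+\mathrm{Re}\big(\hat{\boldsymbol\psi}^\dagger\cdot\hat{\boldsymbol g}\big)+\frac\mu2\hat{\boldsymbol\psi}^\dagger\cdot\hat{\boldsymbol p}\odot\hat{\boldsymbol\psi}$, where $\dagger$ is the Hermitian transpose; its minimization is understood as solving the associated linear system $(\hat{\boldsymbol a}*+\mu\hat{\boldsymbol p}\odot)\hat{\boldsymbol\psi}=-\hat{\boldsymbol g}$. Exact counterparts: $\hat{\boldsymbol A}$ is the operator on $(\mathbb{C}^d)^{\hat G_L}$ defined by $\hat{\boldsymbol\zeta}^\dagger\cdot\hat{\boldsymbol A}\hat{\boldsymbol\phi}=2^{Ld}\int\overline{\zeta}\cdot a\phi$ for all $\hat{\boldsymbol\zeta},\hat{\boldsymbol\phi}$ with interpolates $\zeta,\phi$; $\hat p_{ij}(k)=\delta_{ij}-k_ik_j/|k|^2$ for $k\ne0$, $\hat p_{ij}(0)=\delta_{ij}$ (symbol of the Helmholtz–Leray projector onto divergence-free fields); $\hat g(k)=2^{Ld/2}\int g(x)e^{\mathrm{i}k\cdot x}\,dx$, integrals being over $\mathbb{R}^d/\mathbb{Z}^d$. Residuals: $\delta\hat{\boldsymbol A}=\hat{\boldsymbol a}*-\hat{\boldsymbol A}$, $\delta\hat{\boldsymbol p}_k=\hat{\boldsymbol p}_k-\hat p(k)$, $\delta\hat{\boldsymbol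 g}_k=\hat{\boldsymbol g}_k-\hat g(k)$ for $k\in\hat G_L$; $\nu_a$ is the $\ell^2\to\ell^2$ operator (spectral) norm of $\delta\hat{\boldsymbol A}$, $\nu_P=\|\delta\hat{\boldsymbol p}\|_{\ell^\infty}=\max_{k\in\hat G_L}\|\delta\hat{\boldsymbol p}_k\|$ (spectral matrix norm), and $\nu_g=2^{-Ld/2}\|\delta\hat{\boldsymbol g}\|_{\ell^2}$. *)

(* Defs.v *)
From HB Require Import structures.
From mathcomp Require Import all_boot all_order all_algebra.
From mathcomp Require Import complex.
From mathcomp Require Import all_classical all_reals all_analysis.

Set Implicit Arguments.
Unset Strict Implicit.
Unset Printing Implicit Defensive.

Import Order.TTheory GRing.Theory Num.Theory.
Import numFieldNormedType.Exports.

Local Open Scope classical_set_scope.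
Local Open Scope ring_scope.
Local Open Scope complex_scope.
Local Open Scope sesquilinear_scope.

(* Functions on the torus R^d/Z^d are 1-periodic functions on 'rV[R]_d (see
   [torus_periodic]); they are integrated over a period by precomposing with
   [torus_pt] and using [torus_measure], the product of d copies of the uniform
   probability on [0, 1], i.e. Lebesgue measure on the unit cube. *)

Section torus_measure.
Context {R : realType}.
Local Notation T := (measurableTypeR R).

Definition tuple_cons n (z : T * n.-tuple T) : n.+1.-tuple T :=
  [the n.+1.-tuple T of z.1 :: z.2].

Lemma measurable_tuple_cons n : measurable_fun setT (@tuple_cons n).
Proof. exact: measurable_cons. Qed.

HB.instance Definition _ n :=
  isMeasurableFun.Build _ _ _ _ (@tuple_cons n) (@measurable_tuple_cons n).

Section unit_product.
Context n (P : probability (n.-tuple T) R).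

Definition unit_product := (uniform_prob (@ltr01 R) \x P)%E.

HB.instance Definition _ := Measure.on unit_product.

Let unit_product_setT : unit_product [set: _] = 1%E.
Proof.
have uT : uniform_prob (@ltr01 R) setT = 1%E by exact: probability_setT.
have PT : P setT = 1%E by exact: probability_setT.
rewrite /unit_product -setXTT product_measure1E//.
by rewrite -[RHS]mule1; congr (_ * _)%E; [exact: uT | exact: PT].
Qed.

HB.instance Definition _ :=
  Measure_isProbability.Build _ _ _ unit_product unit_product_setT.

End unit_product.

Fixpoint torus_measure d : probability (d.-tuple T) R :=
  match d return probability (d.-tuple T) R with
  | 0 => \d_ ([tuple] : 0.-tuple T)
  | n.+1 => distribution (unit_product (torus_measure n)) (@tuple_cons n)
  end.
End torus_measure.
Arguments torus_measure R d : clear implicits.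

Section torus_functions.
Context {R : realType} {d : nat}.
Local Notation mu := (torus_measure R d).
Implicit Types (f u phi : 'rV[R]_d -> R) (x : 'rV[R]_d).

Definition torus_pt (t : d.-tuple (measurableTypeR R)) : 'rV[R]_d :=
  \row_i tnth t i.

Definition torus_periodic (V : zmodType) (f : 'rV[R]_d -> V) :=
  forall i, periodic f (delta_mx 0 i).

Definition torus_int f : R := \int[mu]_t f (torus_pt t).

Definition torus_intC (f : 'rV[R]_d -> R[i]) : R[i] :=
  torus_int (fun x => complex.Re (f x)) +i* torus_int (fun x => complex.Im (f x)).

Definition torus_norm (q : \bar R) f : \bar R :=
  Lnorm mu q (fun t => (f (torus_pt t))%:E).

Definition torus_L2 f := (f \o torus_pt) \in Lfun mu 2%:E.

Definition pderiv (s : seq 'I_d) f : 'rV[R]_d -> R :=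
  foldr (fun i h => 'D_(delta_mx 0 i) h) f s.

Definition classC (n : nat) f :=
  (forall s : seq 'I_d, (size s <= n)%N -> continuous (pderiv s f)) /\
  (forall (s : seq 'I_d) i x,
     (size s < n)%N -> derivable (pderiv s f) x (delta_mx 0 i)).

(* Pointwise Euclidean norm of the tensor of all k-th order partial derivatives
   of all entries of a matrix field (a vector field being the case n = 1). *)
Definition nabla_norm m n (k : nat) (F : 'rV[R]_d -> 'M[R]_(m, n)) x : R :=
  Num.sqrt (\sum_(s : k.-tuple 'I_d) \sum_i \sum_j
    (pderiv s (fun y => F y i j) x) ^+ 2).

Definition grad phi x : 'cV[R]_d := \col_i pderiv [:: i] phi x.

Definition dot (v w : 'cV[R]_d) : R := \sum_i v i 0 * w i 0.

Definition test_function phi := torus_periodic phi /\ forall n, classC n phi.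

(* u is in H^1 of the torus with weak gradient Du. *)
Definition H1_gradient u (Du : 'rV[R]_d -> 'cV[R]_d) :=
  [/\ torus_periodic u, torus_periodic Du, torus_L2 u,
      forall i, torus_L2 (fun x => Du x i 0) &
      forall phi, test_function phi -> forall i,
        torus_int (fun x => u x * grad phi x i 0) =
        - torus_int (fun x => Du x i 0 * phi x)].

(* - div (a Du) = div g in the sense of distributions on the torus. *)
Definition elliptic_solution (a : 'rV[R]_d -> 'M[R]_d)
    (g Du : 'rV[R]_d -> 'cV[R]_d) :=
  forall phi, test_function phi ->
    torus_int (fun x => dot (grad phi x) (a x *m Du x)) =
    - torus_int (fun x => dot (grad phi x) (g x)).

Definition cnorm n (v : 'cV[R[i]]_n) : R :=
  Num.sqrt (\sum_i (complex.Re (v i 0) ^+ 2 + complex.Im (v i 0) ^+ 2)).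

Definition torus_L2norm (F : 'rV[R]_d -> 'cV[R[i]]_d) : \bar R :=
  torus_norm 2%:E (fun x => cnorm (F x)).

Definition opnorm (V : Type) (N : V -> R) (T : V -> V) : R :=
  sup [set N (T v) | v in [set v | N v <= 1]].

End torus_functions.

(* e^{i t} *)
Definition expi {R : realType} (t : R) : R[i] := cos t +i* sin t.

(* The index m of a frequency 2 pi m is kept modulo 2^L in each coordinate, so
   that k - k' below is the periodic difference. The type 'Z_(2 ^ L) is Z/2^L
   only for L >= 1. *)
Definition grid (L d : nat) := 'rV['Z_(2 ^ L)]_d.

Section discretization.
Context {R : realType} {d L : nat}.
Local Notation gfield := (grid L d -> 'cV[R[i]]_d).
Local Notation cmx := (map_mx (real_complex R)).

(* the representative of a class mod 2^L in {-2^(L-1), ..., 2^(L-1) - 1} *)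
Definition signed_rep (j : 'Z_(2 ^ L)) : int :=
  if (j < 2 ^ L.-1)%N then j%:Z else j%:Z - (2 ^ L)%N%:Z.

Definition wave (k : grid L d) : 'rV[R]_d :=
  \row_i (2 * pi * (signed_rep (k 0 i))%:~R).

Definition phase (k : grid L d) (x : 'rV[R]_d) : R :=
  \sum_i wave k 0 i * x 0 i.

Definition interpolate (phi : gfield) (x : 'rV[R]_d) : 'cV[R[i]]_d :=
  (2 `^ (- (L * d)%N%:R / 2))%:C *: \sum_k expi (- phase k x) *: phi k.

Definition grid_dot (zeta phi : gfield) : R[i] :=
  \sum_k ((zeta k) ^t* *m phi k) 0 0.

Definition grid_norm (phi : gfield) : R := Num.sqrt (\sum_k cnorm (phi k) ^+ 2).

Definition convol (ah : grid L d -> 'M[R[i]]_d) (phi : gfield) : gfield :=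
  fun k => \sum_k' ah (k - k') *m phi k'.

Definition hermitian_operator (T : gfield -> gfield) :=
  forall zeta phi, grid_dot zeta (T phi) = grid_dot (T zeta) phi.

(* The Euler-Lagrange system (ah* + mu ph) psi = - gh of the functional
   psi^dagger (ah * psi) / 2 + Re (psi^dagger gh)
     + mu psi^dagger (ph psi) / 2. *)
Definition discrete_minimizer (mu : R) (ah ph : grid L d -> 'M[R[i]]_d)
    (gh psi : gfield) :=
  forall k, convol ah psi k + mu%:C *: (ph k *m psi k) = - gh k.

(* A is the operator on grid fields given by
   zeta^dagger A phi = 2^(Ld) \int conj zeta . a phi. *)
Definition exact_operator (a : 'rV[R]_d -> 'M[R]_d) (A : gfield -> gfield) :=
  forall zeta phi, grid_dot zeta (A phi) = (2 ^+ (L * d)%N)%:C *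
    torus_intC (fun x =>
      ((interpolate zeta x) ^t* *m cmx (a x) *m interpolate phi x) 0 0).

Definition leray (k : grid L d) : 'M[R[i]]_d :=
  if k == 0 then 1%:M else
  cmx (1%:M - (\sum_i wave k 0 i ^+ 2)^-1 *: ((wave k)^T *m wave k)).

Definition exact_source (g : 'rV[R]_d -> 'cV[R]_d) : gfield := fun k =>
  \col_j ((2 `^ ((L * d)%N%:R / 2))%:C *
    torus_intC (fun x => (g x j 0)%:C * expi (phase k x))).

Definition nu_a (ah : grid L d -> 'M[R[i]]_d) (A : gfield -> gfield) : R :=
  opnorm grid_norm (fun phi k => convol ah phi k - A phi k).

Definition nu_P (ph : grid L d -> 'M[R[i]]_d) : R :=
  \big[Num.max/0]_k opnorm (@cnorm R d) (mulmx (ph k - leray k)).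

Definition nu_g (g : 'rV[R]_d -> 'cV[R]_d) (gh : gfield) : R :=
  2 `^ (- (L * d)%N%:R / 2) * grid_norm (fun k => gh k - exact_source g k).

End discretization.

(* Main.v *)
(* Write w and q for the exact Fourier coefficients on the grid of Du and of the flux
   a Du + g. The first is a gradient and the second is divergence free, so that
   leray * w = 0 and leray * q = q. Inserting the ansatz psi = w - q / mu + z into the
   discrete system, the exact data cancel: what is left on the right of the equation for z
   are the residuals applied to w, q, the term A q / mu and the consistency error
   A w - (a Du)^. Ellipticity and the smallness assumption make the operator on the left
   coercive, since leray is nonnegative, and this bounds z.

   The consistency error is controlled by the L^2 tail of Du over frequencies outside the
   grid, i.e. by eps^-p times the L^2 norm of p-th order differences of Du. These are
   bounded by induction on the order: the differences D^n Du and D^n (a Du + g) are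
   orthogonal in L^2, and D^n (a Du) - a D^n Du only involves differences of Du of order
   less than n. Working with finite differences keeps derivatives off Du, which is only a
   weak gradient. Orthogonality and the tail bound follow from Parseval's identity. *)

Require Import Defs.
From HB Require Import structures.
From mathcomp Require Import all_boot all_order all_algebra.
From mathcomp Require Import complex ring lra zify.
From mathcomp Require Import all_classical all_reals all_analysis.
From mathcomp Require Import measurable_realfun ess_sup_inf.

Set Implicit Arguments.
Unset Strict Implicit.
Unset Printing Implicit Defensive.

Import Order.TTheory GRing.Theory Num.Theory.
Import numFieldNormedType.Exports.

Local Open Scope classical_set_scope.
Local Open Scope ring_scope.

(** * Lebesgue measure on the torus *)

(** The penalty fixes the divergence-free part of psi only up to order 1/mu. The corrector
    [- q / mu] is that deviation: [mu leray (q / mu) = q] absorbs the flux, which would otherwise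
    stay in the equation for z at order one. Its price, [A q / mu], and its own size are the origin
    of [mu^-1] in the estimate. The smallness assumption leaves half of the ellipticity constant,
    whence the factors [2 * lam].

    Complex fields are handled as pairs of real functions, and only real parts of Hermitian products
    are used. The grid contains the frequency -2^(L-1) but not its opposite, so truncating the
    Fourier series of a real field may give a non-real interpolate. Its imaginary part has to be
    estimated too, which is why real and imaginary parts occur together in the Parseval identities.

    The regularity bounds are uniform in the step length. In the tail estimate the step may thus be
    chosen after a finite set of frequencies has been fixed, so small that |e^(iy) - 1| is
    comparable to |y|; it then cancels, and no limit of difference quotients of Du is taken.
    Parseval itself rests on the L^2 density of trigonometric polynomials, reached through
    indicators of sets {t_i < b}. *)

Section unit_interval.
Context {R : realType}.
Local Notation T := (measurableTypeR R).
Local Notation leb := (@lebesgue_measure R).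
Local Notation unif := (uniform_prob (@ltr01 R)).

Lemma lebesgue_measure_shift (h : R) (A : set R) : measurable A ->
  leb ((fun x => x + h) @^-1` A) = leb A.
Proof.
move=> mA; have mf : measurable_fun [set: T] (fun x : T => x + h : T).
  exact: measurable_funD.
rewrite -[LHS]/(pushforward leb (fun x => x + h : T) A).
apply/esym/lebesgue_measure_unique => //= _ [[a b]] _ <-.
rewrite /pushforward (_ : _ @^-1` _ = `]a - h, b - h]%classic); last first.
  by apply/seteqP; split=> x /=; rewrite !in_itv/= ltrBlDr lerBrDr.
by rewrite !lebesgue_measure_itv/= !lte_fin ltrD2r; case: ifPn => // _;
  rewrite -!EFinD; congr (_%:E); rewrite opprB addrA subrK.
Qed.

(** The half-open interval is a fundamental domain of R/Z, on which translation modulo 1 is a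
    bijection; removing the endpoint 1 costs a null set. *)
Lemma uniform_prob01E (A : set T) : measurable A ->
  unif A = leb (A `&` `[0, 1[%classic).
Proof.
move=> mA; rewrite /uniform_prob integral_uniform_pdf.
rewrite (eq_integral (cst 1%E)); last first.
  move=> x; rewrite inE => -[_ /=]; rewrite in_itv/= => x01.
  by rewrite /uniform_pdf x01 subr0 invr1.
rewrite integral_cst ?mul1e; last exact: measurableI.
apply/eqP; rewrite eq_le; apply/andP; split; last first.
  apply: le_measure; rewrite ?inE; [exact: measurableI|exact: measurableI|].
  by apply: setIS => x /=; rewrite !in_itv/= => /andP[-> /ltW].
have <- : leb (A `&` `[0, 1[%classic `|` [set 1]) = leb (A `&` `[0, 1[%classic).
  by apply: measureU0 => //; [exact: measurableI|exact: lebesgue_measure_set1].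
apply: le_measure; rewrite ?inE; [exact: measurableI| |].
  by apply: measurableU => //; exact: measurableI.
move=> x [Ax] /=; rewrite !in_itv/= => /andP[x0]; rewrite le_eqVlt.
by case/orP => [/eqP ->|x1]; [right|left; split => //; rewrite x0].
Qed.

(** Translation by [h] modulo 1: a single subtraction suffices when both [h] and [x] lie in [0,
    1). *)
Definition wrap01 (h x : T) : T := if x + h < 1 then x + h else x + h - 1.

Lemma measurable_wrap01 h : measurable_fun [set: T] (wrap01 h).
Proof.
apply: measurable_fun_if => //=.
- by apply: measurable_fun_ltr => //; exact: measurable_funD.
- by apply: measurable_funTS; exact: measurable_funD.
- apply: measurable_funTS; apply: measurable_funB => //.
  exact: measurable_funD.
Qed.

(** Cut [0, 1) at [1 - h]: the left piece moves by [h] onto [h, 1), the right one by [h - 1] onto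
    [0, h), and Lebesgue measure is translation invariant. *)
Lemma uniform_prob_wrap01 (h : R) (A : set T) : 0 <= h < 1 -> measurable A ->
  unif (wrap01 h @^-1` A) = unif A.
Proof.
move=> /andP[h0 h1] mA.
have mI (B : set T) a b : measurable B -> measurable (B `&` `[a, b[%classic).
  by move=> mB; exact: measurableI.
have mS a : measurable ((fun x : T => x + a) @^-1` A).
  rewrite -[X in measurable X]setTI.
  by apply: (_ : measurable_fun _ _) => //; exact: measurable_funD.
have split01 (B : set T) (c : R) : 0 <= c -> c <= 1 -> measurable B ->
    leb (B `&` `[0, 1[%classic) =
    adde (leb (B `&` `[0, c[%classic)) (leb (B `&` `[c, 1[%classic)).
  move=> c0 c1 mB; transitivity (leb ((B `&` `[0, c[%classic) `|` (B `&` `[c, 1[%classic))); last first.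
    apply: measureU; [exact: mI|exact: mI|].
    apply/seteqP; split => x //= -[[_ +] [_]]; rewrite !in_itv/=.
    by move=> /andP[_ xc] /andP[+ _]; rewrite leNgt xc.
  rewrite -setIUr; congr (leb (_ `&` _)); apply/seteqP; split => x /=.
      by rewrite !in_itv/= => /andP[-> ->]; case: ltP; [left|right].
    rewrite !in_itv/= => -[/andP[x1 x2]|/andP[x1 x2]]; apply/andP; split => //.
    exact: lt_le_trans c1.
  exact: le_trans x1.
rewrite !uniform_prob01E //; last first.
  by rewrite -[X in measurable X]setTI; exact: measurable_wrap01.
have h1' : 0 <= 1 - h by rewrite subr_ge0 ltW.
have h1'' : 1 - h <= 1 by rewrite gerBl.
rewrite (split01 _ (1 - h)) //; last first.
  by rewrite -[X in measurable X]setTI; exact: measurable_wrap01.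
rewrite (split01 A h) ?(ltW h1)// [RHS]addeC; congr adde.
- rewrite -[RHS](lebesgue_measure_shift h); last exact: mI.
  congr (leb _); apply/seteqP; split => x /=; rewrite /wrap01 !in_itv/=.
    move=> [+ /andP[x1 x2]]; rewrite (_ : (x + h < 1)); last by lra.
    by split => //; apply/andP; split; lra.
  move=> [Ax /andP[x1 x2]]; rewrite (_ : (x + h < 1)); last by lra.
  by split => //; apply/andP; split; lra.
- rewrite -[RHS](lebesgue_measure_shift (h - 1)); last exact: mI.
  congr (leb _); apply/seteqP; split => x /=; rewrite /wrap01 !in_itv/=.
    move=> [+ /andP[x1 x2]]; rewrite ltNge -lerBlDr x1/= addrA => ?; split=> //.
    by apply/andP; split; lra.
  move=> [Ax /andP[x1 x2]]; rewrite (_ : (x + h < 1) = false); last first.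
    by apply/negbTE; rewrite -leNgt; lra.
  by rewrite -addrA; split => //; apply/andP; split; lra.
Qed.

End unit_interval.

Section torus_measure_theory.
Context {R : realType}.
Local Notation T := (measurableTypeR R).
Local Notation unif := (uniform_prob (@ltr01 R)).

Definition wrapt d (h : 'I_d -> R) (t : d.-tuple T) : d.-tuple T :=
  [tuple wrap01 (h i) (tnth t i) | i < d].

Lemma measurable_wrapt d (h : 'I_d -> R) : measurable_fun setT (wrapt h).
Proof.
apply/measurable_fun_tnthP => i.
rewrite (_ : _ \o _ = wrap01 (h i) \o (@tnth _ T ^~ i)); last first.
  by apply/funext => t /=; rewrite tnth_mktuple.
by apply: measurableT_comp; [exact: measurable_wrap01|exact: measurable_tnth].
Qed.

Lemma torus_measureS d (A : set (d.+1.-tuple T)) :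
  torus_measure R d.+1 A =
  (unif \x torus_measure R d)%E (@tuple_cons R d @^-1` A).
Proof. by []. Qed.

(** By uniqueness of product measures it is enough to compare both sides on rectangles, where the
    one-dimensional invariance handles the first factor and the induction hypothesis the second. *)
Lemma torus_measure_wrapt d (h : 'I_d -> R) (A : set (d.-tuple T)) :
  (forall i, 0 <= h i < 1) -> measurable A ->
  torus_measure R d (wrapt h @^-1` A) = torus_measure R d A.
Proof.
elim: d h A => [|d IH] h A h01 mA.
  congr (torus_measure R 0 _); apply/seteqP; split => t /=;
  by rewrite (tuple0 t) (tuple0 (wrapt h _)).
rewrite !torus_measureS.
pose h' i := h (lift ord0 i).
pose w (z : T * d.-tuple T) := (wrap01 (h ord0) z.1, wrapt h' z.2).
have mw : measurable_fun setT w.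
  apply/measurable_fun_pairP; split.
    exact: (measurableT_comp (measurable_wrap01 _) measurable_fst).
  exact: (measurableT_comp (measurable_wrapt _) measurable_snd).
have mc : measurable (@tuple_cons R d @^-1` A).
  by rewrite -[X in measurable X]setTI; exact: measurable_tuple_cons.
rewrite (_ : _ @^-1` _ = w @^-1` (@tuple_cons R d @^-1` A)); last first.
  apply/seteqP; split => -[z t] /=; rewrite (_ : wrapt _ _ = tuple_cons (w (z, t))) //;
  apply: eq_from_tnth => i; rewrite tnth_mktuple;
  by case: (unliftP ord0 i) => [j ->|->]; rewrite ?tnthS ?tnth_mktuple ?tnth0.
rewrite [RHS](product_measure_unique (m' := pushforward (unif \x torus_measure R d)%E w))//.
move=> B C mB mC; rewrite /pushforward.
change ((unif \x torus_measure R d)%E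
  ((wrap01 (h ord0) @^-1` B) `*` (wrapt h' @^-1` C)) = (unif B * torus_measure R d C)%E).
rewrite product_measure1E.
- congr mule; first exact: uniform_prob_wrap01.
  by apply: IH => // i; exact: h01.
- by rewrite -[X in measurable X]setTI; exact: measurable_wrap01.
- by rewrite -[X in measurable X]setTI; exact: measurable_wrapt.
Qed.

Lemma torus_measure_box d (B : 'I_d -> set T) : (forall i, measurable (B i)) ->
  torus_measure R d [set t | forall i, B i (tnth t i)] =
  (\prod_(i < d) unif (B i))%E.
Proof.
elim: d B => [|d IH] B mB.
  rewrite big_ord0 (_ : [set _ | _] = setT) ?probability_setT//.
  by apply/seteqP; split => t // _ [].
rewrite torus_measureS big_ord_recl/= -IH// -product_measure1E//.
  congr (_ _); apply/seteqP; split => -[z t] /=.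
    move=> Bt; split; first exact: (Bt ord0).
    by move=> i; have := Bt (lift ord0 i); rewrite tnthS.
  move=> [Bz Bt] i; case: (unliftP ord0 i) => [j ->|->]; last by rewrite tnth0.
  by rewrite tnthS; exact: Bt.
rewrite (_ : [set _ | _] = \bigcap_(i in [set: 'I_d]) (@tnth d T ^~ i @^-1` B (lift ord0 i))).
  apply: fin_bigcap_measurable => // i _.
  by rewrite -[X in measurable X]setTI; exact: measurable_tnth.
by apply/seteqP; split => t /= Ht i; [move=> _; exact: Ht|exact: Ht].
Qed.

End torus_measure_theory.

(** * Square integrable periodic functions *)

Section torus_l2.
Context {R : realType} {d : nat}.
Local Notation T := (measurableTypeR R).
Local Notation mu := (torus_measure R d).
Local Notation pt := (@torus_pt R d).
Implicit Types (f g b : 'rV[R]_d -> R) (x h : 'rV[R]_d).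

Definition tmeas f := measurable_fun setT (f \o pt).

Lemma torus_L2P f : torus_L2 f <->
  tmeas f /\ mu.-integrable setT (fun t => (f (pt t) ^+ 2)%:E).
Proof.
split=> [f2|[mf f2]].
  split; last exact: (Lfun2_integrable_sqr f2).
  by move: f2; rewrite /torus_L2 inE => /andP[]; rewrite inE.
rewrite /torus_L2 inE; apply/andP; split; rewrite inE//=.
rewrite /finite_norm unlock poweR_lty//.
have /integrableP[_] := f2; apply: le_lt_trans.
apply: ge0_le_integral => //.
- by move=> t _; rewrite poweR_ge0.
- apply/measurable_EFinP.
  apply: (@measurableT_comp _ _ _ _ _ _ (fun x : R => x `^ 2)).
    exact: measurable_powR.
  exact: measurableT_comp.
- by apply: measurableT_comp => //; apply/measurable_EFinP; exact: measurable_funX.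
- by move=> t _ /=; rewrite lee_fin normrX powR_mulrn.
Qed.

Lemma torus_L2_tmeas f : torus_L2 f -> tmeas f.
Proof. by case/torus_L2P. Qed.

Lemma torus_L2D f g : torus_L2 f -> torus_L2 g -> torus_L2 (fun x => f x + g x).
Proof. by move=> f2 g2; exact: (Lfun_addr_closed mu (lee1n 2)).2. Qed.

Lemma torus_L2Z c f : torus_L2 f -> torus_L2 (fun x => c * f x).
Proof.
move=> /(Lfun_scale c (ler1n R 2)) H.
by rewrite /torus_L2 (_ : _ \o _ = c \o* (f \o pt))//; apply/funext => t /=; rewrite mulrC.
Qed.

Lemma torus_L2M f g : torus_L2 f -> torus_L2 g ->
  mu.-integrable setT (fun t => (f (pt t) * g (pt t))%:E).
Proof. by move=> f2 g2; apply/Lfun1_integrable; exact: Lfun2_mul_Lfun1. Qed.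

Lemma torus_L2_mul_bounded b f M : tmeas b -> (forall x, `|b x| <= M) ->
  torus_L2 f -> torus_L2 (fun x => b x * f x).
Proof.
move=> mb bM /torus_L2P[mf f2]; apply/torus_L2P.
have mbf : tmeas (fun x => b x * f x) by exact: measurable_funM.
split => //.
apply: (@le_integrable _ _ _ mu _ measurableT _ (fun t => (M ^+ 2)%:E * (f (pt t) ^+ 2)%:E)%E).
- by apply/measurable_EFinP; exact: measurable_funX.
- move=> t _ /=; rewrite lee_fin exprMn !normrM.
  rewrite ler_wpM2r ?mulr_ge0//.
  by rewrite ler_pM// (le_trans (bM _)) ?ler_norm.
- exact: integrableZl.
Qed.

Lemma torus_L2_bounded f M : tmeas f -> (forall x, `|f x| <= M) -> torus_L2 f.
Proof.
move=> mf fM; have := @torus_L2_mul_bounded f (cst 1) M mf fM.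
rewrite (_ : (fun x => _) = f); last by apply/funext => x; rewrite mulr1.
by apply; exact: Lfun_cst.
Qed.

Lemma periodic_int (V : zmodType) (f : 'rV[R]_d -> V) (m : 'I_d -> int) x :
  torus_periodic f -> f (x + \row_i (m i)%:~R) = f x.
Proof.
move=> pf.
have -> : \row_i (m i)%:~R = \sum_(i < d) (m i)%:~R *: delta_mx 0 i :> 'rV[R]_d.
  apply/rowP => j; rewrite mxE summxE (bigD1 j)//= big1 => [|i ij].
    by rewrite !mxE !eqxx mulr1 addr0.
  by rewrite !mxE eqxx/= eq_sym (negbTE ij) mulr0.
elim/big_ind: _ x => [x|u v Hu Hv x|i _ x]; first by rewrite addr0.
  by rewrite addrA Hv Hu.
have pn n y : f (y + n%:R *: delta_mx 0 i) = f y.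
  elim: n y => [|n IH] y; first by rewrite scale0r addr0.
  by rewrite -[n.+1]addn1 natrD scalerDl addrA scale1r pf IH.
case: (m i) => n; first exact: pn.
by rewrite NegzE mulrNz scaleNr -(pn n.+1 (x - _)) subrK.
Qed.

(** For a periodic function, wrapping the sample point is the same as translating the argument. This
    transfers the invariance of the measure to shifts on R^d. *)
Lemma torus_pt_wrapt f h : torus_periodic f ->
  f \o pt \o wrapt (fun i => h 0 i) = (fun x => f (x + h)) \o pt.
Proof.
move=> pf; apply/funext => t /=.
rewrite -[RHS](periodic_int (fun i => if tnth t i + h 0 i < 1 then 0 else -1))//.
congr f; apply/rowP => i; rewrite !mxE tnth_mktuple /wrap01.
by case: (_ < 1); rewrite ?addr0.
Qed.

(** Shifts are kept in the unit cube because [wrap01] subtracts at most 1. *)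
Definition ushift h := forall i, 0 <= h 0 i < 1.

Lemma torus_measure_pushforward h (A : set (d.-tuple T)) : ushift h ->
  measurable A -> pushforward mu (wrapt (fun i => h 0 i)) A = mu A.
Proof. by move=> h01 mA; rewrite -[RHS](torus_measure_wrapt h01). Qed.

Lemma tmeas_shift f h : torus_periodic f -> tmeas f -> tmeas (fun x => f (x + h)).
Proof.
move=> pf mf; rewrite /tmeas -torus_pt_wrapt//.
by apply: measurableT_comp => //; exact: measurable_wrapt.
Qed.

Lemma integrable_shift f h : ushift h -> torus_periodic f ->
  mu.-integrable setT (EFin \o (f \o pt)) ->
  mu.-integrable setT (EFin \o ((fun x => f (x + h)) \o pt)).
Proof.
move=> h01 pf /integrableP[mf lf]; rewrite -torus_pt_wrapt//.
have mw := measurable_wrapt (fun i => h 0 i).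
apply/integrableP; split; first exact: (measurableT_comp mf mw).
have := @ge0_integral_pushforward _ _ _ _ R _ mw mu setT
  (abse \o (EFin \o (f \o pt))) measurableT.
rewrite preimage_setT => <-.
- rewrite (eq_measure_integral mu)// => A mA _.
  exact: torus_measure_pushforward.
- exact: (measurableT_comp (@abse_measurable R setT) mf).
- by move=> t _; exact: abse_ge0.
Qed.

Lemma torus_int_shift f h : ushift h -> torus_periodic f ->
  mu.-integrable setT (EFin \o (f \o pt)) ->
  torus_int (fun x => f (x + h)) = torus_int f.
Proof.
move=> h01 pf lf; rewrite /torus_int /Rintegral; congr fine.
have mw := measurable_wrapt (fun i => h 0 i).
have := integrable_shift h01 pf lf; rewrite -torus_pt_wrapt// => lf'.
transitivity (\int[mu]_t ((EFin \o (f \o pt)) \o wrapt (fun i => h 0%R i)) t)%E.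
  by apply: eq_integral => t _ /=; congr EFin; have /funeqP/(_ t) := torus_pt_wrapt h pf.
have /integrableP[mf _] := lf.
have := @integral_pushforward _ _ _ _ R _ mw mu setT (EFin \o (f \o pt)) mf.
rewrite preimage_setT => <- //.
by apply: eq_measure_integral => A mA _; exact: torus_measure_pushforward.
Qed.

Lemma torus_L2_shift f h : ushift h -> torus_periodic f -> torus_L2 f ->
  torus_L2 (fun x => f (x + h)).
Proof.
move=> h01 pf /torus_L2P[mf f2]; apply/torus_L2P; split; first exact: tmeas_shift.
apply: (@integrable_shift (fun x => f x ^+ 2)) => //.
by move=> i x /=; rewrite pf.
Qed.

Definition l2 f := torus_periodic f /\ torus_L2 f.

Lemma periodic_shift (V : zmodType) (F : 'rV[R]_d -> V) h :
  torus_periodic F -> torus_periodic (fun x => F (x + h)).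
Proof. by move=> pF i x; rewrite addrAC pF. Qed.

Lemma l2D f g : l2 f -> l2 g -> l2 (fun x => f x + g x).
Proof.
move=> [pf f2] [pg g2]; split; last exact: torus_L2D.
by move=> i x; rewrite pf pg.
Qed.

Lemma l2Z c f : l2 f -> l2 (fun x => c * f x).
Proof.
by move=> [pf f2]; split; [move=> i x; rewrite pf|exact: torus_L2Z].
Qed.

Lemma l2N f : l2 f -> l2 (fun x => - f x).
Proof.
by move=> /(l2Z (-1)); congr l2; apply/funext => x; rewrite mulN1r.
Qed.

Lemma l2B f g : l2 f -> l2 g -> l2 (fun x => f x - g x).
Proof. by move=> f2 g2; apply: l2D => //; exact: l2N. Qed.

Lemma l2_cst c : l2 (cst c).
Proof. by split => //; exact: Lfun_cst. Qed.

Lemma l2_sum I (r : seq I) (P : pred I) (F : I -> 'rV[R]_d -> R) :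
  (forall i, P i -> l2 (F i)) -> l2 (fun x => \sum_(i <- r | P i) F i x).
Proof.
move=> HF; elim: r => [|i r IH].
  by under eq_fun do rewrite big_nil; exact: l2_cst.
under eq_fun do rewrite big_cons.
by case: (boolP (P i)) => // Pi; apply: l2D => //; exact: HF.
Qed.

Lemma l2_shift f h : ushift h -> l2 f -> l2 (fun x => f (x + h)).
Proof.
by move=> h01 [pf f2]; split; [exact: periodic_shift|exact: torus_L2_shift].
Qed.

Lemma l2_mul_bounded b f M : torus_periodic b -> tmeas b ->
  (forall x, `|b x| <= M) -> l2 f -> l2 (fun x => b x * f x).
Proof.
move=> pb mb bM [pf f2]; split; first by move=> i x; rewrite pb pf.
exact: torus_L2_mul_bounded bM f2.
Qed.

Definition ip f g := torus_int (fun x => f x * g x).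
Definition nrm f := Num.sqrt (ip f f).

Lemma ipC f g : ip f g = ip g f.
Proof. by congr torus_int; apply/funext => x; rewrite mulrC. Qed.

Lemma ipDl f1 f2 g : l2 f1 -> l2 f2 -> l2 g ->
  ip (fun x => f1 x + f2 x) g = ip f1 g + ip f2 g.
Proof.
move=> [_ h1] [_ h2] [_ h3]; rewrite /ip /torus_int -RintegralD//; [|exact: torus_L2M..].
by apply: eq_Rintegral => t _; rewrite mulrDl.
Qed.

Lemma ipZl c f g : l2 f -> l2 g -> ip (fun x => c * f x) g = c * ip f g.
Proof.
move=> [_ h1] [_ h2]; rewrite /ip /torus_int -RintegralZl//; last exact: torus_L2M.
by apply: eq_Rintegral => t _; rewrite mulrA.
Qed.

Lemma ipNl f g : l2 f -> l2 g -> ip (fun x => - f x) g = - ip f g.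
Proof.
move=> f2 g2; rewrite -mulN1r -ipZl//; congr ip.
by apply/funext => x; rewrite mulN1r.
Qed.

Lemma ipBl f1 f2 g : l2 f1 -> l2 f2 -> l2 g ->
  ip (fun x => f1 x - f2 x) g = ip f1 g - ip f2 g.
Proof. by move=> h1 h2 h3; rewrite ipDl ?ipNl//; exact: l2N. Qed.

Lemma ipDr f g1 g2 : l2 f -> l2 g1 -> l2 g2 ->
  ip f (fun x => g1 x + g2 x) = ip f g1 + ip f g2.
Proof. by move=> *; rewrite ipC ipDl// !(ipC f). Qed.

Lemma ipZr c f g : l2 f -> l2 g -> ip f (fun x => c * g x) = c * ip f g.
Proof. by move=> *; rewrite ipC ipZl// (ipC f). Qed.

Lemma ipNr f g : l2 f -> l2 g -> ip f (fun x => - g x) = - ip f g.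
Proof. by move=> *; rewrite ipC ipNl// (ipC f). Qed.

Lemma ipBr f g1 g2 : l2 f -> l2 g1 -> l2 g2 ->
  ip f (fun x => g1 x - g2 x) = ip f g1 - ip f g2.
Proof. by move=> *; rewrite ipC ipBl// !(ipC f). Qed.

Lemma ip0l g : ip (cst 0) g = 0.
Proof.
rewrite /ip /torus_int; under eq_Rintegral do rewrite mul0r.
by rewrite Rintegral_cst// mul0r.
Qed.

Lemma ip_suml I (r : seq I) (P : pred I) (F : I -> 'rV[R]_d -> R) g :
  (forall i, P i -> l2 (F i)) -> l2 g ->
  ip (fun x => \sum_(i <- r | P i) F i x) g = \sum_(i <- r | P i) ip (F i) g.
Proof.
move=> HF g2; elim: r => [|i r IH].
  by under eq_fun do rewrite big_nil; rewrite big_nil; exact: ip0l.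
under eq_fun do rewrite big_cons; rewrite big_cons.
by case: (boolP (P i)) => // Pi; rewrite ipDl ?IH//; [exact: HF|exact: l2_sum].
Qed.

Lemma ip_sumr I (r : seq I) (P : pred I) (F : I -> 'rV[R]_d -> R) g :
  (forall i, P i -> l2 (F i)) -> l2 g ->
  ip g (fun x => \sum_(i <- r | P i) F i x) = \sum_(i <- r | P i) ip g (F i).
Proof. by move=> *; rewrite ipC ip_suml//; apply: eq_bigr => i _; rewrite ipC. Qed.

Lemma ip_ge0 f : 0 <= ip f f.
Proof. by apply: Rintegral_ge0 => t _; rewrite -expr2 sqr_ge0. Qed.

Lemma ip_shift f g h : ushift h -> l2 f -> l2 g ->
  ip (fun x => f (x + h)) (fun x => g (x + h)) = ip f g.
Proof.
move=> h01 [pf f2] [pg g2]; apply: (@torus_int_shift (fun x => f x * g x)) => //.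
  by move=> i x; rewrite pf pg.
exact: torus_L2M.
Qed.

Lemma nrm_ge0 f : 0 <= nrm f. Proof. exact: sqrtr_ge0. Qed.

Lemma nrm_sqr f : nrm f ^+ 2 = ip f f.
Proof. by rewrite sqr_sqrtr// ip_ge0. Qed.

Lemma nrm_shift f h : ushift h -> l2 f -> nrm (fun x => f (x + h)) = nrm f.
Proof. by move=> h01 f2; rewrite /nrm ip_shift. Qed.

Lemma nrmZ c f : l2 f -> nrm (fun x => c * f x) = `|c| * nrm f.
Proof.
move=> f2; rewrite /nrm ipZl ?ipZr//; last exact: l2Z.
by rewrite mulrA -expr2 sqrtrM ?sqr_ge0// sqrtr_sqr.
Qed.

Lemma nrmN f : l2 f -> nrm (fun x => - f x) = nrm f.
Proof.
by move=> f2; rewrite /nrm ipNl ?ipNr ?opprK//; exact: l2N.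
Qed.

Lemma ler_ip f g : l2 f -> l2 g -> (forall x, `|f x| <= `|g x|) ->
  ip f f <= ip g g.
Proof.
move=> [_ f2] [_ g2] fg; apply: le_Rintegral => //; [exact: torus_L2M..|].
by move=> t _; rewrite -!expr2 -(real_normK (num_real (f _))) -(real_normK (num_real (g _))) lerXn2r ?nnegrE.
Qed.

Lemma nrm_mul_bounded b f M : torus_periodic b -> tmeas b ->
  (forall x, `|b x| <= M) -> l2 f -> nrm (fun x => b x * f x) <= M * nrm f.
Proof.
move=> pb mb bM f2; have M0 : 0 <= M := le_trans (normr_ge0 _) (bM 0).
rewrite -[X in X * _](ger0_norm M0) -nrmZ// ler_wsqrtr//; apply: ler_ip.
- exact: l2_mul_bounded bM f2.
- exact: l2Z.
- by move=> x; rewrite !normrM ler_wpM2r// (ger0_norm M0).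
Qed.

Lemma ip_cauchy f g : l2 f -> l2 g -> `|ip f g| <= nrm f * nrm g.
Proof.
move=> f2 g2; rewrite /nrm -sqrtrM ?ip_ge0// -sqrtr_sqr ler_wsqrtr//.
have quad s t : 0 <= s ^+ 2 * ip f f - 2 * s * t * ip f g + t ^+ 2 * ip g g.
  have := ip_ge0 (fun x => s * f x - t * g x).
  have sf := l2Z s f2; have tg := l2Z t g2; have stg := l2B sf tg.
  rewrite ipBl// !ipBr// !ipZl// !ipZr// (ipC g f).
  by congr (_ <= _); ring.
have [gg0|gg0] := eqVneq (ip g g) 0.
  (* With [ip g g = 0] the quadratic form at this point equals -(ip f g)^2 (2 + ip f f), which
     forces [ip f g = 0]. *)
  have := quad (ip f g) (1 + ip f f); have := quad (- ip f g) (- (1 + ip f f)).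
  rewrite gg0 !mulr0 !addr0 => _; have := ip_ge0 f; nra.
have {}gg0 : 0 < ip g g by rewrite lt0r gg0 ip_ge0.
have := quad (ip g g) (ip f g).
have -> : ip g g ^+ 2 * ip f f - 2 * ip g g * ip f g * ip f g +
  ip f g ^+ 2 * ip g g = ip g g * (ip f f * ip g g - ip f g ^+ 2) by ring.
by rewrite pmulr_rge0// subr_ge0.
Qed.

Lemma ler_ip_nrm f g : l2 f -> l2 g -> ip f g <= nrm f * nrm g.
Proof. by move=> f2 g2; apply: le_trans (ip_cauchy f2 g2); exact: ler_norm. Qed.

Lemma nrmD f g : l2 f -> l2 g -> nrm (fun x => f x + g x) <= nrm f + nrm g.
Proof.
move=> f2 g2; have fg := l2D f2 g2.
rewrite -(@ler_pXn2r _ 2)// ?nnegrE ?addr_ge0 ?nrm_ge0//.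
rewrite sqrrD !nrm_sqr ipDl// !ipDr// (ipC g f).
have := ler_ip_nrm f2 g2; lra.
Qed.

Lemma nrmB f g : l2 f -> l2 g -> nrm (fun x => f x - g x) <= nrm f + nrm g.
Proof. by move=> f2 g2; rewrite -(nrmN g2); apply: nrmD => //; exact: l2N. Qed.

Lemma nrm_sum I (r : seq I) (F : I -> 'rV[R]_d -> R) :
  (forall i, l2 (F i)) ->
  nrm (fun x => \sum_(i <- r) F i x) <= \sum_(i <- r) nrm (F i).
Proof.
move=> HF; elim: r => [|i r IH].
  under eq_fun do rewrite big_nil; rewrite big_nil.
  by rewrite /nrm ip0l sqrtr0.
under eq_fun do rewrite big_cons; rewrite big_cons.
by apply: le_trans (nrmD _ _) _ => //; [exact: l2_sum|rewrite lerD2l].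
Qed.

End torus_l2.

(** * Continuous periodic functions *)

Section torus_continuous.
Context {R : realType} {d : nat}.
Local Notation T := (measurableTypeR R).
Local Notation mu := (torus_measure R d).
Local Notation pt := (@torus_pt R d).
Implicit Types (f g b : 'rV[R]_d -> R) (x h : 'rV[R]_d).

Lemma measurable_tuple_box (B : 'I_d -> set T) : (forall i, measurable (B i)) ->
  measurable [set t : d.-tuple T | forall i, B i (tnth t i)].
Proof.
move=> mB.
rewrite (_ : [set _ | _] = \bigcap_(i in [set: 'I_d]) (@tnth d T ^~ i @^-1` B i)).
  apply: fin_bigcap_measurable => // i _.
  by rewrite -[X in measurable X]setTI; exact: measurable_tnth.
by apply/seteqP; split => t /= Ht i; [move=> _; exact: Ht|exact: Ht].
Qed.

(* f is the pointwise limit of its values on the grids (Z/n)^d. *)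
Lemma tmeas_continuous f : continuous f -> tmeas f.
Proof.
move=> cf.
pose fl n (y : R) : int := Num.floor (y * n.+1%:R).
pose gr n (m : 'I_d -> int) : 'rV[R]_d := \row_i ((m i)%:~R / n.+1%:R).
apply: (@measurable_fun_cvg _ _ _ _ (fun n (t : d.-tuple T) => f (gr n (fun i => fl n (tnth t i))))).
  move=> n _ Y mY; rewrite setTI.
  rewrite (_ : _ @^-1` Y = \bigcup_(m : {ffun 'I_d -> int})
     (if `[< Y (f (gr n m)) >] then [set t : d.-tuple T | forall i, [set y | fl n y = m i] (tnth t i)] else set0)).
    apply: countable_bigcupT_measurable => [|m]; first exact: countableP.
    case: ifPn => // _; apply: (measurable_tuple_box (B := fun i => [set y | fl n y = m i])) => i.
    rewrite (_ : [set y | _] = `[(m i)%:~R / n.+1%:R, (m i + 1)%:~R / n.+1%:R[%classic)//.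
    apply/seteqP; split => y /=; rewrite in_itv/= ler_pdivrMr// ltr_pdivlMr//.
      by move=> <-; exact: floor_itv.
    exact: floor_def.
  apply/seteqP; split => t /=.
    move=> Yt; exists [ffun i => fl n (tnth t i)] => //.
    case: ifPn => [_ i|/asboolPn]; first by rewrite /= ffunE.
    by under [gr n _]eq_mx do rewrite ffunE.
  move=> [m _]; case: ifPn => // /asboolP Ym /= tm.
  by have -> : gr n (fun i => fl n (tnth t i)) = gr n m by apply/rowP => i; rewrite !mxE tm.
move=> t _.
suff cg : gr n (fun i => fl n (tnth t i)) @[n --> \oo] --> pt t.
  exact: (cvg_comp _ _ cg (cf (pt t))).
apply/cvg_ballP => e e0.
near=> n; split => // i j; rewrite ord1 !mxE /ball/=.
have n0 : 0 < n.+1%:R :> R by [].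
have /andP[l1 l2] := floor_itv (tnth t j * n.+1%:R).
rewrite ger0_norm; last by rewrite subr_ge0 ler_pdivrMr.
rewrite -(ltr_pM2r n0) mulrBl.
have ne : n.+1%:R^-1 < e by near: n; exact: (near_infty_natSinv_lt (PosNum e0)).
rewrite divfK ?gt_eqF//; move: l2; rewrite intrD.
have : 1 < e * n.+1%:R by rewrite -ltr_pdivrMr// div1r.
rewrite /fl; lra.
Unshelve. all: by end_near.
Qed.

Lemma reduce_unit_cube (F : 'rV[R]_d -> R) x : torus_periodic F ->
  exists2 y : 'rV[R]_d, F y = F x & forall i, 0 <= y 0 i < 1.
Proof.
move=> pF; exists (x + \row_i (- Num.floor (x 0 i))%:~R).
  exact: periodic_int.
move=> i; rewrite !mxE mulrNz; have := floor_itv (x 0 i); rewrite intrD; lra.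
Qed.

Lemma periodic_bounded f : torus_periodic f -> continuous f ->
  exists2 M, 0 <= M & forall x, `|f x| <= M.
Proof.
move=> pf cf.
have cnf : continuous (fun x => `|f x|).
  by move=> x; apply: cvg_comp (cf x) _; exact: norm_continuous.
have [||//|c _ cM] := @EVT_max_rV R d (fun x => `|f x|)
  [set v | forall i, `[0, 1]%classic (v ord0 i)].
- by exists 0 => i /=; rewrite mxE in_itv/= lexx ler01.
- exact: (rV_compact (fun i => @segment_compact R 0 1)).
- exact: continuous_subspaceT.
exists `|f c| => // x; have [y <- y01] := reduce_unit_cube x pf.
apply: cM; rewrite inE => i /=; rewrite in_itv/=.
by have /andP[-> /ltW] := y01 i.
Qed.

Lemma l2_continuous f : torus_periodic f -> continuous f -> l2 f.
Proof.
move=> pf cf; split => //; have [M _ fM] := periodic_bounded pf cf.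
by apply: torus_L2_bounded fM; exact: tmeas_continuous.
Qed.

Lemma uniform_prob_ball_gt0 (y e : R) : 0 <= y < 1 -> 0 < e ->
  (0 < uniform_prob (@ltr01 R) (ball y e))%E.
Proof.
move=> /andP[y0 y1] e0.
rewrite uniform_prob01E; last exact: measurable_ball.
(* Only the part of the ball to the right of [y] is used: cut at 1 it stays inside [0, 1) and has
   positive length. *)
pose z := Num.min 1 (y + e).
have yz : y < z by rewrite lt_min y1 ltrDl.
apply: (@lt_le_trans _ _ (@lebesgue_measure R `[y, z[%classic)).
  by rewrite lebesgue_measure_itv/= lte_fin yz -EFinD lte_fin subr_gt0.
apply: le_measure; rewrite ?inE//; first by apply: measurableI => //; exact: measurable_ball.
move=> t /=; rewrite in_itv/= lt_min => /andP[yt /andP[t1 te]]; split.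
  by rewrite /ball/= distrC ger0_norm ?subr_ge0// ltrBlDl.
by rewrite in_itv/= t1 (le_trans y0 yt).
Qed.

(** A violation at one point may be moved into the unit cube by periodicity, and by continuity it
    persists on a small box around that point. The box has positive measure even if the boundary of
    the cube cuts it, so it cannot lie in a null set. *)
Lemma le_torus_norm_oo f M : torus_periodic f -> continuous f ->
  (torus_norm +oo f <= M%:E)%E -> forall x, `|f x| <= M.
Proof.
have muT : (0 < mu setT)%E by rewrite probability_setT.
move=> pf cf; rewrite /torus_norm unlock muT => /ess_supP.
move=> [N [mN N0 subN]] x; rewrite leNgt; apply/negP => Mx.
have [y fy y01] := reduce_unit_cube x pf; rewrite -fy in Mx => {fy x}.
have cnf : {for y, continuous (fun x => `|f x|)}.
  by apply: cvg_comp (cf y) _; exact: norm_continuous.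
have : \forall x \near y, M < `|f x| by exact: (cvgr_gt _ cnf).
move=> /nbhs_ballP[e /= e0 ye].
have mB := @measurable_tuple_box (fun i => ball (y 0 i) e) (fun i => measurable_ball _ _).
pose B := [set t : d.-tuple T | forall i, ball (y 0 i) e (tnth t i)].
have : (mu B <= mu N)%E.
  apply: le_measure; rewrite ?inE// => t /= yt; apply: subN => /= Hle.
  have : M < `|f (pt t)|.
    by apply: ye; split => // i j; rewrite ord1 mxE; exact: yt.
  by rewrite ltNge -lee_fin Hle.
rewrite (torus_measure_box (B := fun i => ball (y 0 i) e)) => [|i]; last exact: measurable_ball.
rewrite N0 leNgt => /negP; apply.
apply: (big_ind (fun z => 0 < z)%E) => [//|u v u0 v0|i _]; first exact: mule_gt0.
exact: uniform_prob_ball_gt0.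
Qed.

End torus_continuous.

(** * Trigonometric functions *)

Section line_derivative.
Context {R : realType} {d : nat}.
Implicit Types (f : 'rV[R]_d -> R) (x v : 'rV[R]_d).

Lemma line_quotient f x v (t : R) :
  (fun h : R => h^-1 *: ((f \o shift (x + t *: v)) (h *: v) - f (x + t *: v))) =
  (fun h : R => h^-1 *: (((fun s : R => f (x + s *: v)) \o shift t) (h *: 1) - f (x + t *: v))).
Proof.
apply/funext => h /=; congr (_ *: (f _ - _)).
by rewrite scalerDl addrCA -scalerA scale1r.
Qed.

Lemma derivable_line f x v (t : R) :
  derivable f (x + t *: v) v = derivable (fun s : R => f (x + s *: v)) t 1.
Proof. by rewrite /derivable line_quotient. Qed.

Lemma derive_line f x v (t : R) :
  'D_v f (x + t *: v) = 'D_1 (fun s : R => f (x + s *: v)) t.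
Proof. by rewrite /derive line_quotient. Qed.

Lemma MVT_line f x v (h : R) : 0 < h ->
  (forall t : R, derivable f (x + t *: v) v) ->
  exists2 c, 0 < c < h & f (x + h *: v) - f x = 'D_v f (x + c *: v) * h.
Proof.
move=> h0 df; have dg t : derivable (fun s : R => f (x + s *: v)) t 1.
  by rewrite -derivable_line.
have [||c] := @MVT R (fun s => f (x + s *: v)) (fun s => 'D_v f (x + s *: v)) 0 h h0.
- by move=> t _; split => //; rewrite derive_line.
- by apply: derivable_within_continuous => t _; exact: dg.
by rewrite in_itv/= => c0h; rewrite scale0r addr0 subr0 => ?; exists c.
Qed.

End line_derivative.

Section trigonometric.
Context {R : realType} {d : nat}.
Local Notation T := (measurableTypeR R).
Local Notation mu := (torus_measure R d).
Implicit Types (a b : R) (m n : 'rV[int]_d) (x h v : 'rV[R]_d).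

Definition fph m x : R := \sum_i (2 * pi * (m 0 i)%:~R) * x 0 i.
(** The real part of (a + ib) e^(-i [fph m x]); the imaginary part is [trig b (- a) m]. *)
Definition trig a b m x : R := a * cos (fph m x) + b * sin (fph m x).
Definition fcos m := trig 1 0 m.
Definition fsin m := trig 0 1 m.

Lemma fphD m x h : fph m (x + h) = fph m x + fph m h.
Proof. by rewrite /fph -big_split; apply: eq_bigr => i _; rewrite mxE mulrDr. Qed.

Lemma fphZ m (c : R) v : fph m (c *: v) = c * fph m v.
Proof. by rewrite /fph big_distrr; apply: eq_bigr => i _; rewrite mxE /= mulrCA. Qed.

Lemma fph_delta m i : fph m (delta_mx 0 i) = 2 * pi * (m 0 i)%:~R.
Proof.
rewrite /fph (bigD1 i)//= big1 => [|j ji]; first by rewrite mxE !eqxx mulr1 addr0.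
by rewrite mxE (negbTE ji) andbF mulr0.
Qed.

Lemma fphB m n x : fph (m - n) x = fph m x - fph n x.
Proof.
rewrite /fph -sumrB; apply: eq_bigr => i _.
by rewrite !mxE rmorphB /=; ring.
Qed.

Lemma fph_add m n x : fph (m + n) x = fph m x + fph n x.
Proof.
by rewrite /fph -big_split; apply: eq_bigr => i _; rewrite !mxE rmorphD /=; ring.
Qed.

Lemma fph0 x : fph 0 x = 0.
Proof. by rewrite /fph big1// => i _; rewrite mxE mulr0z mulr0 mul0r. Qed.

Lemma cos_sin_2piz (k : int) y :
  cos (y + 2 * pi * k%:~R) = cos y /\ sin (y + 2 * pi * k%:~R) = sin y :> R.
Proof.
have E (n : nat) z : z + 2 * pi * n%:R = z + (pi *+ 2) *+ n :> R.
  by rewrite mulr_natr -(mulr_natl pi 2).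
case: k => n; first by rewrite -pmulrn E !(periodicn (@cosD2pi R)) !(periodicn (@sinD2pi R)).
rewrite NegzE mulrNz mulrN -pmulrn.
have := periodicn (@cosD2pi R) n.+1 (y - 2 * pi * n.+1%:R).
have := periodicn (@sinD2pi R) n.+1 (y - 2 * pi * n.+1%:R).
by rewrite -!E subrK => -> ->.
Qed.

Lemma trig_periodic a b m : torus_periodic (trig a b m).
Proof.
move=> i x; rewrite /trig fphD fph_delta.
by have [-> ->] := cos_sin_2piz (m 0 i) (fph m x).
Qed.

Lemma continuous_fph m : continuous (fph m).
Proof.
change (continuous (fun x : 'rV[R]_d => \sum_i (2 * pi * (m 0 i)%:~R) * x 0 i)).
apply: continuous_big => [|i _ x]; first exact: add_continuous.
exact: (cvgM (cvg_cst _) (@coord_continuous R 1 d 0 i x)).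
Qed.

Lemma continuous_trig a b m : continuous (trig a b m).
Proof.
move=> x; have cm := @continuous_fph m x.
have cc : cos (fph m y) @[y --> x] --> cos (fph m x).
  exact: (cvg_comp _ _ cm (@continuous_cos R _)).
have cs : sin (fph m y) @[y --> x] --> sin (fph m x).
  exact: (cvg_comp _ _ cm (@continuous_sin R _)).
exact: (cvgD (cvgM (cvg_cst _) cc) (cvgM (cvg_cst _) cs)).
Qed.

Lemma l2_trig a b m : l2 (trig a b m).
Proof. by apply: l2_continuous; [exact: trig_periodic|exact: continuous_trig]. Qed.

Lemma is_derive_trig a b m x v :
  is_derive x v (trig a b m) (trig (fph m v * b) (- (fph m v * a)) m x).
Proof.
have E (s : R) : trig a b m (x + s *: v) =
  a * cos (fph m x + fph m v * s) + b * sin (fph m x + fph m v * s).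
  by rewrite /trig fphD fphZ [s * _]mulrC.
have D : is_derive (0 : R) 1 (fun s : R => trig a b m (x + s *: v))
    (trig (fph m v * b) (- (fph m v * a)) m x).
  rewrite (_ : (fun s => _) = (fun s => a * cos (fph m x + fph m v * s) + b * sin (fph m x + fph m v * s))); last exact/funext.
  apply: is_derive_eq; rewrite /trig mulr0 addr0 /GRing.scale/=; ring.
split.
  by rewrite -[x]addr0 -(scale0r v) derivable_line; case: D.
by rewrite -{1}[x]addr0 -(scale0r v) derive_line; case: D.
Qed.

Lemma pderiv_trig (s : seq 'I_d) a b m : exists a' b',
  pderiv s (trig a b m) = trig a' b' m.
Proof.
elim: s => [|i s [a' [b' IH]]]; first by exists a, b.
exists (fph m (delta_mx 0 i) * b'), (- (fph m (delta_mx 0 i) * a')).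
rewrite /= -/(pderiv s _) IH; apply/funext => x.
by have [_ ->] := is_derive_trig a' b' m x (delta_mx 0 i).
Qed.

Lemma trig_test a b m : test_function (trig a b m).
Proof.
split; first exact: trig_periodic.
move=> k; split=> [s _|s i x _]; have [a' [b' ->]] := pderiv_trig s a b m.
  exact: continuous_trig.
by have [] := is_derive_trig a' b' m x (delta_mx 0 i).
Qed.

Lemma trig_shift a b m x h : trig a b m (x + h) =
  trig (a * cos (fph m h) + b * sin (fph m h))
       (b * cos (fph m h) - a * sin (fph m h)) m x.
Proof. by rewrite /trig fphD cosD sinD; ring. Qed.

Lemma torus_int_trig0 a b : torus_int (trig a b 0) = a.
Proof.
rewrite /torus_int /trig; under eq_Rintegral do rewrite !fph0 cos0 sin0 mulr1 mulr0 addr0.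
rewrite Rintegral_cst// -[RHS]mulr1; congr (_ * _).
exact: (congr1 fine (probability_setT mu)).
Qed.

Lemma integrable_trig a b m :
  mu.-integrable setT (EFin \o (trig a b m \o @torus_pt R d)).
Proof.
have [_ t2] := l2_trig a b m; have [_ c2] := @l2_cst R d 1.
have := torus_L2M t2 c2; congr (_.-integrable _ _).
by apply/funext => t /=; rewrite mulr1.
Qed.

(** A shift by half a period along a coordinate with [m 0 i != 0] changes the sign of the function
    but not its integral. *)
Lemma torus_int_trig a b m : m != 0 -> torus_int (trig a b m) = 0.
Proof.
move=> m0.
have [i mi] : exists i, m 0 i != 0.
  apply/existsP; apply: contra_neqT m0 => /existsPn H; apply/rowP => i.
  by rewrite mxE; apply/eqP; rewrite -[_ == _]negbK H.
(* Half a period in direction [i]. Since [m 0 i] is a nonzero integer, [c] is at most 1/2, hence an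
   admissible shift. *)
pose c : R := (2 * `|(m 0 i)%:~R|)^-1.
have mi1 : 1 <= `|(m 0 i)%:~R| :> R by rewrite norm_intr_ge1// ?intr_int// intr_eq0.
have sh : ushift (c *: delta_mx 0 i : 'rV[R]_d).
  move=> j; rewrite !mxE eqxx/=; case: (j == i); last by rewrite mulr0 lexx ltr01.
  rewrite mulr1 /c invr_ge0 mulr_ge0//= invf_lt1; lra.
have := torus_int_shift sh (@trig_periodic a b m) (integrable_trig a b m).
have -> : (fun x => trig a b m (x + c *: delta_mx 0 i)) = trig (- a) (- b) m.
  apply/funext => x; rewrite trig_shift fphZ fph_delta.
  have [->|->] : c * (2 * pi * (m 0 i)%:~R) = pi \/ c * (2 * pi * (m 0 i)%:~R) = - pi.
  - have m0' : (m 0 i)%:~R != 0 :> R by rewrite intr_eq0.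
    rewrite /c; have [m1|m1] := lerP 0 ((m 0 i)%:~R : R).
      by left; rewrite ger0_norm//; field.
    by right; rewrite ltr0_norm//; field.
  - by rewrite cospi sinpi; congr trig; ring.
  - by rewrite cosN sinN cospi sinpi; congr trig; ring.
have -> : torus_int (trig (- a) (- b) m) = - torus_int (trig a b m).
  rewrite (_ : trig (- a) (- b) m = (fun x => -1 * trig a b m x)).
    by rewrite /torus_int RintegralZl ?mulN1r//; exact: integrable_trig.
  by apply/funext => x; rewrite /trig; ring.
lra.
Qed.

Lemma trigM a b a' b' m n x : trig a b m x * trig a' b' n x =
  trig ((a * a' + b * b') / 2) ((b * a' - a * b') / 2) (m - n) x +
  trig ((a * a' - b * b') / 2) ((b * a' + a * b') / 2) (m + n) x.
Proof.
by rewrite /trig fphB fph_add cosB cosD sinB sinD; field.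
Qed.

End trigonometric.

(** * Density of the trigonometric polynomials *)

Section step_approximation.
Context {R : realType}.
Implicit Types (s k r : R).

Lemma bernoulli_ineq (y : R) (n : nat) : -1 <= y -> 1 + n%:R * y <= (1 + y) ^+ n.
Proof.
move=> y1; elim: n => [|n IH]; first by rewrite mul0r addr0 expr0.
have y0 : 0 <= 1 + y by lra.
rewrite exprS; apply: le_trans (ler_wpM2l y0 IH).
rewrite -natr1; have := sqr_ge0 y; have : 0 <= n%:R :> R by [].
nra.
Qed.

(** With q the square root of r, n r^n = (n q^n) q^n, and Bernoulli's inequality for q^-1 = 1 + D
    bounds n q^n by 1/D. *)
Lemma cvg_nX_geometric r : 0 <= r < 1 -> n%:R * r ^+ n @[n --> \oo] --> (0 : R).
Proof.
move=> /andP[r0 r1]; have [->|rn0] := eqVneq r 0.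
  apply: cvg_near_cst; near=> n; rewrite expr0n gtn_eqF ?mulr0//.
  by near: n; exists 1%N.
have {rn0}r0 : 0 < r by rewrite lt_neqAle eq_sym rn0.
pose q := Num.sqrt r; have q0 : 0 < q by rewrite sqrtr_gt0.
have rE : r = q * q by rewrite -expr2 sqr_sqrtr// ltW.
have q1 : q < 1 by rewrite -sqrtr1 ltr_sqrt.
pose D := q^-1 - 1; have D0 : 0 < D by rewrite subr_gt0 invf_gt1.
apply: (@squeeze_cvgr _ _ _ _ (cst 0) (fun n => D^-1 * q ^+ n)); last first.
- rewrite -(mulr0 D^-1); apply: cvgM; first exact: cvg_cst.
  by apply: cvg_expr; rewrite gtr0_norm.
- exact: cvg_cst.
near=> n; rewrite mulr_ge0 ?exprn_ge0 ?(ltW r0)//= rE exprMn mulrA.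
rewrite ler_wpM2r ?exprn_ge0 ?(ltW q0)//.
rewrite -ler_pdivlMr ?exprn_gt0// -exprVn ler_pdivlMl//.
have D1 : -1 <= D by lra.
have := bernoulli_ineq n D1; rewrite (_ : 1 + D = q^-1) => [H|]; last by rewrite /D; ring.
by move: H; rewrite mulrC; lra.
Unshelve. all: by end_near.
Qed.

(** The polynomials (1 - s^n)^M of the elementary proof of the Stone-Weierstrass theorem. The
    exponent M is just above n k^-n, so that M s^n tends to 0 for s < k but is at least n for s >=
    k. *)
Definition step_poly k (n : nat) s : R :=
  (1 - s ^+ n) ^+ (Num.truncn (n%:R * k ^- n)).+1.

Lemma step_poly_bound k n s : 0 <= s <= 1 -> 0 <= step_poly k n s <= 1.
Proof.
move=> /andP[s0 s1]; have sn1 : s ^+ n <= 1 by rewrite exprn_ile1.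
have sn0 : 0 <= s ^+ n by rewrite exprn_ge0.
by rewrite exprn_ge0 ?subr_ge0//= exprn_ile1 ?subr_ge0// gerBl.
Qed.

(** Below [k], Bernoulli gives (1 - s^n)^M >= 1 - M s^n, which tends to 1. From [k] on, (1 - s^n)^M
    (1 + s^n)^M <= 1 and Bernoulli for the second factor give the bound 1/(n + 1). The threshold
    [s = k] belongs to the second case. *)
Lemma cvg_step_poly k s : 0 < k <= 1 -> 0 <= s <= 1 ->
  step_poly k n s @[n --> \oo] --> ((s < k)%R%:R : R).
Proof.
move=> /andP[k0 k1] s01; have /andP[s0 s1] := s01.
have sn0 n : 0 <= s ^+ n by rewrite exprn_ge0.
have sn1 n : s ^+ n <= 1 by rewrite exprn_ile1.
have wk0 n : 0 <= n%:R * k ^- n by rewrite mulr_ge0// invr_ge0 exprn_ge0// ltW.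
have [sk|ks] := ltP s k.
- apply: (@squeeze_cvgr _ _ _ _ (fun n => 1 - (n%:R * (s / k) ^+ n + s ^+ n)) (cst 1)); last first.
  + exact: cvg_cst.
  + rewrite -[X in _ --> X]subr0 -[X in _ - X]addr0.
    apply: cvgB; first exact: cvg_cst.
    apply: cvgD.
      by apply: cvg_nX_geometric; rewrite divr_ge0 ?(ltW k0)//= ltr_pdivrMr// mul1r.
    by apply: cvg_expr; rewrite ger0_norm// (lt_le_trans sk).
  near=> n; have /andP[_ ->] := step_poly_bound k n s01; rewrite andbT.
  have s1' : -1 <= - s ^+ n by rewrite lerN2.
  rewrite /step_poly; set M := (Num.truncn _).+1.
  have := bernoulli_ineq M s1'; apply: le_trans.
  rewrite mulrN lerD2l lerN2 /M -natr1 mulrDl mul1r lerD2r expr_div_n mulrCA mulrC.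
  by rewrite ler_wpM2l//; have /andP[] := truncn_itv (wk0 n).
- apply: (@squeeze_cvgr _ _ _ _ (cst 0) (fun n => n.+1%:R^-1)); last first.
  + exact: cvg_harmonic.
  + exact: cvg_cst.
  near=> n; have /andP[-> _] /= := step_poly_bound k n s01.
  have s1' : -1 <= s ^+ n by apply: le_trans (sn0 n); rewrite lerN10.
  rewrite /step_poly; set M := (Num.truncn _).+1.
  have HM := bernoulli_ineq M s1'.
  have nM : n%:R <= M%:R * s ^+ n.
    have /andP[_ /ltW lM] := truncn_itv (wk0 n).
    apply: le_trans (ler_wpM2r (sn0 n) lM).
    rewrite -mulrA ler_peMr// mulrC ler_pdivlMr ?exprn_gt0// mul1r.
    by rewrite lerXn2r ?nnegrE// ltW.
  have n1 : n.+1%:R <= (1 + s ^+ n) ^+ M.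
    by apply: le_trans HM; rewrite -natr1 addrC lerD2l.
  rewrite -[leRHS]mul1r ler_pdivlMr//.
  apply: (@le_trans _ _ ((1 - s ^+ n) ^+ M * (1 + s ^+ n) ^+ M)).
    by rewrite ler_wpM2l// exprn_ge0// subr_ge0.
  rewrite -exprMn -subr_sqr expr1n exprn_ile1 ?subr_ge0 ?expr1n//.
    by rewrite exprn_ile1.
  by rewrite gerBl sqr_ge0.
Unshelve. all: by end_near.
Qed.

(* On (0, 1) the initial segment (0, b) is the arc centred at b / 2. *)
Lemma arcE (b y : R) : 0 < b < 1 -> 0 < y < 1 ->
  (y < b) = ((1 - cos (2 * pi * y - pi * b)) / 2 < (1 - cos (pi * b)) / 2).
Proof.
move=> /andP[b0 b1] /andP[y0 y1]; have pi0 := pi_gt0 R.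
rewrite ltr_pM2r ?invr_gt0// ltrD2l ltrN2.
set z := 2 * pi * y - pi * b.
have pb0 : 0 < pi * b by exact: mulr_gt0.
have pb1 : pi * b < pi by rewrite gtr_pMr.
have py0 : 0 < pi * y by exact: mulr_gt0.
have py1 : pi * y < pi by rewrite gtr_pMr.
have zE : z = 2 * (pi * y) - pi * b by rewrite mulrA.
have yb : (y < b) = (pi * y < pi * b) by rewrite ltr_pM2l.
have itvpi (u : R) : 0 <= u <= pi -> u \in `[0, pi] by rewrite in_itv.
rewrite {}yb; have [z0|z0] := lerP 0 z.
  have [zp|zp] := lerP z pi.
    rewrite ltr_cos; [|apply: itvpi; lra..].
    apply/idP/idP; lra.
  have -> : cos z = cos (2 * pi - z).
    rewrite -[RHS]cosN opprB -(cosD2pi (z - 2 * pi)) -(mulr_natl pi 2).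
    by rewrite subrK.
  rewrite ltr_cos; [|apply: itvpi; lra..].
  apply/idP/idP; lra.
rewrite -[cos z]cosN ltr_cos; [|apply: itvpi; lra..].
apply/idP/idP; lra.
Qed.

End step_approximation.

Section density.
Context {R : realType} {d : nat}.
Local Notation T := (measurableTypeR R).
Local Notation mu := (torus_measure R d).
Local Notation pt := (@torus_pt R d).
Implicit Types (F G : d.-tuple T -> R) (s : seq (R * R * 'rV[int]_d)).

Definition trigpoly s (x : 'rV[R]_d) : R := \sum_(p <- s) trig p.1.1 p.1.2 p.2 x.

Lemma l2_trigpoly s : l2 (trigpoly s).
Proof. by apply: l2_sum => p _; exact: l2_trig. Qed.

Lemma trigpoly_cat s s' x : trigpoly (s ++ s') x = trigpoly s x + trigpoly s' x.
Proof. by rewrite /trigpoly big_cat. Qed.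

Lemma trigpolyM s s' : exists s'', trigpoly s'' = (fun x => trigpoly s x * trigpoly s' x).
Proof.
elim: s => [|p s [s1 IH]].
  by exists [::]; apply/funext => x; rewrite /trigpoly big_nil mul0r.
have [s2 H2] : exists s2, trigpoly s2 = (fun x => trig p.1.1 p.1.2 p.2 x * trigpoly s' x).
  elim: s' {IH} => [|q s' [s2 IH]].
    by exists [::]; apply/funext => x; rewrite /trigpoly big_nil mulr0.
  pose a := p.1.1; pose b := p.1.2; pose a' := q.1.1; pose b' := q.1.2.
  exists [:: ((a * a' + b * b') / 2, (b * a' - a * b') / 2, p.2 - q.2),
             ((a * a' - b * b') / 2, (b * a' + a * b') / 2, p.2 + q.2) & s2].
  apply/funext => x; have /funeqP/(_ x) := IH; rewrite /trigpoly !big_cons => ->.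
  by rewrite mulrDr trigM /= addrA.
exists (s2 ++ s1); apply/funext => x.
by rewrite trigpoly_cat H2 IH -mulrDl; congr (_ * _); rewrite /trigpoly big_cons.
Qed.

Definition msd F G : \bar R := (\int[mu]_t ((F t - G t) ^+ 2)%:E)%E.

(** Membership in the L^2 closure of the trigonometric polynomials, for functions of the sample
    tuple: indicators of measurable sets of tuples then fit in without periodic extension. As [msd]
    is extended real, no integrability has to be known beforehand. *)
Definition approximable F := measurable_fun setT F /\
  forall e : R, 0 < e -> exists s, (msd F (trigpoly s \o pt) < e%:E)%E.

Lemma measurable_trigpoly s : measurable_fun setT (trigpoly s \o pt).
Proof. by have [_ /torus_L2_tmeas] := l2_trigpoly s. Qed.

Lemma measurable_sqB F G : measurable_fun setT F -> measurable_fun setT G ->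
  measurable_fun setT (fun t => ((F t - G t) ^+ 2)%:E).
Proof.
move=> mF mG; apply/measurable_EFinP; apply: measurable_funX.
exact: measurable_funB.
Qed.

Lemma msd_triangle F G H : measurable_fun setT F -> measurable_fun setT G ->
  measurable_fun setT H -> (msd F H <= 2%:E * (msd F G + msd G H))%E.
Proof.
move=> mF mG mH.
have m1 := measurable_sqB mF mG; have m2 := measurable_sqB mG mH.
have p0 (u v : d.-tuple T -> R) t : setT t -> (0 <= ((u t - v t) ^+ 2)%:E)%E.
  by move=> _; rewrite lee_fin sqr_ge0.
rewrite /msd -ge0_integralD//; [|exact: p0..].
rewrite -ge0_integralZl//; last 2 first.
- exact: emeasurable_funD.
- by move=> t _; rewrite adde_ge0 ?p0.
apply: ge0_le_integral => //.
- exact: p0.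
- exact: measurable_sqB.
- by apply: emeasurable_funM => //; exact: emeasurable_funD.
- move=> t _; rewrite -EFinD -EFinM lee_fin.
  have := sqr_ge0 (F t - G t - (G t - H t)); nra.
Qed.

Lemma approximable_closed F : measurable_fun setT F ->
  (forall e : R, 0 < e -> exists2 G, approximable G & (msd F G < e%:E)%E) ->
  approximable F.
Proof.
move=> mF HF; split => // e e0.
have e4 : 0 < e / 4 by exact: divr_gt0.
have [G [mG HG] FG] := HF _ e4; have [s Gs] := HG _ e4; exists s.
apply: (le_lt_trans (msd_triangle mF mG (measurable_trigpoly s))).
have -> : e = 2 * (e / 4 + e / 4) by field.
by rewrite EFinM lte_pmul2l// EFinD lteD.
Qed.

Lemma approximable_trigpoly s : approximable (trigpoly s \o pt).
Proof.
split; first exact: measurable_trigpoly.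
move=> e e0; exists s; rewrite /msd.
under eq_integral do rewrite subrr expr0n/=.
by rewrite integral0.
Qed.

Lemma approximable_cst c : approximable (cst c).
Proof.
have := approximable_trigpoly [:: (c, 0, 0)]; congr approximable.
by apply/funext => t; rewrite /trigpoly/= big_seq1 /trig fph0 cos0 mulr1 mul0r addr0.
Qed.

Lemma approximableD F G : approximable F -> approximable G ->
  approximable (fun t => F t + G t).
Proof.
move=> [mF HF] [mG HG]; split; first exact: measurable_funD.
move=> e e0; have e4 : 0 < e / 4 by exact: divr_gt0.
have [s1 H1] := HF _ e4; have [s2 H2] := HG _ e4; exists (s1 ++ s2).
have m1 := measurable_sqB mF (measurable_trigpoly s1).
have m2 := measurable_sqB mG (measurable_trigpoly s2).
have p0 (u v : d.-tuple T -> R) t : setT t -> (0 <= ((u t - v t) ^+ 2)%:E)%E.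
  by move=> _; rewrite lee_fin sqr_ge0.
have -> : e = 2 * (e / 4 + e / 4) by field.
apply: (@le_lt_trans _ _ (2%:E * (msd F (trigpoly s1 \o pt) + msd G (trigpoly s2 \o pt)))%E).
  rewrite /msd -ge0_integralD//; [|exact: p0..].
  rewrite -ge0_integralZl//; last 2 first.
  - exact: emeasurable_funD.
  - by move=> t _; rewrite adde_ge0 ?p0.
  apply: ge0_le_integral => //.
  - exact: p0.
  - apply: measurable_sqB; [exact: measurable_funD|exact: measurable_trigpoly].
  - by apply: emeasurable_funM => //; exact: emeasurable_funD.
  - move=> t _; rewrite -EFinD -EFinM lee_fin /= trigpoly_cat.
    have := sqr_ge0 ((F t - trigpoly s1 (pt t)) - (G t - trigpoly s2 (pt t))); nra.
by rewrite EFinM lte_pmul2l// EFinD lteD.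
Qed.

Lemma approximable_mul_trigpoly F s : approximable F ->
  approximable (fun t => F t * trigpoly s (pt t)).
Proof.
move=> [mF HF].
have [pp cp] : torus_periodic (trigpoly s) /\ continuous (trigpoly s).
  have [pp _] := l2_trigpoly s; split => //.
  apply: (@continuous_big _ _ _ _ _ add_continuous _ _ (fun p => trig p.1.1 p.1.2 p.2)).
  by move=> p _; exact: continuous_trig.
have [M M0 HM] := periodic_bounded pp cp.
split; first by apply: measurable_funM => //; exact: measurable_trigpoly.
move=> e e0; have e1 : 0 < e / (M ^+ 2 + 1) by rewrite divr_gt0// ltr_wpDl ?sqr_ge0.
have [s1 H1] := HF _ e1; have [s2 H2] := trigpolyM s1 s; exists s2; rewrite H2.
have m1 := measurable_sqB mF (measurable_trigpoly s1).
have M1 : 0 < M ^+ 2 + 1 by rewrite ltr_wpDl ?sqr_ge0.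
apply: (@le_lt_trans _ _ ((M ^+ 2 + 1)%:E * msd F (trigpoly s1 \o pt))%E); last first.
  by rewrite -[e](divfK (lt0r_neq0 M1)) mulrC EFinM lte_pmul2l.
rewrite /msd -ge0_integralZl//; last 2 first.
- by move=> t _; rewrite lee_fin sqr_ge0.
- by rewrite lee_fin ltW.
apply: ge0_le_integral => //.
- by move=> t _; rewrite lee_fin sqr_ge0.
- apply: measurable_sqB.
    by apply: measurable_funM => //; exact: measurable_trigpoly.
  by rewrite -H2; exact: measurable_trigpoly.
- exact: emeasurable_funM.
- move=> t _; rewrite -EFinM lee_fin /= -mulrBl exprMn mulrC ler_wpM2r ?sqr_ge0//.
  rewrite -(real_normK (num_real (trigpoly _ _))) (le_trans (y := M ^+ 2)) ?lerDl//.
  by rewrite lerXn2r ?nnegrE.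
Qed.

Lemma approximableZ c F : approximable F -> approximable (fun t => c * F t).
Proof.
move=> /(approximable_mul_trigpoly [:: (c, 0, 0)]); congr approximable.
apply/funext => t; rewrite /trigpoly/= big_seq1 /trig fph0 cos0 mulr1 mul0r addr0.
by rewrite mulrC.
Qed.

Lemma approximable_sum I (r : seq I) (FF : I -> d.-tuple T -> R) :
  (forall i, approximable (FF i)) -> approximable (fun t => \sum_(i <- r) FF i t).
Proof.
move=> HF; elim: r => [|i r IH].
  by under eq_fun do rewrite big_nil; exact: approximable_cst.
by under eq_fun do rewrite big_cons; exact: approximableD.
Qed.

(** Dominated convergence sends the mean square distance to 0. This one limit argument serves the
    polynomial steps, the countable unions and the simple functions below. *)
Lemma approximable_dominated (FF : (d.-tuple T -> R)^nat) F g :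
  (forall n, approximable (FF n)) -> measurable_fun setT F ->
  mu.-integrable setT (EFin \o g) ->
  (forall n t, (F t - FF n t) ^+ 2 <= g t) ->
  (forall t, FF n t @[n --> \oo] --> F t) -> approximable F.
Proof.
move=> HF mF ig Hg cF; apply: approximable_closed => // e e0.
have : (msd F (FF n) @[n --> \oo] --> \int[mu]_t (cst 0 t))%E.
  apply: (@dominated_cvg _ _ _ mu _ measurableT _ _ (EFin \o g)) => //.
  - by move=> n; apply: measurable_sqB => //; have [] := HF n.
  - move=> t _; apply: cvg_EFin; first by near=> n.
    rewrite -[X in _ --> X](_ : (F t - F t) * (F t - F t) = 0); last by rewrite subrr mul0r.
    have cB : F t - FF n t @[n --> \oo] --> F t - F t by apply: cvgB => //; exact: cvg_cst.
    exact: (cvgM cB cB).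
  - by move=> n t _; rewrite gee0_abs ?lee_fin ?sqr_ge0//; exact: Hg.
rewrite integral0 => /fine_cvgP [nf cf].
have [n [n1 n2]] : exists n, msd F (FF n) \is a fin_num /\ fine (msd F (FF n)) < e.
  have H2 : \forall n \near \oo, fine (msd F (FF n)) < e by exact: (cvgr_lt _ cf).
  have [n] := @filter_ex _ _ _ _ (filterI nf H2).
  by exists n.
by exists (FF n) => //; rewrite -(fineK n1) lte_fin.
Unshelve. all: by end_near.
Qed.

Lemma approximable_ae F G : approximable F -> measurable_fun setT G ->
  ae_eq mu setT F G -> approximable G.
Proof.
move=> [mF HF] mG FG; split => // e e0; have [s Hs] := HF e e0; exists s.
apply: le_lt_trans Hs; rewrite le_eqVlt; apply/orP; left; apply/eqP.
apply: ge0_ae_eq_integral => //.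
- exact: (measurable_sqB mG (measurable_trigpoly s)).
- exact: (measurable_sqB mF (measurable_trigpoly s)).
- by move=> t _; rewrite lee_fin sqr_ge0.
- by move=> t _; rewrite lee_fin sqr_ge0.
- by apply: filterS FG => t H _; rewrite H.
Qed.

(** [step_poly] of a trigonometric polynomial is again a polynomial in it, so the products with [F]
    are approximable; their pointwise limit carries the indicator of a sublevel set. Keeping the
    bounded factor [F] allows indicators to be multiplied one after the other. *)
Lemma approximable_step F s (k M : R) : approximable F -> (forall t, `|F t| <= M) ->
  0 < k <= 1 -> (forall t, 0 <= trigpoly s (pt t) <= 1) ->
  approximable (fun t => F t * (trigpoly s (pt t) < k)%R%:R).
Proof.
move=> HF FM k01 s01.
have Hpow n G : approximable G -> approximable (fun t => G t * trigpoly s (pt t) ^+ n).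
  elim: n G => [|n IH] G HG; first by under eq_fun do rewrite expr0 mulr1.
  under eq_fun do rewrite exprS mulrA; apply: IH.
  exact: approximable_mul_trigpoly.
have Hone n j G : approximable G ->
    approximable (fun t => G t * (1 - trigpoly s (pt t) ^+ n) ^+ j).
  elim: j G => [|j IH] G HG; first by under eq_fun do rewrite expr0 mulr1.
  under eq_fun do rewrite exprS mulrA; apply: IH.
  under eq_fun do rewrite mulrBr mulr1 -mulN1r.
  by apply: approximableD => //; apply: approximableZ; exact: Hpow.
have mS := measurable_trigpoly s.
have [mF _] := HF.
have M0 t : 0 <= M := le_trans (normr_ge0 _) (FM t).
apply: (@approximable_dominated (fun n t => F t * step_poly k n (trigpoly s (pt t))) _ (cst (M ^+ 2))).
- by move=> n; exact: Hone.
- apply: measurable_funM => //.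
  apply: (@measurableT_comp _ _ _ _ _ _ (fun b : bool => b%:R : R)) => //.
  exact: measurable_fun_ltr.
- exact: finite_measure_integrable_cst.
- move=> n t; rewrite -mulrBr exprMn -[leRHS]mulr1.
  rewrite ler_pM ?sqr_ge0//.
    by rewrite -(real_normK (num_real (F t))) lerXn2r ?nnegrE ?(M0 t) ?FM.
  have /andP[u0 u1] := step_poly_bound k n (s01 t).
  move: u0 u1; case: (_ < k) => /=; move: (step_poly _ _ _) => u u0 u1;
  clear -u0 u1; nra.
- move=> t; apply: cvgM; first exact: cvg_cst.
  exact: cvg_step_poly.
Qed.

Lemma ae_unit_box : {ae mu, forall t, forall i, 0 < (tnth t i : R) < 1}.
Proof.
have mB (i : 'I_d) : measurable (`]0, 1[%classic : set T) by exact: measurable_itv.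
have mBB := measurable_tuple_box mB.
exists (~` [set t : d.-tuple T | forall i : 'I_d, `]0, 1[%classic (tnth t i)]).
split; first exact: measurableC.
- rewrite probability_setC// (torus_measure_box mB) big1 ?subee// => i _.
  rewrite uniform_prob01E// (_ : _ `&` _ = `]0, 1[%classic).
    by rewrite lebesgue_measure_itv/= lte_fin ltr01 sube0.
  apply/seteqP; split => y /=; rewrite !in_itv/=; first by case.
  by move=> /andP[y0 y1]; rewrite y0 y1 ltW.
- move=> t /= H1 H2; apply: H1 => i.
  by have := H2 i; rewrite in_itv.
Qed.

Lemma ae_boxP (P : d.-tuple T -> Prop) :
  (forall t, (forall i, 0 < (tnth t i : R) < 1) -> P t) -> {ae mu, forall t, P t}.
Proof.
case: ae_unit_box => N [mN N0 sN] H; exists N; split => // t Pt.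
by apply: sN => Ht; apply: Pt; exact: H.
Qed.

(** On the open unit cube {t_i < b} with 0 < b < 1 is an arc, hence a sublevel set of a shifted 1 -
    cos, to which [approximable_step] applies. The boundary of the cube is negligible, and for other
    [b] the indicator is constant almost everywhere. *)
Lemma approximable_coord F i (b M : R) : approximable F -> (forall t, `|F t| <= M) ->
  approximable (fun t => F t * (tnth t i < b)%R%:R).
Proof.
move=> HF FM; have [mF _] := HF.
have mG : measurable_fun setT (fun t : d.-tuple T => F t * (tnth t i < b)%R%:R).
  apply: measurable_funM => //.
  apply: (@measurableT_comp _ _ _ _ _ _ (fun b : bool => b%:R : R)) => //.
  by apply: measurable_fun_ltr => //; exact: measurable_tnth.
have [b0|b0] := lerP b 0.
  apply: (@approximable_ae (cst 0)) => //; first exact: approximable_cst.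
  apply: ae_boxP => t /(_ i) /andP[t0 t1] _ /=.
  by rewrite (_ : (tnth t i < b) = false) ?mulr0//; apply/negbTE; rewrite -leNgt; lra.
have [b1|b1] := lerP 1 b.
  apply: (@approximable_ae F) => //.
  apply: ae_boxP => t /(_ i) /andP[t0 t1] _ /=.
  by rewrite (_ : (tnth t i < b) = true) ?mulr1//; lra.
(* The coefficients of (1 - cos(2 pi t_i - pi b)) / 2, expanded with the addition formula; its
   values lie in [0, 1]. *)
pose s : seq (R * R * 'rV[int]_d) := [:: (1 / 2, 0, 0);
  (- (cos (pi * b) / 2), - (sin (pi * b) / 2), delta_mx 0 i)].
have sE t : trigpoly s (pt t) = (1 - cos (2 * pi * tnth t i - pi * b)) / 2.
  have phE : fph (delta_mx 0 i) (pt t) = 2 * pi * tnth t i.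
    rewrite /fph (bigD1 i)//= big1 => [|j ji].
      by rewrite !mxE !eqxx mulr1 addr0.
    by rewrite !mxE (negbTE ji) andbF mulr0 mul0r.
  by rewrite /trigpoly !big_cons big_nil /trig /= phE fph0 cos0 sin0 cosB; field.
have pb : 0 < pi * b < pi.
  by rewrite mulr_gt0 ?pi_gt0//= gtr_pMr// pi_gt0.
apply: (@approximable_ae (fun t => F t * (trigpoly s (pt t) < (1 - cos (pi * b)) / 2)%R%:R)) => //.
  apply: (approximable_step HF FM).
    apply/andP; split; last by have := cos_geN1 (pi * b); lra.
    rewrite divr_gt0// subr_gt0 -cos0 ltr_cos ?in_itv/= ?lexx ?pi_ge0//; lra.
  by move=> t; rewrite sE; have := cos_geN1 (2 * pi * tnth t i - pi * b);
     have := cos_le1 (2 * pi * tnth t i - pi * b); lra.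
apply: ae_boxP => t /(_ i) t01 _ /=.
by rewrite sE -arcE// b0.
Qed.

Definition orthant (l : seq ('I_d * R)) : set (d.-tuple T) :=
  [set t | all (fun p => tnth t p.1 < p.2) l].

Lemma indic_orthant l t :
  \1_(orthant l) t = (all (fun p => tnth t p.1 < p.2) l)%:R :> R.
Proof.
rewrite indicE; case: (boolP (all _ l)) => tl; first by rewrite mem_set.
by rewrite memNset//= => tl'; move: tl; rewrite tl'.
Qed.

Lemma approximable_orthant l : approximable (\1_(orthant l)).
Proof.
elim: l => [|[i b] l IH].
  by rewrite (_ : orthant [::] = setT) ?indicT; [exact: approximable_cst|apply/seteqP].
have H (t : d.-tuple T) : `|\1_(orthant l) t| <= 1 :> R.
  by rewrite indic_orthant; case: (all _ _); rewrite ?normr1 ?normr0.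
have := approximable_coord i b IH H; congr approximable; apply/funext => t.
by rewrite !indic_orthant /= mulrC -natrM mulnb.
Qed.

Let good (A : set (d.-tuple T)) := measurable A /\ approximable (\1_A).

Let good_dynkin : dynkin good.
Proof.
split.
- by split => //; rewrite indicT; exact: approximable_cst.
- move=> A [mA HA]; split; first exact: measurableC.
  rewrite (_ : \1__ = fun t => cst 1 t + -1 * \1_A t).
    by apply: approximableD; [exact: approximable_cst|exact: approximableZ].
  by apply/funext => t; rewrite !indicE in_setC; case: (_ \in _) => /=; lra.
- move=> A tA HA; have mU : measurable (\bigcup_k A k).
    by apply: bigcup_measurable => k _; have [] := HA k.
  split => //.
  have SE n t : \sum_(k < n) \1_(A k) t = \1_(\big[setU/set0]_(k < n) A k) t :> R.
    elim: n => [|n IH]; first by rewrite !big_ord0 indic0.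
    rewrite !big_ord_recr /= IH !indicE in_setU.
    have : ~ (t \in \big[setU/set0]_(k < n) A k /\ t \in A n).
      rewrite !in_setE => -[]; rewrite -bigcup_mkord => -[k /= kn Akt] Ant.
      have := tA k n I I (ex_intro _ t (conj Akt Ant)) => kE; move: kn; rewrite kE ltnn.
      by [].
    by case: (_ \in _); case: (_ \in _) => //= H; rewrite ?addr0 ?add0r//; case: H.
  apply: (@approximable_dominated (fun n t => \sum_(k < n) \1_(A k) t) _ (cst 1)).
  + by move=> n; apply: approximable_sum => k; have [] := HA k.
  + exact: measurable_indic.
  + exact: finite_measure_integrable_cst.
  + move=> n t; rewrite SE !indicE; case: (_ \in _); case: (_ \in _) => /=; lra.
  + move=> t; under eq_fun do rewrite SE.
    have [tU|tU] := pselect ((\bigcup_k A k) t).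
      have -> : \1_(\bigcup_k A k) t = 1 :> R by rewrite indicE mem_set.
      apply: cvg_near_cst.
      have [k _ Ak] := tU; near=> n; rewrite indicE mem_set//.
      rewrite -bigcup_mkord; exists k => //=; near: n; exact: nbhs_infty_gt.
    have -> : \1_(\bigcup_k A k) t = 0 :> R by rewrite indicE memNset.
    apply: cvg_near_cst.
    near=> n; rewrite indicE memNset// -bigcup_mkord => -[k _ Ak].
    by apply: tU; exists k.
Unshelve. all: by end_near.
Qed.

Definition orthants := [set A | exists l, A = orthant l].

Lemma orthants_generate (A : set (d.-tuple T)) : measurable A -> <<s orthants >> A.
Proof.
pose W := g_sigma_algebraType orthants.
have idm : measurable_fun [set: W] (id : W -> d.-tuple T).
  apply/measurable_fun_tnthP => i.
  apply: (measurability _ (RGenInftyO.measurableE R)) => _ [_ [b ->] <-].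
  apply: sub_sigma_algebra; exists [:: (i, b)]; rewrite setTI /orthant.
  by apply/seteqP; split => t /=; rewrite in_itv/= andbT.
by move=> mA; have := idm measurableT A mA; rewrite setTI.
Qed.

(** The pi-lambda theorem: orthants are stable under intersection, because their defining lists
    concatenate, and they generate the product sigma-algebra. *)
Lemma approximable_indic (A : set (d.-tuple T)) : measurable A -> approximable (\1_A).
Proof.
move=> mA; suff [] : good A by [].
have := orthants_generate mA; rewrite -setI_closed_g_dynkin_g_sigma_algebra.
  apply; split; first exact: good_dynkin.
  move=> _ [l ->]; split; last exact: approximable_orthant.
  rewrite /orthant; elim: l => [|p l IH]; first by rewrite (_ : [set _ | _] = setT)//; apply/seteqP.
  rewrite (_ : [set _ | _] = (@tnth d T ^~ p.1 @^-1` `]-oo, p.2[%classic) `&`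
     [set t : d.-tuple T | all (fun p => tnth t p.1 < p.2) l]).
    apply: measurableI => //; rewrite -[X in measurable X]setTI.
    by apply: measurable_tnth => //; exact: measurable_itv.
  apply/seteqP; split => t /=; rewrite in_itv/=; first by move=> /andP[].
  by move=> [-> ->].
move=> _ _ [l1 ->] [l2 ->]; exists (l1 ++ l2).
apply/seteqP; split => t /=; rewrite /orthant/= all_cat; first by move=> [-> ->].
by move=> /andP[].
Qed.

Import HBNNSimple.

Lemma approximable_nnsfun (f : {nnsfun d.-tuple T >-> R}) : approximable f.
Proof.
rewrite (_ : (f : _ -> _) = fun t => \sum_(y <- finmap.enum_fset (fset_set (range f))) y * \1_(f @^-1` [set y]) t).
  apply: approximable_sum => y; apply: approximableZ; apply: approximable_indic.
  by rewrite -[X in measurable X]setTI; exact: measurable_funP.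
by apply/funext => t; rewrite {1}fimfunE fsbig_finite.
Qed.

(** Positive and negative parts are treated separately: each is an increasing limit of nonnegative
    simple functions, and the squared errors are then dominated by [F ^+ 2]. *)
Lemma approximable_sqr_integrable F : measurable_fun setT F ->
  mu.-integrable setT (fun t => (F t ^+ 2)%:E) -> approximable F.
Proof.
move=> mF iF.
have nonneg G : measurable_fun setT G -> (forall t, 0 <= G t) ->
    (forall t, G t <= `|F t|) -> approximable G.
  move=> mG G0 GF.
  have mG' : measurable_fun setT (EFin \o G) by exact/measurable_EFinP.
  pose gn := nnsfun_approx measurableT mG'.
  have cg t : gn n t @[n --> \oo] --> G t.
    have : (EFin \o (gn ^~ t)) n @[n --> \oo] --> (G t)%:E.
      by apply: (cvg_nnsfun_approx measurableT mG') => // x _; rewrite lee_fin.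
    by move/fine_cvg.
  apply: (@approximable_dominated (fun n => gn n) _ (fun t => F t ^+ 2)) => //.
  - by move=> n; exact: approximable_nnsfun.
  - move=> n t; have g0 : 0 <= gn n t by [].
    have gG : gn n t <= G t.
      have ndg : nondecreasing_seq (gn ^~ t).
        by move=> a b ab; have /lefP := nd_nnsfun_approx measurableT mG' ab.
      have := nondecreasing_cvgn_le ndg (cvgP _ (cg t)) n.
      by rewrite (cvg_lim _ (cg t)).
    rewrite -(real_normK (num_real (F t))); have := GF t.
    move: g0 gG; move: (gn n t) (G t) `|F t|; clear => u v w; nra.
have mFp : measurable_fun setT (fun t => Num.max (F t) 0) by exact: measurable_maxr.
have mFn : measurable_fun setT (fun t => Num.max (- F t) 0).
  by apply: measurable_maxr => //; exact: measurableT_comp.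
rewrite (_ : F = fun t => Num.max (F t) 0 + -1 * Num.max (- F t) 0).
  apply: approximableD; last apply: approximableZ; apply: nonneg => // t.
  - by rewrite le_max lexx orbT.
  - by rewrite ge_max ler_norm normr_ge0.
  - by rewrite le_max lexx orbT.
  - by rewrite ge_max -normrN ler_norm normr_ge0.
apply/funext => t; case: (lerP (F t) 0) => F0; case: (lerP (- F t) 0) => F0'; lra.
Qed.

End density.

Lemma trigpoly_dense {R : realType} {d : nat} (f : 'rV[R]_d -> R) (e : R) :
  l2 f -> 0 < e -> exists s, nrm (fun x => f x - trigpoly s x) < e.
Proof.
move=> f2 e0; have [_ /torus_L2P[mf f2']] := f2.
have [_ H] := approximable_sqr_integrable mf f2'.
have e2 : 0 < e ^+ 2 by exact: exprn_gt0.
have [s Hs] := H _ e2; exists s.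
rewrite -(ltr_pXn2r (n := 2)) ?nnegrE ?nrm_ge0 ?(ltW e0)// nrm_sqr.
have fs2 := l2B f2 (l2_trigpoly s).
move: Hs; rewrite /msd (_ : (\int[_]_t _)%E = (ip (fun x => f x - trigpoly s x) (fun x => f x - trigpoly s x))%:E) ?lte_fin//.
rewrite /ip /torus_int /Rintegral fineK.
  by apply: eq_integral => t _; rewrite expr2.
by apply: integrable_fin_num => //; exact: (torus_L2M fs2.2 fs2.2).
Qed.

(** * Fourier coefficients *)

Section fourier.
Context {R : realType} {d : nat}.
Implicit Types (f g : 'rV[R]_d -> R) (x h : 'rV[R]_d) (m n : 'rV[int]_d).
Implicit Types (S : seq 'rV[int]_d) (al be : 'rV[int]_d -> R).

(** Together with [cb], the complex coefficient [ca] + i [cb] = integral of f(x) e^(2 pi i m.x),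
    with the sign convention of [exact_source]. *)
Definition ca f m : R := ip f (fcos m).
Definition cb f m : R := ip f (fsin m).
Definition en f m : R := ca f m ^+ 2 + cb f m ^+ 2.

Lemma trig_linear f a b m : l2 f -> ip f (trig a b m) = a * ca f m + b * cb f m.
Proof.
move=> f2; rewrite /ca /cb -!ipZr//; [|exact: l2_trig..].
rewrite -ipDr//; [|apply: l2Z; exact: l2_trig..].
by congr ip; apply/funext => x; rewrite /fcos /fsin /trig; ring.
Qed.

(* Real and imaginary parts of sum_m (al m + i be m) e^(- i 2 pi m x) *)
Definition tsumR S al be x : R := \sum_(m <- S) trig (al m) (be m) m x.
Definition tsumI S al be x : R := \sum_(m <- S) trig (be m) (- al m) m x.

Lemma l2_tsumR S al be : l2 (tsumR S al be).
Proof. by apply: l2_sum => m _; exact: l2_trig. Qed.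

Lemma l2_tsumI S al be : l2 (tsumI S al be).
Proof. by apply: l2_sum => m _; exact: l2_trig. Qed.

(** Each product alone also sees the frequency [m + n], that is n = -m. These contributions cancel
    between real and imaginary parts, which leaves the orthonormality of the complex
    exponentials. *)
Lemma ip_trig_pair a b a' b' m n :
  ip (trig a b m) (trig a' b' n : 'rV[R]_d -> R) + ip (trig b (- a) m) (trig b' (- a') n) =
  (m == n)%:R * (a * a' + b * b').
Proof.
have l1 := @l2_trig R d a b m; have l2' := @l2_trig R d a' b' n.
have l3 := @l2_trig R d b (- a) m; have l4 := @l2_trig R d b' (- a') n.
transitivity (torus_int (trig (a * a' + b * b') (b * a' - a * b') (m - n) : 'rV[R]_d -> R)).
  rewrite /ip /torus_int -RintegralD//; [|exact: (torus_L2M l1.2 l2'.2)|exact: (torus_L2M l3.2 l4.2)].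
  by apply: eq_Rintegral => t _; rewrite !trigM /trig; field.
have [->|mn] := eqVneq m n; first by rewrite subrr torus_int_trig0 mul1r.
by rewrite torus_int_trig ?mul0r// subr_eq0.
Qed.

Lemma ip_tsum S al be al' be' : uniq S ->
  ip (tsumR S al be) (tsumR S al' be') + ip (tsumI S al be) (tsumI S al' be') =
  \sum_(m <- S) (al m * al' m + be m * be' m).
Proof.
move=> uS; rewrite !ip_suml//;
  [|by move=> *; exact: l2_trig|exact: l2_tsumI|by move=> *; exact: l2_trig|exact: l2_tsumR].
rewrite -big_split big_seq_cond [RHS]big_seq_cond; apply: eq_bigr => m /andP[mS _].
rewrite /= !ip_sumr; try by move=> *; exact: l2_trig.
rewrite -big_split /=; under eq_bigr do rewrite ip_trig_pair.
rewrite (bigD1_seq m)//= eqxx mul1r big1 ?addr0// => n nm.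
by rewrite eq_sym (negbTE nm) mul0r.
Qed.

Lemma ip_tsumR f S al be : l2 f ->
  ip f (tsumR S al be) = \sum_(m <- S) (al m * ca f m + be m * cb f m).
Proof.
move=> f2; rewrite ip_sumr//; last by move=> *; exact: l2_trig.
by apply: eq_bigr => m _; exact: trig_linear.
Qed.

(** Completing the square for the complex distance between the real function [f] and a finite
    Fourier sum. The imaginary part of the sum enters because [S] need not be symmetric. *)
Lemma dist_tsum f S al be : l2 f -> uniq S ->
  ip (fun x => f x - tsumR S al be x) (fun x => f x - tsumR S al be x) +
  ip (tsumI S al be) (tsumI S al be) =
  ip f f - \sum_(m <- S) en f m +
  \sum_(m <- S) ((al m - ca f m) ^+ 2 + (be m - cb f m) ^+ 2).
Proof.
move=> f2 uS; have tR := l2_tsumR S al be; have fR := l2B f2 tR.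
rewrite ipBl// !ipBr// (ipC (tsumR _ _ _) f).
have -> : \sum_(m <- S) ((al m - ca f m) ^+ 2 + (be m - cb f m) ^+ 2) =
  ip (tsumR S al be) (tsumR S al be) + ip (tsumI S al be) (tsumI S al be) +
  \sum_(m <- S) en f m - ip f (tsumR S al be) *+ 2.
  rewrite ip_tsum// ip_tsumR// -big_split/= -sumrMnl -sumrB.
  by apply: eq_bigr => m _; rewrite /en; ring.
ring.
Qed.

Lemma dist_fourier f S : l2 f -> uniq S ->
  ip (fun x => f x - tsumR S (ca f) (cb f) x) (fun x => f x - tsumR S (ca f) (cb f) x) +
  ip (tsumI S (ca f) (cb f)) (tsumI S (ca f) (cb f)) =
  ip f f - \sum_(m <- S) en f m.
Proof.
move=> f2 uS; rewrite dist_tsum// [X in _ + X]big1 ?addr0// => m _.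
by rewrite !subrr expr0n addr0.
Qed.

Lemma bessel f S : l2 f -> uniq S -> \sum_(m <- S) en f m <= ip f f.
Proof.
by move=> f2 uS; rewrite -subr_ge0 -dist_fourier// addr_ge0// ip_ge0.
Qed.

(* A real trigonometric polynomial is the real part of a complex one with
   vanishing imaginary part. *)
Lemma trigpoly_tsum (s : seq (R * R * 'rV[int]_d)) S : uniq S ->
  {subset [seq p.2 | p <- s] <= S} -> {subset [seq - p.2 | p <- s] <= S} ->
  exists al be, tsumR S al be = trigpoly s /\ tsumI S al be = cst 0.
Proof.
move=> uS; elim: s => [_ _|[[a b] m] s IH H1 H2].
  exists (cst 0), (cst 0); split; apply/funext => x.
    rewrite /tsumR /trigpoly big_nil big1// => m _; rewrite /trig /=; ring.
  rewrite /tsumI big1// => m _; rewrite /trig /=; ring.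
have [||al [be [IR II]]] := IH.
- by move=> y ys; apply: H1; rewrite inE ys orbT.
- by move=> y ys; apply: H2; rewrite inE ys orbT.
have mS : m \in S by apply: H1; rewrite inE eqxx.
have nS : - m \in S by apply: H2; rewrite inE eqxx.
(* The term a cos + b sin is split into half of a + ib at frequency [m] and half of its conjugate at
   [- m], so that the imaginary parts cancel. *)
exists (fun n => al n + ((n == m)%:R * (a / 2) + (n == - m)%:R * (a / 2))).
exists (fun n => be n + ((n == m)%:R * (b / 2) - (n == - m)%:R * (b / 2))).
have del (F : 'rV[int]_d -> R) k : k \in S ->
    \sum_(n <- S) (n == k)%:R * F n = F k.
  move=> kS; rewrite (bigD1_seq k)//= eqxx mul1r big1 ?addr0// => n nk.
  by rewrite (negbTE nk) mul0r.
have fphN x : fph (- m) x = - fph m x by rewrite -sub0r fphB fph0 sub0r.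
split; apply/funext => x.
- rewrite /tsumR /trigpoly big_cons -/(trigpoly s x) -IR /tsumR addrC.
  transitivity (\sum_(n <- S) (trig (al n) (be n) n x +
    ((n == m)%:R * (a / 2 * cos (fph n x) + b / 2 * sin (fph n x)) +
     (n == - m)%:R * (a / 2 * cos (fph n x) - b / 2 * sin (fph n x))))).
    by apply: eq_bigr => n _; rewrite /trig; ring.
  rewrite big_split /= [X in _ + X = _]big_split /= !(del _ _ mS) !(del _ _ nS) fphN cosN sinN /trig/=.
  by congr (_ + _); field.
- transitivity (\sum_(n <- S) (trig (be n) (- al n) n x +
    ((n == m)%:R * (b / 2 * cos (fph n x) - a / 2 * sin (fph n x)) +
     (n == - m)%:R * (- (b / 2) * cos (fph n x) - a / 2 * sin (fph n x))))).
    by apply: eq_bigr => n _; rewrite /trig; ring.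
  have E : \sum_(n <- S) trig (be n) (- al n) n x = 0.
    by have /funeqP/(_ x) := II.
  rewrite big_split /= E [X in _ + X]big_split /= !(del _ _ mS) !(del _ _ nS) fphN cosN sinN; ring.
Qed.

(** On a set containing the frequencies of a close trigonometric polynomial and their opposites,
    [dist_tsum] bounds the missing energy by the squared distance to that polynomial. The bound is
    stated for all larger sets so that several functions can share one set and so that it can be
    merged with the grid. *)
Lemma parseval_approx f (e : R) : l2 f -> 0 < e ->
  exists S, forall S', uniq S' -> {subset S <= S'} ->
    ip f f - \sum_(m <- S') en f m < e.
Proof.
move=> f2 e0; have e0' : 0 < Num.sqrt e by rewrite sqrtr_gt0.
have [s Hs] := trigpoly_dense f2 e0'.
exists ([seq p.2 | p <- s] ++ [seq - p.2 | p <- s]) => S' uS' sub.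
have [||al [be [HR HI]]] := @trigpoly_tsum s S' uS'.
- by move=> y ys; apply: sub; rewrite mem_cat ys.
- by move=> y ys; apply: sub; rewrite mem_cat ys orbT.
have := dist_tsum al be f2 uS'; rewrite HR HI ip0l addr0 => H.
apply: (@le_lt_trans _ _ (ip (fun x => f x - trigpoly s x) (fun x => f x - trigpoly s x))).
  by rewrite H lerDl sumr_ge0// => m _; rewrite addr_ge0 ?sqr_ge0.
by rewrite -nrm_sqr -(sqr_sqrtr (ltW e0)) ltrXn2r// ?nnegrE ?nrm_ge0 ?sqrtr_ge0.
Qed.

(** Cauchy-Schwarz for the remainder of [f] against [g]: the frequency set only has to suit [f]. *)
Lemma parseval_polarized f g S : l2 f -> l2 g -> uniq S ->
  `|ip f g - \sum_(m <- S) (ca f m * ca g m + cb f m * cb g m)| <=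
  Num.sqrt (ip f f - \sum_(m <- S) en f m) * nrm g.
Proof.
move=> f2 g2 uS; rewrite -ip_tsumR// (ipC g) -ipBl//; last exact: l2_tsumR.
have fR := l2B f2 (l2_tsumR S (ca f) (cb f)).
apply: le_trans (ip_cauchy fR g2) _; rewrite ler_wpM2r ?nrm_ge0//.
by rewrite ler_wsqrtr// -dist_fourier// lerDl ip_ge0.
Qed.

Lemma ip_shift_trig f a b m h : ushift h -> l2 f ->
  ip (fun x => f (x + h)) (trig a b m) =
  ip f (trig (a * cos (fph m h) - b * sin (fph m h))
             (b * cos (fph m h) + a * sin (fph m h)) m).
Proof.
move=> h01 f2; rewrite -(ip_shift h01 f2 (l2_trig _ _ _)); congr ip.
apply/funext => x; rewrite trig_shift; congr trig.
- rewrite -[LHS]mulr1 -(cos2Dsin2 (fph m h)); ring.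
- rewrite -[LHS]mulr1 -(cos2Dsin2 (fph m h)); ring.
Qed.

Definition dif h f x : R := f (x + h) - f x.

Lemma l2_dif h f : ushift h -> l2 f -> l2 (dif h f).
Proof. by move=> h01 f2; apply: l2B => //; exact: l2_shift. Qed.

Lemma l2_iter_dif h f j : ushift h -> l2 f -> l2 (iter j (dif h) f).
Proof. by move=> h01 f2; elim: j => //= j; exact: l2_dif. Qed.

Lemma ca_dif h f m : ushift h -> l2 f ->
  ca (dif h f) m = (cos (fph m h) - 1) * ca f m + sin (fph m h) * cb f m.
Proof.
move=> h01 f2; rewrite {1}/ca ipBl//; [|exact: l2_shift|exact: l2_trig].
by rewrite ip_shift_trig// !trig_linear// /ca /fcos; ring.
Qed.

Lemma cb_dif h f m : ushift h -> l2 f ->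
  cb (dif h f) m = (cos (fph m h) - 1) * cb f m - sin (fph m h) * ca f m.
Proof.
move=> h01 f2; rewrite {1}/cb ipBl//; [|exact: l2_shift|exact: l2_trig].
by rewrite ip_shift_trig// !trig_linear// /cb /fsin; ring.
Qed.

(** A shift multiplies the complex coefficient by e^(-iy) with y = [fph m h], and |e^(-iy) - 1|^2 =
    2 - 2 cos y. *)
Lemma en_dif h f m : ushift h -> l2 f ->
  en (dif h f) m = (2 - 2 * cos (fph m h)) * en f m.
Proof.
move=> h01 f2; rewrite /en ca_dif// cb_dif//.
have := cos2Dsin2 (fph m h); move: (cos _) (sin _) (ca f m) (cb f m) => c s a b cs.
have -> : s ^+ 2 = 1 - c ^+ 2 -> ((c - 1) * a + s * b) ^+ 2 + ((c - 1) * b - s * a) ^+ 2 =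
  (2 - 2 * c) * (a ^+ 2 + b ^+ 2) by move=> s2; ring: s2.
by [].
by rewrite -cs; ring.
Qed.

Lemma en_iter_dif h f j m : ushift h -> l2 f ->
  en (iter j (dif h) f) m = (2 - 2 * cos (fph m h)) ^+ j * en f m.
Proof.
move=> h01 f2; elim: j => [|j IH]; first by rewrite expr0 mul1r.
by rewrite iterS en_dif ?IH ?exprS ?mulrA//; exact: l2_iter_dif.
Qed.

(** Gradients and, below, divergence-free fields are described by their coefficients being parallel
    or orthogonal to [m]. A difference multiplies all components of a coefficient by the same
    complex number, so both properties survive it. *)
Definition gradlike (F : 'I_d -> 'rV[R]_d -> R) := forall m, exists w1 w2, forall i,
  ca (F i) m = (m 0 i)%:~R * w1 /\ cb (F i) m = (m 0 i)%:~R * w2.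

Definition divfree (Q : 'I_d -> 'rV[R]_d -> R) := forall m,
  \sum_i (m 0 i)%:~R * ca (Q i) m = 0 /\ \sum_i (m 0 i)%:~R * cb (Q i) m = 0.

Lemma gradlike_dif h F : ushift h -> (forall i, l2 (F i)) -> gradlike F ->
  gradlike (fun i => dif h (F i)).
Proof.
move=> h01 F2 GF m; have [w1 [w2 H]] := GF m.
exists ((cos (fph m h) - 1) * w1 + sin (fph m h) * w2).
exists ((cos (fph m h) - 1) * w2 - sin (fph m h) * w1) => i.
by rewrite ca_dif// cb_dif//; have [-> ->] := H i; split; ring.
Qed.

Lemma divfree_dif h Q : ushift h -> (forall i, l2 (Q i)) -> divfree Q ->
  divfree (fun i => dif h (Q i)).
Proof.
move=> h01 Q2 DQ m; have [H1 H2] := DQ m; split.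
- under eq_bigr do rewrite ca_dif// mulrDr mulrCA [_ * (sin _ * _)]mulrCA.
  by rewrite big_split -!big_distrr/= H1 H2 !mulr0 addr0.
- under eq_bigr do rewrite cb_dif// mulrBr mulrCA [_ * (sin _ * _)]mulrCA.
  by rewrite sumrB -!big_distrr/= H1 H2 !mulr0 subr0.
Qed.

(** On any finite frequency set the sum vanishes term by term, and the truncation error is
    controlled by [parseval_polarized]. A common set for all components is needed, since only the
    sum over [i] vanishes at each frequency. *)
Lemma gradlike_divfree_orth F Q : (forall i, l2 (F i)) -> (forall i, l2 (Q i)) ->
  gradlike F -> divfree Q -> \sum_i ip (F i) (Q i) = 0.
Proof.
move=> F2 Q2 GF DQ; apply/eqP; rewrite -normr_le0; apply/ler_addgt0Pr => e e0.
(* The error [e] is distributed in proportion to the norms of the [Q i]; the 1 keeps [N]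
   positive. *)
pose N := \sum_i nrm (Q i) + 1.
have N0 : 0 < N by rewrite ltr_wpDl// sumr_ge0// => i _; exact: nrm_ge0.
have eN : 0 < (e / N) ^+ 2 by rewrite exprn_gt0// divr_gt0.
have [S HS] : exists S : 'I_d -> seq 'rV[int]_d, forall i S', uniq S' ->
    {subset S i <= S'} -> ip (F i) (F i) - \sum_(m <- S') en (F i) m < (e / N) ^+ 2.
  exists (fun i => sval (cid (parseval_approx (F2 i) eN))) => i.
  exact: (svalP (cid (parseval_approx (F2 i) eN))).
pose S' := undup (flatten [seq S i | i <- enum 'I_d]).
have uS' : uniq S' by exact: undup_uniq.
have subS i : {subset S i <= S'}.
  move=> m mS; rewrite mem_undup; apply/flattenP; exists (S i) => //.
  by apply: map_f; rewrite mem_enum.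
have zero : \sum_i \sum_(m <- S') (ca (F i) m * ca (Q i) m + cb (F i) m * cb (Q i) m) = 0.
  rewrite exchange_big big1// => m _; have [w1 [w2 HF]] := GF m; have [D1 D2] := DQ m.
  transitivity (w1 * \sum_i (m 0 i)%:~R * ca (Q i) m + w2 * \sum_i (m 0 i)%:~R * cb (Q i) m).
    rewrite !big_distrr -big_split; apply: eq_bigr => i _ /=.
    by have [-> ->] := HF i; ring.
  by rewrite D1 D2 !mulr0 addr0.
rewrite add0r -[X in `|X|]subr0 -[X in _ - X]zero -sumrB.
apply: le_trans (ler_norm_sum _ _ _) _.
apply: (@le_trans _ _ (\sum_i (e / N) * nrm (Q i))).
  apply: ler_sum => i _; apply: le_trans (parseval_polarized (F2 i) (Q2 i) uS') _.
  rewrite ler_wpM2r ?nrm_ge0// -[leRHS]ger0_norm ?divr_ge0 ?(ltW e0) ?(ltW N0)// -sqrtr_sqr.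
  by rewrite ler_wsqrtr// ltW// HS.
rewrite -big_distrr/= -mulrA ler_piMr ?(ltW e0)// ler_pdivrMl// mulr1.
by rewrite /N lerDl.
Qed.

End fourier.

(** * Finite differences *)

Section differences.
Context {R : realType} {d : nat}.
Local Notation mu := (torus_measure R d).
Implicit Types (f g b F : 'rV[R]_d -> R) (x v h : 'rV[R]_d).

Lemma shift_quotient f x v h :
  (fun k : R => k^-1 *: (((fun y => f (y + h)) \o shift x) (k *: v) - f (x + h))) =
  (fun k : R => k^-1 *: ((f \o shift (x + h)) (k *: v) - f (x + h))).
Proof. by apply/funext => k /=; rewrite addrA. Qed.

Lemma derivable_shift f x v h :
  derivable (fun y => f (y + h)) x v = derivable f (x + h) v.
Proof. by rewrite /derivable shift_quotient. Qed.

Lemma derive_shift f x v h :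
  'D_v (fun y => f (y + h)) x = 'D_v f (x + h).
Proof. by rewrite /derive shift_quotient. Qed.

Lemma derive_dif f v h : (forall x, derivable f x v) ->
  (forall x, derivable (dif h f) x v) /\ 'D_v (dif h f) = dif h ('D_v f).
Proof.
move=> df; have dfh x : derivable (fun y => f (y + h)) x v by rewrite derivable_shift.
have dd x : is_derive x v (dif h f) (dif h ('D_v f) x).
  rewrite (_ : dif h f = (fun y => f (y + h)) - f); last exact/funext.
  apply: (is_derive_eq (is_deriveB (DeriveDef (dfh x) erefl) (DeriveDef (df x) erefl))).
  by rewrite derive_shift.
by split => [x|]; [case: (dd x)|apply/funext => x; case: (dd x)].
Qed.

Lemma derive_iter_dif f v h j : (forall x, derivable f x v) ->
  (forall x, derivable (iter j (dif h) f) x v) /\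
  'D_v (iter j (dif h) f) = iter j (dif h) ('D_v f).
Proof.
move=> df; elim: j => [|j [IH1 IH2]]; first by [].
by rewrite !iterS; have [H1 ->] := derive_dif h IH1; rewrite IH2.
Qed.

Lemma derive_periodic f v : torus_periodic f -> torus_periodic ('D_v f).
Proof.
move=> pf i x; rewrite -derive_shift; congr ('D_v _ x).
by apply/funext => y; rewrite pf.
Qed.

Lemma pderiv_periodic s f : torus_periodic f -> torus_periodic (pderiv s f).
Proof. by move=> pf; elim: s => //= i s IH; exact: derive_periodic. Qed.

Lemma continuous_shift f h : continuous f ->
  continuous (fun x : 'rV[R]_d => f (x + h)).
Proof.
move=> cf x; have ch : (y + h @[y --> x] --> x + h).
  exact: (cvgD cvg_id (cvg_cst h)).
exact: (cvg_comp _ _ ch (cf _)).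
Qed.

Lemma continuous_dif f h : continuous f -> continuous (dif h f).
Proof.
move=> cf; change (continuous (fun x : 'rV[R]_d => f (x + h) - f x)) => x.
have H1 : f (y + h) @[y --> x] --> f (x + h) by exact: (@continuous_shift f h cf x).
have H2 : f y @[y --> x] --> f x by exact: cf.
exact: (cvgB H1 H2).
Qed.

Lemma dif_periodic f h : torus_periodic f -> torus_periodic (dif h f).
Proof. by move=> pf i x; rewrite /dif addrAC !pf. Qed.

Lemma ushift_delta (i : 'I_d) (c : R) : 0 <= c < 1 -> ushift (c *: delta_mx 0 i).
Proof.
move=> c01 j; rewrite !mxE eqxx/=; case: (j == i); last by rewrite mulr0 lexx ltr01.
by rewrite mulr1.
Qed.

Lemma dif_sup_bound f i (c M : R) : 0 < c ->
  (forall x, derivable f x (delta_mx 0 i)) ->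
  (forall x, `|'D_(delta_mx 0 i) f x| <= M) ->
  forall x, `|dif (c *: delta_mx 0 i) f x| <= c * M.
Proof.
move=> c0 df DM x; rewrite /dif; have [|t _ ->] := @MVT_line R d f x (delta_mx 0 i) c c0.
  by move=> t; exact: df.
by rewrite normrM (gtr0_norm c0) mulrC ler_pM2l.
Qed.

(** The number [k] of derivatives already taken is generalized for the induction: the mean value
    theorem trades the outermost difference for a derivative, which commutes with the remaining
    differences. *)
Lemma iter_dif_sup_bound p f i (c M : R) l k : 0 < c -> classC p f ->
  (k + l <= p)%N -> (forall x, `|pderiv (nseq (k + l) i) f x| <= M) ->
  forall x, `|iter l (dif (c *: delta_mx 0 i)) (pderiv (nseq k i) f) x| <= c ^+ l * M.
Proof.
move=> c0 [cf df]; elim: l k => [|l IH] k kp HM x.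
  by rewrite expr0 mul1r; have := HM x; rewrite addn0.
have dk y : derivable (pderiv (nseq k i) f) y (delta_mx 0 i).
  by apply: df; rewrite size_nseq (leq_trans _ kp)// addnS ltnS leq_addr.
have [H1 H2] := derive_iter_dif (c *: delta_mx 0 i) l dk.
rewrite iterS exprS -mulrA; apply: dif_sup_bound => // y.
have /funeqP/(_ y) /= -> := H2; apply: (IH k.+1) => //; first by rewrite addSnnS.
by rewrite addSnnS.
Qed.

(** A mean value inequality in L^2 without integral remainder: the step is cut into n + 1 equal
    pieces, and the rescaled small differences converge to [c] times the derivative. *)
Lemma dif_l2_bound f i (c : R) : 0 < c < 1 -> torus_periodic f -> continuous f ->
  (forall x, derivable f x (delta_mx 0 i)) -> continuous ('D_(delta_mx 0 i) f) ->
  nrm (dif (c *: delta_mx 0 i) f) <= c * nrm ('D_(delta_mx 0 i) f).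
Proof.
move=> /andP[c0 c1] pf cf df cDf; set e := delta_mx 0 i.
have f2 := l2_continuous pf cf.
have D2 := l2_continuous (derive_periodic e pf) cDf.
have cn0 n : 0 < c / n.+1%:R by exact: divr_gt0.
have cn1 n (j : 'I_n.+1) : 0 <= c / n.+1%:R * j%:R < 1.
  rewrite mulr_ge0 ?(ltW (cn0 n))//= (le_lt_trans _ c1)//.
  by rewrite -mulrA ler_piMr ?(ltW c0)// ler_pdivrMl// mulr1 ler_nat ltnW.
have cnu n : ushift ((c / n.+1%:R) *: e).
  apply: ushift_delta; rewrite (ltW (cn0 n))/= (le_lt_trans _ c1)//.
  by rewrite ler_pdivrMr// ler_peMr ?(ltW c0)// ler1n.
have cu : ushift (c *: e) by apply: ushift_delta; rewrite (ltW c0) c1.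
pose q n x := n.+1%:R * dif ((c / n.+1%:R) *: e) f x.
have q2 n : l2 (q n) by apply: l2Z; exact: l2_dif.
(* The difference telescopes into n + 1 translates of one small difference; translates have equal
   norm, so the triangle inequality gives the bound by [q n]. *)
have step n : nrm (dif (c *: e) f) <= nrm (q n).
  rewrite /q nrmZ ?ger0_norm//; last exact: l2_dif.
  have -> : dif (c *: e) f = fun x => \sum_(j < n.+1)
      dif ((c / n.+1%:R) *: e) f (x + (c / n.+1%:R * j%:R) *: e).
    apply/funext => x.
    rewrite -(big_mkord xpredT (fun j => dif ((c / n.+1%:R) *: e) f (x + (c / n.+1%:R * j%:R) *: e))).
    transitivity (\sum_(0 <= j < n.+1) (f (x + (c / n.+1%:R * j.+1%:R) *: e) - f (x + (c / n.+1%:R * j%:R) *: e))).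
      by rewrite telescope_sumr// mulr0 scale0r addr0 divfK.
    apply: eq_bigr => j _; rewrite /dif -addrA -scalerDl.
    by rewrite -[j.+1%:R]natr1 mulrDr mulr1.
  apply: le_trans (nrm_sum _ _) _.
    by move=> j; apply: l2_shift; [exact: ushift_delta|exact: l2_dif].
  rewrite (eq_bigr (fun=> nrm (dif ((c / n.+1%:R) *: e) f))).
    by rewrite sumr_const card_ord mulr_natl.
  by move=> j _; rewrite nrm_shift//; [exact: ushift_delta|exact: l2_dif].
have qE n x : exists t, 0 < t < c / n.+1%:R /\ q n x = c * 'D_e f (x + t *: e).
  have [|t tn Ht] := @MVT_line R d f x e _ (cn0 n); first by move=> t; exact: df.
  exists t; split => //; rewrite /q /dif Ht.
  have N0 : n.+1%:R != 0 :> R by rewrite pnatr_eq0.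
  move: ('D_e f _) (n.+1%:R : R) N0; clear => D N N0; by field.
have [M M0 HM] := periodic_bounded (derive_periodic e pf) cDf.
(* Pointwise, [q n] is [c] times the derivative at a point within [c / n.+1], so continuity gives
   the limit and boundedness of the derivative the domination. *)
have lim : (\int[mu]_t (q n (torus_pt t) ^+ 2)%:E @[n --> \oo] -->
    \int[mu]_t ((c * 'D_e f (torus_pt t)) ^+ 2)%:E)%E.
  apply: (@dominated_cvg _ _ _ mu _ measurableT _ _ (cst ((c * M) ^+ 2)%:E)) => //.
  - move=> n; apply/measurable_EFinP; apply: measurable_funX.
    by have [_ /torus_L2_tmeas] := q2 n.
  - move=> t _; apply: cvg_EFin; first by near=> n.
    have cq : q n (torus_pt t) @[n --> \oo] --> c * 'D_e f (torus_pt t).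
      pose ct n := sval (cid (qE n (torus_pt t))).
      have Hct n : 0 < ct n < c / n.+1%:R /\ q n (torus_pt t) = c * 'D_e f (torus_pt t + ct n *: e).
        exact: (svalP (cid (qE n (torus_pt t)))).
      rewrite (_ : (fun n => _) = fun n => c * 'D_e f (torus_pt t + ct n *: e)).
        apply: cvgM; first exact: cvg_cst.
        have ct0 : ct n @[n --> \oo] --> (0 : R).
          apply: (@squeeze_cvgr _ _ _ _ (cst 0) (fun n => c * n.+1%:R^-1)).
          - by near=> n; have [/andP[/ltW -> /ltW ->]] := Hct n.
          - exact: cvg_cst.
          - rewrite -(mulr0 c); apply: cvgM; first exact: cvg_cst.
            exact: cvg_harmonic.
        have cx : torus_pt t + ct n *: e @[n --> \oo] --> torus_pt t.
          rewrite -[X in _ --> X]addr0 -(scale0r e).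
          by apply: cvgD; [exact: cvg_cst|apply: cvgZr_tmp; exact: ct0].
        exact: (cvg_comp _ _ cx (cDf _)).
      by apply/funext => n; have [] := Hct n.
    under eq_fun do rewrite expr2; rewrite expr2; exact: cvgM.
  - exact: finite_measure_integrable_cst.
  - move=> n t _; rewrite gee0_abs ?lee_fin ?sqr_ge0//=.
    have [s [_ ->]] := qE n (torus_pt t).
    rewrite -(real_normK (num_real (c * _))) normrM (gtr0_norm c0).
    rewrite lerXn2r ?nnegrE ?mulr_ge0 ?(ltW c0)//.
    by rewrite ler_pM2l.
rewrite -[X in X * _](gtr0_norm c0) -nrmZ// -(@ler_pXn2r _ 2)// ?nnegrE ?nrm_ge0//.
have ipE F : l2 F -> (\int[mu]_t (F (torus_pt t) ^+ 2)%:E)%E = (nrm F ^+ 2)%:E.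
  move=> [_ F2]; rewrite nrm_sqr /ip /torus_int /Rintegral fineK.
    by apply: eq_integral => t _; rewrite expr2.
  by apply: integrable_fin_num => //; exact: torus_L2M.
move: lim; rewrite (ipE (fun x => c * 'D_e f x)); last exact: l2Z.
under eq_fun do rewrite ipE//.
move=> /fine_cvgP[_ lim].
have := limr_ge (x := nrm (dif (c *: e) f) ^+ 2) (cvgP _ lim); rewrite (cvg_lim _ lim)//; apply.
by near=> n; rewrite /= lerXn2r ?nnegrE ?nrm_ge0.
Unshelve. all: by end_near.
Qed.

Lemma iter_dif_l2_bound p f i (c : R) l k : 0 < c < 1 -> torus_periodic f ->
  classC p f -> (k + l <= p)%N ->
  nrm (iter l (dif (c *: delta_mx 0 i)) (pderiv (nseq k i) f)) <=
  c ^+ l * nrm (pderiv (nseq (k + l) i) f).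
Proof.
move=> c01 pf [cf df]; have /andP[c0 c1] := c01.
elim: l k => [|l IH] k kp; first by rewrite expr0 mul1r addn0.
have kp' : (k < p)%N by rewrite (leq_trans _ kp)// addnS ltnS leq_addr.
have dk y : derivable (pderiv (nseq k i) f) y (delta_mx 0 i).
  by apply: df; rewrite size_nseq.
have [H1 H2] := derive_iter_dif (c *: delta_mx 0 i) l dk.
have ci j F : continuous F -> continuous (iter j (dif (c *: delta_mx 0 i)) F).
  by elim: j => //= j IHj /IHj; exact: continuous_dif.
have pi j F : torus_periodic F -> torus_periodic (iter j (dif (c *: delta_mx 0 i)) F).
  by elim: j => //= j IHj /IHj; exact: dif_periodic.
rewrite iterS exprS -mulrA; apply: le_trans (dif_l2_bound c01 _ _ H1 _) _.
- by apply: pi; exact: pderiv_periodic.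
- by apply: ci; apply: cf; rewrite size_nseq ltnW.
- by rewrite H2; apply: ci; apply: (cf (nseq k.+1 i)); rewrite size_nseq.
- by rewrite ler_pM2l// H2 -addSnnS; apply: (IH k.+1); rewrite addSnnS.
Qed.

Lemma torus_norm2E f : l2 f -> torus_norm 2%:E f = (nrm f)%:E.
Proof.
move=> [_ f2]; rewrite /torus_norm unlock.
rewrite (_ : (\int[_]_t _)%E = (ip f f)%:E).
  by rewrite poweR_EFin powR12_sqrt// ip_ge0.
rewrite /ip /torus_int /Rintegral fineK; last first.
  by apply: integrable_fin_num => //; exact: torus_L2M.
by apply: eq_integral => t _ /=; rewrite powR_mulrn// real_normK ?num_real// expr2.
Qed.

Lemma pderiv_le_nabla_norm m n (F : 'rV[R]_d -> 'M[R]_(m, n)) k (s : k.-tuple 'I_d) i j x :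
  `|pderiv s (fun y => F y i j) x| <= nabla_norm k F x.
Proof.
rewrite -sqrtr_sqr ler_wsqrtr// (bigD1 s)//= (bigD1 i)//= (bigD1 j)//=.
rewrite -!addrA lerDl; apply: addr_ge0; last apply: addr_ge0;
by do ?(apply: sumr_ge0 => ? _); exact: sqr_ge0.
Qed.

Lemma nabla_norm_periodic m n (F : 'rV[R]_d -> 'M[R]_(m, n)) k :
  torus_periodic F -> torus_periodic (nabla_norm k F).
Proof.
move=> pF i x; rewrite /nabla_norm; congr Num.sqrt.
apply: eq_bigr => s _; apply: eq_bigr => r _; apply: eq_bigr => c _.
have pFrc : torus_periodic (fun y => F y r c) by move=> l y; rewrite pF.
by rewrite (pderiv_periodic s pFrc).
Qed.

Lemma continuous_nabla_norm m n (F : 'rV[R]_d -> 'M[R]_(m, n)) p k :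
  (forall i j, classC p (fun x => F x i j)) -> (k <= p)%N ->
  continuous (nabla_norm k F).
Proof.
move=> HF kp x.
have cs : continuous (fun x => \sum_(s : k.-tuple 'I_d) \sum_i \sum_j
    (pderiv s (fun y => F y i j) x) ^+ 2).
  apply: continuous_big => [|s _]; first exact: add_continuous.
  apply: continuous_big => [|i _]; first exact: add_continuous.
  apply: continuous_big => [|j _]; first exact: add_continuous.
  have cd : continuous (pderiv s (fun y => F y i j)).
    by apply: (HF i j).1; rewrite size_tuple.
  move=> y; exact: (cvg_comp _ _ (cd y) (@exprn_continuous R 2 _)).
exact: (cvg_comp _ _ (cs x) (@sqrt_continuous R _)).
Qed.

Lemma nabla_sup m n (F : 'rV[R]_d -> 'M[R]_(m, n)) p k (M : R) :
  torus_periodic F -> (forall i j, classC p (fun x => F x i j)) -> (k <= p)%N ->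
  (torus_norm +oo (nabla_norm k F) <= M%:E)%E ->
  forall (s : k.-tuple 'I_d) i j x, `|pderiv s (fun y => F y i j) x| <= M.
Proof.
move=> pF cF kp /(le_torus_norm_oo (nabla_norm_periodic k pF) (continuous_nabla_norm cF kp)) HM s i j x.
apply: le_trans (pderiv_le_nabla_norm F s i j x) _.
by apply: le_trans (HM x); exact: ler_norm.
Qed.

Lemma nabla_l2 m n (F : 'rV[R]_d -> 'M[R]_(m, n)) p k (M : R) :
  torus_periodic F -> (forall i j, classC p (fun x => F x i j)) -> (k <= p)%N ->
  (torus_norm 2%:E (nabla_norm k F) <= M%:E)%E ->
  forall (s : k.-tuple 'I_d) i j, nrm (pderiv s (fun y => F y i j)) <= M.
Proof.
move=> pF cF kp.
have n2 := l2_continuous (nabla_norm_periodic k pF) (continuous_nabla_norm cF kp).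
rewrite torus_norm2E// lee_fin => HM s i j; apply: le_trans HM.
have s2 : l2 (pderiv s (fun y => F y i j)).
  apply: l2_continuous; last by apply: (cF i j).1; rewrite size_tuple.
  by apply: pderiv_periodic => l y; rewrite pF.
rewrite ler_wsqrtr//; apply: ler_ip => // x.
by apply: le_trans (pderiv_le_nabla_norm F s i j x) _; exact: ler_norm.
Qed.

End differences.

(** * Regularity of the solution *)

Section leibniz.
Context {R : realType} {d : nat}.
Local Notation mu := (torus_measure R d).
Implicit Types (f g b F : 'rV[R]_d -> R) (x h : 'rV[R]_d).

Lemma iter_dif_shift h j f x : iter j (dif h) (fun y => f (y + h)) x = iter j (dif h) f (x + h).
Proof. by elim: j x => //= j IH x; rewrite /dif !IH. Qed.

Lemma iter_difD h j f g :
  iter j (dif h) (fun x => f x + g x) = fun x => iter j (dif h) f x + iter j (dif h) g x.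
Proof.
elim: j => // j IH; rewrite !iterS IH; apply/funext => x; rewrite /dif.
by rewrite opprD addrACA.
Qed.

Lemma iter_dif_sum h j I (r : seq I) (FF : I -> 'rV[R]_d -> R) :
  iter j (dif h) (fun x => \sum_(i <- r) FF i x) = fun x => \sum_(i <- r) iter j (dif h) (FF i) x.
Proof.
elim: j => // j IH; rewrite !iterS IH; apply/funext => x; rewrite /dif.
by rewrite -sumrB; apply: eq_bigr => i _; rewrite iterS.
Qed.

Lemma difM h b f : dif h (fun x => b x * f x) =
  fun x => b x * dif h f x + dif h b x * f (x + h).
Proof. by apply/funext => x; rewrite /dif; ring. Qed.

Lemma tmeas_dif h b : torus_periodic b -> tmeas b -> tmeas (dif h b).
Proof. by move=> pb mb; apply: measurable_funB => //; exact: tmeas_shift. Qed.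

(** [difM] splits one difference of the product into two products with one difference fewer to take,
    the factor [r] going once to [f] and once to [b]. Each splitting doubles the number of terms,
    whence [2 ^+ j]. *)
Lemma iter_difM_bound h j b f (M K r : R) : ushift h -> 0 <= M -> 0 <= K -> 0 <= r ->
  torus_periodic b -> tmeas b -> l2 f ->
  (forall l, (l <= j)%N -> forall x, `|iter l (dif h) b x| <= M * r ^+ l) ->
  (forall l, (l <= j)%N -> nrm (iter l (dif h) f) <= K * r ^+ l) ->
  nrm (iter j (dif h) (fun x => b x * f x)) <= 2 ^+ j * M * K * r ^+ j.
Proof.
move=> h01 M0 K0 r0; elim: j b f M K M0 K0 => [|j IH] b f M K M0 K0 pb mb f2 Hb Hf.
  have b0 x : `|b x| <= M by have := Hb 0%N isT x; rewrite expr0 mulr1.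
  have f0 : nrm f <= K by have := Hf 0%N isT; rewrite expr0 mulr1.
  rewrite /= expr0 mul1r expr0 mulr1.
  by apply: le_trans (nrm_mul_bounded pb mb b0 f2) _; rewrite ler_wpM2l.
have b0 x : `|b x| <= M by have := Hb 0%N isT x; rewrite expr0 mulr1.
have b1 x : `|dif h b x| <= M * r by have := Hb 1%N isT x; rewrite expr1.
have fs2 := l2_shift h01 f2.
rewrite iterSr difM iter_difD.
apply: le_trans (nrmD _ _) _.
- by apply: l2_iter_dif => //; apply: (l2_mul_bounded pb mb b0); exact: l2_dif.
- apply: l2_iter_dif => //; apply: (l2_mul_bounded _ _ b1) => //; [exact: dif_periodic|exact: tmeas_dif].
rewrite (_ : 2 ^+ j.+1 * M * K * r ^+ j.+1 =
  2 ^+ j * M * (K * r) * r ^+ j + 2 ^+ j * (M * r) * K * r ^+ j); last by rewrite !exprS; ring.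
apply: lerD; apply: IH => //; try exact: mulr_ge0.
- exact: l2_dif.
- by move=> l lj x; apply: Hb; rewrite (leq_trans lj).
- by move=> l lj; rewrite -iterSr -mulrA -exprS; exact: Hf.
- exact: dif_periodic.
- exact: tmeas_dif.
- by move=> l lj x; rewrite -iterSr -mulrA -exprS; exact: Hb.
- move=> l lj; rewrite (_ : iter l _ _ = fun x => iter l (dif h) f (x + h)); last first.
    by apply/funext => x; exact: iter_dif_shift.
  by rewrite nrm_shift//; [apply: Hf; rewrite (leq_trans lj)|exact: l2_iter_dif].
Qed.

(** Peeling off one difference leaves the commutator of one order less for [dif h f], plus
    differences of [dif h b] times a shift of [f]. In the latter one difference is already spent on
    [b], so the top order of [f] never occurs. *)
Lemma commutator_bound h j b f (M K r : R) : ushift h -> 0 <= M -> 0 <= K -> 0 <= r ->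
  torus_periodic b -> tmeas b -> l2 f ->
  (forall l, (l <= j)%N -> forall x, `|iter l (dif h) b x| <= M * r ^+ l) ->
  (forall l, (l < j)%N -> nrm (iter l (dif h) f) <= K * r ^+ l) ->
  nrm (fun x => iter j (dif h) (fun x => b x * f x) x - b x * iter j (dif h) f x) <=
  2 ^+ j * M * K * r ^+ j.
Proof.
move=> h01 M0 K0 r0; elim: j f K K0 => [|j IH] f K K0 pb mb f2 Hb Hf.
  rewrite /= (_ : (fun x => b x * f x - b x * f x) = cst 0); last first.
    by apply/funext => x; rewrite subrr.
  by rewrite /nrm ip0l sqrtr0 !mulr_ge0// exprn_ge0.
have b0 x : `|b x| <= M by have := Hb 0%N isT x; rewrite expr0 mulr1.
have b1 x : `|dif h b x| <= M * r by have := Hb 1%N isT x; rewrite expr1.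
have fs2 := l2_shift h01 f2.
have bd2 : l2 (fun x => b x * dif h f x) by apply: (l2_mul_bounded pb mb b0); exact: l2_dif.
have db2 : l2 (fun x => dif h b x * f (x + h)).
  by apply: (l2_mul_bounded _ _ b1) => //; [exact: dif_periodic|exact: tmeas_dif].
rewrite (_ : (fun x => _) = fun x =>
  (iter j (dif h) (fun x => b x * dif h f x) x - b x * iter j (dif h) (dif h f) x) +
  iter j (dif h) (fun x => dif h b x * f (x + h)) x); last first.
  by apply/funext => x; rewrite iterSr difM iter_difD iterSr addrAC.
apply: le_trans (nrmD _ _) _.
- apply: l2B; first exact: l2_iter_dif.
  by apply: (l2_mul_bounded pb mb b0); apply: l2_iter_dif => //; exact: l2_dif.
- exact: l2_iter_dif.
rewrite (_ : 2 ^+ j.+1 * M * K * r ^+ j.+1 =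
  2 ^+ j * M * (K * r) * r ^+ j + 2 ^+ j * (M * r) * K * r ^+ j); last by rewrite !exprS; ring.
apply: lerD.
  apply: IH => //; first exact: mulr_ge0; first exact: l2_dif.
  - by move=> l lj x; apply: Hb; rewrite (leq_trans lj).
  - by move=> l lj; rewrite -iterSr -mulrA -exprS; exact: Hf.
apply: iter_difM_bound => //; try exact: mulr_ge0.
- exact: dif_periodic.
- exact: tmeas_dif.
- by move=> l lj x; rewrite -iterSr -mulrA -exprS; exact: Hb.
- move=> l lj; rewrite (_ : iter l _ _ = fun x => iter l (dif h) f (x + h)); last first.
    by apply/funext => x; exact: iter_dif_shift.
  by rewrite nrm_shift//; [exact: Hf|exact: l2_iter_dif].
Qed.

Lemma integrable_sum_mul I (r : seq I) (U V : I -> 'rV[R]_d -> R) :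
  (forall i, l2 (U i)) -> (forall i, l2 (V i)) ->
  mu.-integrable setT (fun t => (\sum_(i <- r) U i (torus_pt t) * V i (torus_pt t))%:E).
Proof.
move=> U2 V2; elim: r => [|i r IH].
  by under eq_fun do rewrite big_nil; exact: finite_measure_integrable_cst.
under eq_fun do rewrite big_cons EFinD.
by apply: integrableD => //; exact: (torus_L2M (U2 i).2 (V2 i).2).
Qed.

Lemma torus_int_sum_mul I (r : seq I) (U V : I -> 'rV[R]_d -> R) :
  (forall i, l2 (U i)) -> (forall i, l2 (V i)) ->
  \sum_(i <- r) ip (U i) (V i) = torus_int (fun x => \sum_(i <- r) U i x * V i x).
Proof.
move=> U2 V2; elim: r => [|i r IH].
  rewrite big_nil /torus_int; under eq_Rintegral do rewrite big_nil.
  by rewrite Rintegral_cst// mul0r.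
rewrite big_cons IH /ip /torus_int -RintegralD//.
- by apply: eq_Rintegral => t _; rewrite big_cons.
- exact: (torus_L2M (U2 i).2 (V2 i).2).
- exact: integrable_sum_mul.
Qed.

Lemma le_sum_ip I (r : seq I) (F G F' G' : I -> 'rV[R]_d -> R) :
  (forall i, l2 (F i)) -> (forall i, l2 (G i)) ->
  (forall i, l2 (F' i)) -> (forall i, l2 (G' i)) ->
  (forall x, \sum_(i <- r) F i x * G i x <= \sum_(i <- r) F' i x * G' i x) ->
  \sum_(i <- r) ip (F i) (G i) <= \sum_(i <- r) ip (F' i) (G' i).
Proof.
move=> F2 G2 F2' G2' H; rewrite !torus_int_sum_mul//.
by apply: le_Rintegral => //; exact: integrable_sum_mul.
Qed.

End leibniz.

Section regularity.
Context {R : realType} {d : nat}.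
Variables (lam M : R).

(* [kreg n * r ^ l] bounds the differences of order [l < n] of a solution, for steps of
   relative size [r]; the recursion is the energy estimate for the commutator. *)
Fixpoint kreg (n : nat) : R := if n is n'.+1 then
  kreg n' + lam * (d%:R * (d%:R * (2 ^+ n' * M * kreg n') + M)) else 0.

Lemma kreg_ge0 n : 0 <= lam -> 0 <= M -> 0 <= kreg n.
Proof.
move=> l0 M0; elim: n => //= n IH.
by rewrite addr_ge0// mulr_ge0// mulr_ge0// addr_ge0// mulr_ge0// !mulr_ge0// exprn_ge0.
Qed.

(** One constant is carried for all orders below [n], since the commutator at order [n] involves all
    of them. The bound [n <= p.+1] makes order [p] the last one reached. *)
Lemma elliptic_regularity (A : 'I_d -> 'I_d -> 'rV[R]_d -> R) (G E : 'I_d -> 'rV[R]_d -> R)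
    (h : 'rV[R]_d) (r : R) (p : nat) :
  0 < lam -> 0 <= M -> 0 <= r -> ushift h ->
  (forall i j, torus_periodic (A i j)) -> (forall i j, tmeas (A i j)) ->
  (forall i, l2 (G i)) -> (forall i, l2 (E i)) ->
  gradlike E -> divfree (fun i x => \sum_j A i j x * E j x + G i x) ->
  (forall x (xi : 'I_d -> R),
     lam^-1 * \sum_i xi i ^+ 2 <= \sum_i xi i * \sum_j A i j x * xi j) ->
  (forall i j l, (l <= p)%N -> forall x, `|iter l (dif h) (A i j) x| <= M * r ^+ l) ->
  (forall i l, (l <= p)%N -> nrm (iter l (dif h) (G i)) <= M * r ^+ l) ->
  forall n l i, (l < n)%N -> (n <= p.+1)%N -> nrm (iter l (dif h) (E i)) <= kreg n * r ^+ l.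
Proof.
move=> l0 M0 r0 h01 pA mA G2 E2 gE dQ coer bA bG.
have k0 n := kreg_ge0 n (ltW l0) M0.
have A0 i j x : `|A i j x| <= M by have := bA i j 0%N isT x; rewrite expr0 mulr1.
(* Orders below [n] follow from the induction hypothesis because [kreg] is nondecreasing; only
   [l = n] needs the energy estimate. *)
elim=> // n IH l i; rewrite ltnS leq_eqVlt => /orP[/eqP -> {l}|ln] np; last first.
  apply: le_trans (IH l i ln (ltnW np)) _; rewrite ler_wpM2r ?exprn_ge0//= lerDl.
  by rewrite mulr_ge0 ?(ltW l0)// mulr_ge0// addr_ge0// mulr_ge0// !mulr_ge0// exprn_ge0.
set D := iter n (dif h); pose F j := D (E j).
have F2 j : l2 (F j) by exact: l2_iter_dif.
have AF2 k j : l2 (fun x => A k j x * F j x) by exact: (l2_mul_bounded (pA k j) (mA k j) (A0 k j)).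
have AE2 k j : l2 (fun x => A k j x * E j x) by exact: (l2_mul_bounded (pA k j) (mA k j) (A0 k j)).
pose Q k (x : 'rV[R]_d) := \sum_j A k j x * E j x + G k x.
have Q2 k : l2 (Q k) by apply: l2D => //; exact: l2_sum.
have DQ2 k : l2 (D (Q k)) by exact: l2_iter_dif.
pose B k (x : 'rV[R]_d) := \sum_j A k j x * F j x.
have B2 k : l2 (B k) by exact: l2_sum.
have orth : \sum_k ip (F k) (D (Q k)) = 0.
  suff [gF dF] : gradlike F /\ divfree (fun k => D (Q k)) by exact: gradlike_divfree_orth.
  rewrite /F /D; elim: (n) => [|j [IH1 IH2]]; first by split.
  split; first by apply: (gradlike_dif h01 _ IH1) => k; exact: l2_iter_dif.
  by apply: (divfree_dif h01 _ IH2) => k; exact: l2_iter_dif.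
pose rho := d%:R * (2 ^+ n * M * kreg n) + M.
have rho0 : 0 <= rho by rewrite addr_ge0// mulr_ge0// !mulr_ge0// exprn_ge0.
have Rm k : nrm (fun x => D (Q k) x - B k x) <= rho * r ^+ n.
  rewrite (_ : (fun x => _) = fun x => \sum_j (D (fun x => A k j x * E j x) x - A k j x * F j x) + D (G k) x); last first.
    by apply/funext => x; rewrite /D /Q iter_difD iter_dif_sum sumrB addrAC.
  have c2 j : l2 (fun x => D (fun x => A k j x * E j x) x - A k j x * F j x).
    by apply: l2B => //; exact: l2_iter_dif.
  apply: le_trans (nrmD _ _) _; [exact: l2_sum|exact: l2_iter_dif|].
  rewrite mulrDl; apply: lerD; last exact: bG.
  apply: le_trans (nrm_sum _ _) _ => //.
  apply: (@le_trans _ _ (\sum_(j < d) 2 ^+ n * M * kreg n * r ^+ n)).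
    apply: ler_sum => j _; apply: commutator_bound => //.
    - by move=> l ln x; apply: bA; exact: (leq_trans ln np).
    - by move=> l ln; apply: IH => //; exact: ltnW.
  by rewrite sumr_const card_ord -[leLHS]mulr_natl mulrA.
pose V := Num.sqrt (\sum_k ip (F k) (F k)).
have S0 : 0 <= \sum_k ip (F k) (F k) by rewrite sumr_ge0// => k _; exact: ip_ge0.
have V0 : 0 <= V by exact: sqrtr_ge0.
have FV k : nrm (F k) <= V.
  rewrite ler_wsqrtr// (bigD1 k)//= lerDl sumr_ge0// => j _; exact: ip_ge0.
have HV : lam^-1 * V ^+ 2 <= V * (d%:R * (rho * r ^+ n)).
  rewrite sqr_sqrtr//.
  apply: (@le_trans _ _ (\sum_k ip (F k) (B k))).
    have := @le_sum_ip R d _ (index_enum 'I_d) (fun k x => lam^-1 * F k x) F F B.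
    under eq_bigr do rewrite ipZl//; rewrite -big_distrr/=; apply => //.
      by move=> k; exact: l2Z.
    move=> x; have := coer x (F ^~ x); rewrite big_distrr/=.
    by under eq_bigr do rewrite expr2 mulrA.
  (* Subtracting the vanishing pairing with the differenced flux replaces [B] by [B - D Q], which
     consists of commutators and the source. *)
  apply: (@le_trans _ _ (\sum_k (ip (F k) (B k) - ip (F k) (D (Q k))))).
    by rewrite sumrB orth subr0.
  apply: (@le_trans _ _ (\sum_(k < d) V * (rho * r ^+ n))); last first.
    by rewrite sumr_const card_ord -[leLHS]mulr_natl mulrCA.
  apply: ler_sum => k _; rewrite -ipBr//.
  have BQ2 : l2 (fun x => B k x - D (Q k) x) by exact: l2B.
  apply: le_trans (ler_ip_nrm (F2 k) BQ2) _; apply: ler_pM; rewrite ?nrm_ge0//.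
  rewrite (_ : (fun x => _) = fun x => - (D (Q k) x - B k x)).
    by rewrite nrmN//; exact: l2B.
  by apply/funext => x; rewrite opprB.
apply: le_trans (FV i) _.
have : V <= lam * (d%:R * (rho * r ^+ n)).
  have [->|Vn0] := eqVneq V 0; first by rewrite mulr_ge0 ?(ltW l0)// mulr_ge0// mulr_ge0// exprn_ge0.
  have {}Vn0 : 0 < V by rewrite lt0r Vn0.
  rewrite -ler_pdivrMl// -(ler_pM2l Vn0); apply: le_trans HV.
  by rewrite mulrCA expr2.
move/le_trans; apply.
change (kreg n.+1) with (kreg n + lam * (d%:R * rho)).
by rewrite [leRHS]mulrDl -!mulrA lerDr mulr_ge0// exprn_ge0.
Qed.

End regularity.

(** * Tail of the Fourier expansion *)

Section tail.
Context {R : realType} {d : nat}.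
Local Notation mu := (torus_measure R d).
Implicit Types (f : 'rV[R]_d -> R) (x h : 'rV[R]_d) (m : 'rV[int]_d).

(** Where cos exceeds 1/2 the mean value theorem gives sin u >= u/2, and 2 - 2 cos u = 4 sin(u/2)^2.
    The loss of a factor 4 is harmless below. *)
Lemma cos_quadratic_near0 : exists2 delta : R, 0 < delta &
  forall y : R, `|y| <= delta -> y ^+ 2 / 4 <= 2 - 2 * cos y.
Proof.
have cos_cvg : cos c @[c --> (0 : R)] --> (1 : R).
  by rewrite -cos0; exact: continuous_cos.
have : \forall c \near (0 : R), 1 / 2 < cos c by apply: (cvgr_gt _ cos_cvg); lra.
move=> /nbhs_ballP[e /= e0 He]; exists e => // y ye.
have singe (u : R) : 0 < u -> u < e -> u / 2 <= sin u.
  move=> u0 ue; have [|c] := @MVT R sin cos 0 u u0 (fun t _ => is_derive_sin t).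
    by apply: continuous_subspaceT; exact: continuous_sin.
  rewrite in_itv/= sin0 !subr0 => /andP[c0 cu] ->.
  have : 1 / 2 < cos c.
    by apply: He; rewrite /ball/= sub0r normrN gtr0_norm// (lt_trans cu).
  nra.
have main (u : R) : 0 <= u <= e -> u ^+ 2 / 4 <= 2 - 2 * cos u.
  move=> /andP[]; rewrite le_eqVlt => /orP[/eqP <- _|u0 ue].
    by rewrite cos0; lra.
  have := singe (u / 2); have -> : cos u = 1 - 2 * sin (u / 2) ^+ 2.
    rewrite [u in cos u](_ : u = u / 2 + u / 2); last by rewrite -splitr.
    by rewrite cosD; have := cos2Dsin2 (u / 2); lra.
  move=> H; have {}H := H ltac:(lra) ltac:(lra); nra.
have [y0|y0] := lerP 0 y; first by apply: main; rewrite y0 -(ger0_norm y0).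
rewrite -sqrrN -cosN; apply: main; rewrite oppr_ge0 (ltW y0)/=.
by rewrite -(ltr0_norm y0).
Qed.

(** At a frequency with a large i-th coordinate, p differences in direction [i] multiply the energy
    by at least (N c)^(2p). Bessel's inequality for the differences and the hypothesis bound the
    result by (K (c/eps)^p)^2; the step [c] cancels, and the sum over directions gives the factor
    [d]. *)
Lemma fourier_tail f (K eps N : R) p (G : seq 'rV[int]_d) :
  l2 f -> 0 <= K -> 0 < eps -> 0 < N -> uniq G ->
  (forall m, m \notin G -> exists i, N <= 2 * `|(m 0 i)%:~R|) ->
  (forall i (c : R), 0 < c < 1 ->
     nrm (iter p (dif (c *: delta_mx 0 i)) f) <= K * (c / eps) ^+ p) ->
  ip f f - \sum_(m <- G) en f m <= d%:R * (K * (N * eps) ^- p) ^+ 2.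
Proof.
move=> f2 K0 eps0 N0 uG HG Hf; apply/ler_addgt0Pr => e e0.
have [S HS] := parseval_approx f2 e0.
pose S1 := [seq m <- undup S | m \notin G].
have uS1 : uniq S1 by rewrite filter_uniq ?undup_uniq.
have uS' : uniq (G ++ S1).
  rewrite cat_uniq uG uS1 andbT/=; apply/hasPn => m.
  by rewrite mem_filter => /andP[].
have sub : {subset S <= G ++ S1}.
  by move=> m mS; rewrite mem_cat mem_filter mem_undup mS andbT orbN.
have := HS _ uS' sub; rewrite big_cat/= => H.
suff : \sum_(m <- S1) en f m <= d%:R * (K * (N * eps) ^- p) ^+ 2 by lra.
have [delta delta0 Hdelta] := cos_quadratic_near0.
pose B := \sum_(m <- S1) \sum_i `|2 * pi * (m 0 i)%:~R : R|.
have B0 : 0 <= B by rewrite sumr_ge0// => m _; rewrite sumr_ge0.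
pose c := Num.min (1 / 2) (delta / (B + 1)).
have B1 : 0 < B + 1 by rewrite ltr_wpDl.
have c0 : 0 < c by rewrite lt_min divr_gt0//= divr_gt0.
have c1 : c < 1 by rewrite gt_min; apply/orP; left; lra.
have cB : c * (B + 1) <= delta.
  by rewrite -ler_pdivlMr// ge_min lexx orbT.
have en0 g m : 0 <= en g m by rewrite /en addr_ge0 ?sqr_ge0.
have bnd i m : m \in S1 -> N <= 2 * `|(m 0 i)%:~R : R| ->
    en f m <= (N * c) ^- p ^+ 2 * en (iter p (dif (c *: delta_mx 0 i)) f) m.
  move=> mS Nm; rewrite en_iter_dif//; last by apply: ushift_delta; rewrite (ltW c0).
  rewrite fphZ fph_delta.
  have small : `|c * (2 * pi * (m 0 i)%:~R)| <= delta.
    apply: le_trans cB; rewrite normrM (gtr0_norm c0) ler_wpM2l ?(ltW c0)//.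
    apply: (@le_trans _ _ B); last by rewrite lerDl.
    rewrite /B (bigD1_seq m)//= (bigD1 i)//= -addrA lerDl addr_ge0 ?sumr_ge0//.
    by move=> *; rewrite sumr_ge0.
  have := Hdelta _ small; move: (cos _) => cs Hcs.
  (* The quarter lost in the quadratic bound is regained from 2 <= pi: half of the phase is pi |m_i|
     c >= 2 |m_i| c >= N c. *)
  have Nc : (N * c) ^+ 2 <= 2 - 2 * cs.
    apply: le_trans Hcs; rewrite !exprMn [leRHS](_ : _ = (pi * `|(m 0 i)%:~R|) ^+ 2 * c ^+ 2); last first.
      by rewrite [in RHS]exprMn real_normK ?num_real//; field.
    rewrite ler_wpM2r ?sqr_ge0// lerXn2r ?nnegrE ?mulr_ge0 ?pi_ge0 ?(ltW N0)//.
    by apply: le_trans Nm _; rewrite ler_wpM2r// pi_ge2.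
  have Ncp : 0 < (N * c) ^+ p by rewrite exprn_gt0// mulr_gt0.
  have Ncs : (N * c) ^+ p ^+ 2 <= (2 - 2 * cs) ^+ p.
    by rewrite exprAC lerXn2r ?nnegrE ?sqr_ge0// (le_trans _ Nc)// sqr_ge0.
  rewrite mulrA ler_peMl ?en0// (exprVn ((N * c) ^+ p) 2) ler_pdivlMl ?exprn_gt0//.
    by rewrite mulr1.
  exact: mulr_gt0.
apply: (@le_trans _ _ (\sum_(i < d) \sum_(m <- S1) (N * c) ^- p ^+ 2 *
    en (iter p (dif (c *: delta_mx 0 i)) f) m)).
  rewrite exchange_big /= big_seq [leRHS]big_seq; apply: ler_sum => m mS.
  have [|i Hi] := HG m; first by move: mS; rewrite mem_filter => /andP[].
  apply: le_trans (bnd i m mS Hi) _.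
  rewrite (bigD1 i)//= lerDl sumr_ge0// => j _; rewrite mulr_ge0 ?sqr_ge0 ?en0//.
apply: (@le_trans _ _ (\sum_(i < d) (K * (N * eps) ^- p) ^+ 2)); last first.
  by rewrite sumr_const card_ord -[leLHS]mulr_natl.
apply: ler_sum => i _; rewrite -big_distrr/=.
have cu : ushift (c *: delta_mx 0 i) by apply: ushift_delta; rewrite (ltW c0).
apply: (@le_trans _ _ ((N * c) ^- p ^+ 2 * (K * (c / eps) ^+ p) ^+ 2)).
  rewrite ler_wpM2l ?sqr_ge0//.
  apply: le_trans (bessel (l2_iter_dif p cu f2) uS1) _.
  rewrite -nrm_sqr lerXn2r ?nnegrE ?nrm_ge0 ?mulr_ge0 ?exprn_ge0 ?divr_ge0 ?(ltW c0) ?(ltW eps0)//.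
  by apply: Hf; rewrite c0.
rewrite le_eqVlt; apply/orP; left; apply/eqP; rewrite -exprMn; congr (_ ^+ 2).
by rewrite !exprMn exprVn; field; rewrite !expf_neq0 ?gt_eqF.
Qed.

End tail.

(** * From the assumptions on a, g and u to bounds on Fourier coefficients and differences *)

Section hypotheses.
Context {R : realType} {d : nat}.
Local Notation mu := (torus_measure R d).

Lemma weighted_norm_bound p (eps Cp : R) (X Y : nat -> \bar R) : 0 < eps ->
  (forall k, 0 <= X k)%E -> (forall k, 0 <= Y k)%E ->
  (\sum_(k < p.+1) (eps ^+ k)%:E * (X k + Y k) <= Cp%:E)%E ->
  forall k, (k <= p)%N -> (X k <= (Cp / eps ^+ k)%:E)%E /\ (Y k <= (Cp / eps ^+ k)%:E)%E.
Proof.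
move=> e0 X0 Y0 H k kp; have ek : 0 < eps ^+ k by exact: exprn_gt0.
have : (X k + Y k <= (Cp / eps ^+ k)%:E)%E.
  rewrite mulrC EFinM lee_pdivlMl//; apply: le_trans H.
  rewrite (bigD1 (Ordinal (kp : (k < p.+1)%N)))//=; apply: leeDl.
  apply: sume_ge0 => i _; rewrite mule_ge0 ?adde_ge0// lee_fin exprn_ge0// ltW//.
move=> XY; split; apply: le_trans XY; [exact: leeDl|exact: leeDr].
Qed.

Lemma grad_trig (a b : R) (m : 'rV[int]_d) x i :
  grad (trig a b m) x i 0 =
  trig (2 * pi * (m 0 i)%:~R * b) (- (2 * pi * (m 0 i)%:~R * a)) m x.
Proof.
rewrite mxE /pderiv/=.
by have [_ ->] := is_derive_trig a b m x (delta_mx 0 i); rewrite fph_delta.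
Qed.

(** Testing the weak gradient with cosines and sines expresses its coefficients as 2 pi m times
    those of [u], rotated by a quarter turn. *)
Lemma H1_gradlike (u : 'rV[R]_d -> R) (Du : 'rV[R]_d -> 'cV[R]_d) :
  H1_gradient u Du ->
  (forall i, l2 (fun x => Du x i 0)) /\ gradlike (fun i x => Du x i 0).
Proof.
move=> [pu pD u2 D2 H].
have l2D i : l2 (fun x => Du x i 0) by split => // j x; rewrite pD.
have l2u : l2 u by split.
split=> // m.
have key a b i : ip (fun x => Du x i 0) (trig a b m) =
    - ip u (trig (2 * pi * (m 0 i)%:~R * b) (- (2 * pi * (m 0 i)%:~R * a)) m).
  apply: oppr_inj; rewrite opprK; have := H _ (trig_test a b m) i.
  by under eq_fun do rewrite grad_trig; move=> <-.
exists (2 * pi * cb u m), (- (2 * pi * ca u m)) => i.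
rewrite {1}/ca {2}/cb /fcos /fsin !key !trig_linear//; split; ring.
Qed.

(** The weak equation is tested with [trig b c m], whose gradient is 2 pi m times a function
    independent of the direction. *)
Lemma elliptic_divfree (a : 'rV[R]_d -> 'M[R]_d) (g Du : 'rV[R]_d -> 'cV[R]_d) :
  (forall i j, l2 (fun x => a x i j * Du x j 0)) -> (forall i, l2 (fun x => g x i 0)) ->
  elliptic_solution a g Du ->
  divfree (fun i x => \sum_j a x i j * Du x j 0 + g x i 0).
Proof.
move=> aD2 g2 H m.
pose q i (x : 'rV[R]_d) := \sum_j a x i j * Du x j 0 + g x i 0.
have B2 i : l2 (fun x => \sum_j a x i j * Du x j 0) by exact: l2_sum.
have q2 i : l2 (q i) by exact: l2D.
have key b c : \sum_i (2 * pi * (m 0 i)%:~R) * (c * ca (q i) m - b * cb (q i) m) = 0.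
  have := H _ (trig_test b c m).
  have dotE (w : 'rV[R]_d -> 'cV[R]_d) : (forall i, l2 (fun x => w x i 0)) ->
      torus_int (fun x => dot (grad (trig b c m) x) (w x)) =
      \sum_i (2 * pi * (m 0 i)%:~R) * (c * ca (fun x => w x i 0) m - b * cb (fun x => w x i 0) m).
    move=> w2; have := torus_int_sum_mul (index_enum 'I_d)
      (U := fun i => trig (2 * pi * (m 0 i)%:~R * c) (- (2 * pi * (m 0 i)%:~R * b)) m)
      (V := fun i x => w x i 0).
    move=> /(_ (fun i => l2_trig _ _ _) w2) E.
    transitivity (torus_int (fun x => \sum_i trig (2 * pi * (m 0 i)%:~R * c) (- (2 * pi * (m 0 i)%:~R * b)) m x * w x i 0)).
      congr torus_int; apply/funext => x; rewrite /dot; apply: eq_bigr => i _.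
      by rewrite grad_trig.
    rewrite -E; apply: eq_bigr => i _; rewrite ipC trig_linear//; ring.
  have mE x i : (a x *m Du x) i 0 = \sum_j a x i j * Du x j 0 by rewrite mxE.
  rewrite !dotE//; last by move=> i; under eq_fun do rewrite mE.
  move=> H'; rewrite (eq_bigr (fun i => (2 * pi * (m 0 i)%:~R) *
      (c * ca (fun x => (a x *m Du x) i 0) m - b * cb (fun x => (a x *m Du x) i 0) m) +
    (2 * pi * (m 0 i)%:~R) * (c * ca (fun x => g x i 0) m - b * cb (fun x => g x i 0) m))).
    by rewrite big_split /= H' addNr.
  move=> i _; under eq_fun do rewrite mE.
  by rewrite /ca /cb /q !ipDl//; [ring|exact: l2_trig..].
have pi0 : 2 * pi != 0 :> R by rewrite mulf_neq0// gt_eqF// pi_gt0.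
split; apply: (mulfI pi0); rewrite mulr0 big_distrr/=.
(* The sine tests the coefficients [ca]; minus the cosine, in the next case, tests [cb]. *)
- rewrite -[RHS](key 0 1); apply: eq_bigr => i _.
  by rewrite mul0r subr0 mul1r mulrA.
- rewrite -[RHS](key (-1) 0); apply: eq_bigr => i _.
  by rewrite mul0r sub0r mulN1r opprK mulrA.
Qed.

Lemma coercive_sum (lam : R) (a : 'rV[R]_d -> 'M[R]_d) :
  (forall x xi, lam^-1 * dot xi xi <= dot xi (a x *m xi)) ->
  forall x (xi : 'I_d -> R),
    lam^-1 * \sum_i xi i ^+ 2 <= \sum_i xi i * \sum_j a x i j * xi j.
Proof.
move=> coer x xi; have := coer x (\col_i xi i); rewrite /dot.
under eq_bigr do rewrite mxE -expr2.
under [X in _ <= X -> _]eq_bigr do rewrite !mxE.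
by under [X in _ <= X -> _]eq_bigr do under eq_bigr do rewrite mxE.
Qed.

(** Steps of length [c] turn the derivative bounds [Cp / eps ^+ l] into Cp (c/eps)^l, the geometric
    form required by [elliptic_regularity] with r = c/eps. Hence [K] depends on neither [eps] nor
    [c]. *)
Lemma solution_bounds (p : nat) (lam Cp eps : R)
    (a : 'rV[R]_d -> 'M[R]_d) (g : 'rV[R]_d -> 'cV[R]_d)
    (u : 'rV[R]_d -> R) (Du : 'rV[R]_d -> 'cV[R]_d) :
  0 < lam -> 0 < eps -> torus_periodic a -> torus_periodic g ->
  (forall x xi, lam^-1 * dot xi xi <= dot xi (a x *m xi)) ->
  H1_gradient u Du -> elliptic_solution a g Du ->
  (forall i j, classC p (fun x => a x i j)) ->
  (forall i, classC p (fun x => g x i 0)) ->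
  (\sum_(k < p.+1) (eps ^+ k)%:E *
     (torus_norm +oo (nabla_norm k a) + torus_norm 2%:E (nabla_norm k g))
   <= Cp%:E)%E ->
  let K := kreg (d := d) lam Cp p.+1 in
  [/\ 0 <= Cp, forall i j x, `|a x i j| <= Cp, forall i, nrm (fun x => g x i 0) <= Cp,
    forall i, nrm (fun x => Du x i 0) <= K &
    forall j i (c : R), 0 < c < 1 ->
     nrm (iter p (dif (c *: delta_mx 0 i)) (fun x => Du x j 0)) <= K * (c / eps) ^+ p].
Proof.
move=> l0 e0 pa pg coer HDu Hell ca cg Hnorm K.
have HN := @weighted_norm_bound p eps Cp (fun k => torus_norm +oo (nabla_norm k a))
  (fun k => torus_norm 2%:E (nabla_norm k g)) e0
  (fun k => Lnorm_ge0 _ _ _) (fun k => Lnorm_ge0 _ _ _) Hnorm.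
have cg' i j : classC p (fun x => g x i j) by rewrite ord1; exact: cg.
have ba l i j k x : (l <= p)%N -> `|pderiv (nseq l k) (fun x => a x i j) x| <= Cp / eps ^+ l.
  by move=> lp; exact: (nabla_sup pa ca lp (HN l lp).1 [tuple of nseq l k]).
have bg l i k : (l <= p)%N -> nrm (pderiv (nseq l k) (fun x => g x i 0)) <= Cp / eps ^+ l.
  by move=> lp; exact: (nabla_l2 pg cg' lp (HN l lp).2 [tuple of nseq l k]).
have pa' i j : torus_periodic (fun x => a x i j) by move=> k x; rewrite pa.
have pg' i : torus_periodic (fun x => g x i 0) by move=> k x; rewrite pg.
have cca i j : continuous (fun x => a x i j) by exact: ((ca i j).1 [::]).
have ma i j := tmeas_continuous (cca i j).
have g2 i : l2 (fun x => g x i 0) by apply: l2_continuous => //; exact: ((cg i).1 [::]).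
have Cp0 : 0 <= Cp.
  have := le_trans (Lnorm_ge0 _ _ _) (HN 0%N (leq0n _)).2.
  by rewrite expr0 divr1 lee_fin.
have [E2 gE] := H1_gradlike HDu.
have ba0 i j x : `|a x i j| <= Cp.
  by have := nabla_sup pa ca (leq0n _) (HN 0%N (leq0n _)).1 [tuple] i j x; rewrite expr0 divr1.
have aE2 i j : l2 (fun x => a x i j * Du x j 0).
  exact: (l2_mul_bounded (pa' i j) (ma i j) (ba0 i j)).
have dQ := elliptic_divfree aE2 g2 Hell.
have coer' := coercive_sum coer.
have main i (c : R) l j : 0 < c < 1 -> (l <= p)%N ->
    nrm (iter l (dif (c *: delta_mx 0 i)) (fun x => Du x j 0)) <= K * (c / eps) ^+ l.
  move=> c01 lp; have /andP[c0 c1] := c01.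
  apply: (@elliptic_regularity R d lam Cp _ _ _ (c *: delta_mx 0 i) (c / eps) p l0 Cp0 _ _ pa' ma g2 E2 gE dQ coer') => //.
  - by rewrite divr_ge0 ?ltW.
  - by apply: ushift_delta; rewrite (ltW c0).
  - move=> k k' n np x; rewrite expr_div_n mulrCA.
    apply: (iter_dif_sup_bound (k := 0) c0 (ca k k') np) => y.
    by have := ba n k k' i y np; rewrite mulrC [leRHS]mulrC.
  - move=> k n np; rewrite expr_div_n mulrCA.
    apply: le_trans (iter_dif_l2_bound (k := 0) i c01 (pg' k) (cg k) np) _.
    by rewrite ler_wpM2l ?exprn_ge0 ?(ltW c0)//; exact: bg.
split => //.
- move=> i; have := nabla_l2 pg cg' (leq0n _) (HN 0%N (leq0n _)).2 [tuple] i 0.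
  by rewrite expr0 divr1.
(* At order 0 no difference is taken: the step 1/2 is an arbitrary admissible value, and the
   component index doubles as direction. *)
- by move=> i; have := @main i (1 / 2) 0%N i; rewrite expr0 mulr1 /=; apply => //; lra.
- by move=> j i c c01; exact: main.
Qed.

End hypotheses.

(** * Complex vectors and operator norms *)

Section complex_vectors.
Context {R : realType}.

(** Cauchy-Schwarz in terms of a nonnegative binary form, shared by the products on vectors and on
    grid fields. *)
Lemma psd_cauchy (a b c : R) :
  (forall s t, 0 <= s ^+ 2 * a + 2 * s * t * b + t ^+ 2 * c) ->
  b <= Num.sqrt a * Num.sqrt c.
Proof.
move=> H; have a0 : 0 <= a by have := H 1 0; rewrite expr1n expr0n/=; lra.
have c0 : 0 <= c by have := H 0 1; rewrite expr1n expr0n/=; lra.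
have [b0|b0] := lerP b 0; first by rewrite (le_trans b0)// mulr_ge0 ?sqrtr_ge0.
rewrite -sqrtrM// -(ger0_norm (ltW b0)) -sqrtr_sqr ler_wsqrtr//.
have [cz|cn0] := eqVneq c 0.
  (* For [c = 0] and [b > 0] the form is affine in [t] and takes the value -1 here. *)
  have := H 1 (- (a + 1) / b / 2); rewrite cz.
  rewrite (_ : _ + _ = - 1); first by rewrite lerNr oppr0 ler10.
  by field; rewrite gt_eqF.
have cp : 0 < c by rewrite lt_def cn0.
have := H c (- b); rewrite (_ : _ + _ = c * (a * c - b ^+ 2)); last by ring.
by rewrite pmulr_rge0// subr_ge0.
Qed.

Lemma ReD (z w : R[i]) : complex.Re (z + w) = complex.Re z + complex.Re w.
Proof. by case: z w => [? ?] [? ?]. Qed.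

Lemma ImD (z w : R[i]) : complex.Im (z + w) = complex.Im z + complex.Im w.
Proof. by case: z w => [? ?] [? ?]. Qed.

Lemma ReN (z : R[i]) : complex.Re (- z) = - complex.Re z.
Proof. by case: z. Qed.

Lemma ImN (z : R[i]) : complex.Im (- z) = - complex.Im z.
Proof. by case: z. Qed.

Lemma ReZ c (z : R[i]) : complex.Re (c%:C%C * z) = c * complex.Re z.
Proof. by case: z => ? ? /=; rewrite mul0r subr0. Qed.

Lemma ImZ c (z : R[i]) : complex.Im (c%:C%C * z) = c * complex.Im z.
Proof. by case: z => ? ? /=; rewrite mul0r addr0. Qed.

Lemma Re_sum I (r : seq I) (F : I -> R[i]) :
  complex.Re (\sum_(i <- r) F i) = \sum_(i <- r) complex.Re (F i).
Proof. by apply: (big_morph _ ReD). Qed.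

Lemma Im_sum I (r : seq I) (F : I -> R[i]) :
  complex.Im (\sum_(i <- r) F i) = \sum_(i <- r) complex.Im (F i).
Proof. by apply: (big_morph _ ImD). Qed.

Lemma Re_conjM (z w : R[i]) : complex.Re (z^* * w)%C =
  complex.Re z * complex.Re w + complex.Im z * complex.Im w.
Proof. by case: z w => [? ?] [? ?] /=; rewrite mulNr opprK. Qed.

Context {n : nat}.
Implicit Types v w : 'cV[R[i]]_n.

(* C^n is treated as a real inner product space: only real parts of Hermitian
   products are needed. *)
Definition vdot v w : R := \sum_i
  (complex.Re (v i 0) * complex.Re (w i 0) + complex.Im (v i 0) * complex.Im (w i 0)).

Lemma vdotC v w : vdot v w = vdot w v.
Proof. by apply: eq_bigr => i _; ring. Qed.

Lemma vdotDr v w w' : vdot v (w + w') = vdot v w + vdot v w'.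
Proof. by rewrite -big_split; apply: eq_bigr => i _; rewrite !mxE ReD ImD/=; ring. Qed.

Lemma vdotZr c v w : vdot v (c%:C%C *: w) = c * vdot v w.
Proof. by rewrite big_distrr; apply: eq_bigr => i _; rewrite !mxE ReZ ImZ/=; ring. Qed.

Lemma vdotNr v w : vdot v (- w) = - vdot v w.
Proof. by rewrite -sumrN; apply: eq_bigr => i _; rewrite !mxE ReN ImN/=; ring. Qed.

Lemma vdotBr v w w' : vdot v (w - w') = vdot v w - vdot v w'.
Proof. by rewrite vdotDr vdotNr. Qed.

Lemma vdot_ge0 v : 0 <= vdot v v.
Proof. by apply: sumr_ge0 => i _; rewrite -!expr2 addr_ge0 ?sqr_ge0. Qed.

Lemma vdot_eq0 v : vdot v v = 0 -> v = 0.
Proof.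
move=> v0; apply/colP => i; rewrite mxE; apply/eqP; rewrite eq_complex/=.
have /eqP : complex.Re (v i 0) * complex.Re (v i 0) +
    complex.Im (v i 0) * complex.Im (v i 0) = 0.
  by apply: (psumr_eq0P _ v0) => // j _; rewrite -!expr2 addr_ge0 ?sqr_ge0.
by rewrite -!expr2 paddr_eq0 ?sqr_ge0// !sqrf_eq0.
Qed.

Lemma Re_adjoint_mul v w : complex.Re ((v ^t* *m w)%sesqui 0 0) = vdot v w.
Proof. by rewrite mxE Re_sum; apply: eq_bigr => j _; rewrite !mxE Re_conjM. Qed.

Lemma cnormE v : cnorm v = Num.sqrt (vdot v v).
Proof. by []. Qed.

Lemma cnorm_ge0 v : 0 <= cnorm v. Proof. exact: sqrtr_ge0. Qed.

Lemma cnorm_sqr v : cnorm v ^+ 2 = vdot v v.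
Proof. by rewrite cnormE sqr_sqrtr// vdot_ge0. Qed.

Lemma vdot_lin s t v w :
  vdot (s%:C%C *: v + t%:C%C *: w) (s%:C%C *: v + t%:C%C *: w) =
  s ^+ 2 * vdot v v + 2 * s * t * vdot v w + t ^+ 2 * vdot w w.
Proof.
rewrite vdotDr !vdotZr !(vdotC (_ + _)) !vdotDr !vdotZr (vdotC w v); ring.
Qed.

Lemma vdot_cauchy v w : vdot v w <= cnorm v * cnorm w.
Proof. by apply: psd_cauchy => s t; rewrite -vdot_lin vdot_ge0. Qed.

Lemma cnormZ c v : cnorm (c%:C%C *: v) = `|c| * cnorm v.
Proof.
by rewrite !cnormE vdotZr vdotC vdotZr mulrA -expr2 sqrtrM ?sqr_ge0// sqrtr_sqr.
Qed.

End complex_vectors.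

Section operator_norm.
Context {R : realType} {V : Type} (N : V -> R) (T : V -> V) (sc : R -> V -> V).
Hypothesis NZ : forall c v, N (sc c v) = `|c| * N v.
Hypothesis TZ : forall c v, N (T (sc c v)) = `|c| * N (T v).
Hypothesis N0 : forall v, 0 <= N v.
Variable M : R.
Hypothesis TM : forall v, N (T v) <= M * N v.

(** The a priori bound [TM] makes the set of values bounded, so that [sup] is a genuine upper
    bound. *)
Lemma opnorm_ub v : N v <= 1 -> N (T v) <= opnorm N T.
Proof.
move=> v1; apply: ub_le_sup; last by exists v.
exists `|M| => _ [w /= w1 <-]; apply: le_trans (TM w) _.
rewrite (le_trans (ler_norm _))// normrM (ger0_norm (N0 w)).
by rewrite -[leRHS]mulr1 ler_wpM2l.
Qed.

Lemma opnorm_ge0 (v : V) : 0 <= opnorm N T.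
Proof.
apply: le_trans (N0 (T (sc 0 v))) (opnorm_ub _).
by rewrite NZ normr0 mul0r.
Qed.

Lemma le_opnorm v : N (T v) <= opnorm N T * N v.
Proof.
have [v0|v0] := eqVneq (N v) 0; first by have := TM v; rewrite v0 !mulr0.
have vp : 0 < N v by rewrite lt_def v0 N0.
rewrite -ler_pdivrMr// mulrC -[_^-1]gtr0_norm ?invr_gt0// -TZ.
by apply: opnorm_ub; rewrite NZ gtr0_norm ?invr_gt0// mulVf.
Qed.

End operator_norm.

(** * Grid fields *)

Section grid_fields.
Context {R : realType} {d L : nat}.
Local Notation gfield := (grid L d -> 'cV[R[i]]_d).
Implicit Types (k : grid L d) (m : 'rV[int]_d) (phi psi zeta : gfield).

Hypothesis L0 : (0 < L)%N.

Let q1 : (1 < 2 ^ L)%N. Proof. by rewrite -(expn0 2) ltn_exp2l. Qed.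

Let qE : (2 ^ L = 2 * 2 ^ L.-1)%N. Proof. by rewrite -expnS prednK. Qed.

Definition mrep k : 'rV[int]_d := \row_i signed_rep (k 0 i).

Definition mclass m : grid L d := map_mx intr m.

Lemma signed_repK (j : 'Z_(2 ^ L)) : (signed_rep j)%:~R = j.
Proof.
have E : (val j)%:R = j := natr_Zp j.
rewrite /signed_rep; case: ifP => _; first exact: E.
by rewrite rmorphB /= -!pmulrn E pchar_Zp ?subr0.
Qed.

Lemma signed_rep_intr (z : int) : 2 * `|z| < (2 ^ L)%:Z ->
  signed_rep (z%:~R : 'Z_(2 ^ L)) = z.
Proof.
case: z => n.
  move=> H; have nq : (2 * n < 2 ^ L)%N by move: H; move: (2 ^ L)%N => q; lia.
  rewrite -pmulrn /signed_rep val_Zp_nat// modn_small ?ifT//; lia.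
move=> H; have nq : (2 * n.+1 < 2 ^ L)%N by move: H; move: (2 ^ L)%N => q; lia.
rewrite NegzE.
have -> : (- n.+1%:Z)%:~R = (2 ^ L - n.+1)%:R :> 'Z_(2 ^ L).
  by rewrite mulrNz -pmulrn natrB ?pchar_Zp ?sub0r//; lia.
rewrite /signed_rep val_Zp_nat// modn_small ?ifF//; lia.
Qed.

Lemma mrepK : cancel mrep mclass.
Proof. by move=> k; apply/rowP => i; rewrite !mxE signed_repK. Qed.

Definition gfreq : seq 'rV[int]_d := [seq mrep k | k <- index_enum (grid L d)].

Lemma uniq_gfreq : uniq gfreq.
Proof. by rewrite map_inj_uniq ?index_enum_uniq//; exact: can_inj mrepK. Qed.

(** If every coordinate satisfied 2 |m_i| < 2^L, the signed representative of its class would be [m]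
    itself. This is the origin of the cut-off 2^L in the rate. *)
Lemma gfreq_notin m : m \notin gfreq ->
  exists i, (2 ^ L)%:R <= 2 * `|(m 0 i)%:~R : R|.
Proof.
move=> mG; apply: contrapT => H; move/negP: mG; apply.
suff -> : m = mrep (mclass m) by apply: map_f; rewrite mem_index_enum.
apply/rowP => i; rewrite !mxE.
have : 2 * `|m 0 i| < (2 ^ L)%:Z.
  rewrite ltNge; apply/negP => Hm; apply: H; exists i.
  by rewrite -intr_norm -(intrM R 2) pmulrn ler_int.
by move/signed_rep_intr ->.
Qed.

Lemma phaseE k x : phase k x = fph (mrep k) x :> R.
Proof. by apply: eq_bigr => i _; rewrite !mxE. Qed.

Definition iR phi j (x : 'rV[R]_d) : R := complex.Re (interpolate phi x j 0).
Definition iI phi j (x : 'rV[R]_d) : R := complex.Im (interpolate phi x j 0).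

(** The ratio between the l^2 norm of a grid field and the L^2 norm of its interpolate. *)
Definition gsc : R := 2 `^ ((L * d)%N%:R / 2).

Lemma gsc_gt0 : 0 < gsc. Proof. exact: powR_gt0. Qed.

Lemma gsc_sqr : gsc ^+ 2 = 2 ^+ (L * d).
Proof.
rewrite -powR_mulrn ?powR_ge0// -powRrM divfK ?pnatr_eq0//.
by rewrite powR_mulrn.
Qed.

Lemma gscV : 2 `^ (- (L * d)%N%:R / 2) = gsc^-1.
Proof. by rewrite mulNr powRN. Qed.

(** Coefficients are extended to all integer vectors through [mclass], to match the finite sums
    [tsumR] and [tsumI]. *)
Let cre phi j m := complex.Re (phi (mclass m) j 0).
Let cim phi j m := complex.Im (phi (mclass m) j 0).

Lemma iRE al be phi j : (forall k, complex.Re (phi k j 0) = al (mrep k)) ->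
  (forall k, complex.Im (phi k j 0) = be (mrep k)) ->
  iR phi j = fun x => gsc^-1 * tsumR gfreq al be x.
Proof.
move=> Hal Hbe; apply/funext => x.
rewrite /iR /interpolate gscV !mxE ReZ summxE Re_sum; congr (_ * _).
rewrite /tsumR big_map; apply: eq_bigr => k _; rewrite mxE phaseE -Hal -Hbe /trig /expi.
by case: (phi k j 0) => a b /=; rewrite cosN sinN; ring.
Qed.

Lemma iIE al be phi j : (forall k, complex.Re (phi k j 0) = al (mrep k)) ->
  (forall k, complex.Im (phi k j 0) = be (mrep k)) ->
  iI phi j = fun x => gsc^-1 * tsumI gfreq al be x.
Proof.
move=> Hal Hbe; apply/funext => x.
rewrite /iI /interpolate gscV !mxE ImZ summxE Im_sum; congr (_ * _).
rewrite /tsumI big_map; apply: eq_bigr => k _; rewrite mxE phaseE -Hal -Hbe /trig /expi.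
by case: (phi k j 0) => a b /=; rewrite cosN sinN; ring.
Qed.

Let creE phi j k : complex.Re (phi k j 0) = cre phi j (mrep k).
Proof. by rewrite /cre mrepK. Qed.

Let cimE phi j k : complex.Im (phi k j 0) = cim phi j (mrep k).
Proof. by rewrite /cim mrepK. Qed.

Lemma l2_iR phi j : l2 (iR phi j).
Proof. by rewrite (iRE (creE phi j) (cimE phi j)); apply: l2Z; exact: l2_tsumR. Qed.

Lemma l2_iI phi j : l2 (iI phi j).
Proof. by rewrite (iIE (creE phi j) (cimE phi j)); apply: l2Z; exact: l2_tsumI. Qed.

Lemma interpolateD phi psi x :
  interpolate (fun k => phi k + psi k) x = interpolate phi x + interpolate psi x :> 'cV[R[i]]_d.
Proof.
rewrite /interpolate -scalerDr -big_split; congr (_ *: _).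
by apply: eq_bigr => k _; exact: scalerDr.
Qed.

Lemma interpolateZ (c : R[i]) phi x :
  interpolate (fun k => c *: phi k) x = c *: interpolate phi x :> 'cV[R[i]]_d.
Proof.
rewrite /interpolate [RHS]scalerA (mulrC c) -[RHS]scalerA; congr (_ *: _).
rewrite scaler_sumr; by apply: eq_bigr => k _; rewrite !scalerA mulrC.
Qed.

Lemma iR_lin (c : R) phi psi zeta j x :
  iR (fun k => phi k + (psi k + c%:C%C *: zeta k)) j x =
  iR phi j x + iR psi j x + c * iR zeta j x.
Proof.
rewrite /iR !interpolateD interpolateZ.
move: (interpolate phi x) (interpolate psi x) (interpolate zeta x) => u v w.
by rewrite !mxE !ReD ReZ addrA.
Qed.

Lemma iI_lin (c : R) phi psi zeta j x :
  iI (fun k => phi k + (psi k + c%:C%C *: zeta k)) j x =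
  iI phi j x + iI psi j x + c * iI zeta j x.
Proof.
rewrite /iI !interpolateD interpolateZ.
move: (interpolate phi x) (interpolate psi x) (interpolate zeta x) => u v w.
by rewrite !mxE !ImD ImZ addrA.
Qed.

Definition rdot phi psi : R := \sum_k vdot (phi k) (psi k).

Lemma rdotE phi psi : complex.Re (grid_dot phi psi) = rdot phi psi.
Proof.
by rewrite /grid_dot Re_sum; apply: eq_bigr => k _; exact: Re_adjoint_mul.
Qed.

Lemma rdotC phi psi : rdot phi psi = rdot psi phi.
Proof. by apply: eq_bigr => k _; exact: vdotC. Qed.

Lemma rdotDr zeta phi psi :
  rdot zeta (fun k => phi k + psi k) = rdot zeta phi + rdot zeta psi.
Proof. by rewrite -big_split; apply: eq_bigr => k _; exact: vdotDr. Qed.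

Lemma rdotBr zeta phi psi :
  rdot zeta (fun k => phi k - psi k) = rdot zeta phi - rdot zeta psi.
Proof. by rewrite -sumrB; apply: eq_bigr => k _; exact: vdotBr. Qed.

Lemma rdotZr c zeta phi : rdot zeta (fun k => c%:C%C *: phi k) = c * rdot zeta phi.
Proof. by rewrite big_distrr; apply: eq_bigr => k _; exact: vdotZr. Qed.

Lemma rdot_ge0 phi : 0 <= rdot phi phi.
Proof. by apply: sumr_ge0 => k _; exact: vdot_ge0. Qed.

Lemma rdot_eq0 phi : rdot phi phi = 0 -> phi = fun=> 0.
Proof.
move=> H; apply/funext => k; apply: vdot_eq0.
by apply: (psumr_eq0P _ H) => // i _; exact: vdot_ge0.
Qed.

Lemma grid_normE phi : grid_norm phi = Num.sqrt (rdot phi phi).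
Proof. by congr Num.sqrt; apply: eq_bigr => k _; rewrite cnorm_sqr. Qed.

Lemma grid_norm_ge0 phi : 0 <= grid_norm phi. Proof. exact: sqrtr_ge0. Qed.

Lemma grid_norm_sqr phi : grid_norm phi ^+ 2 = rdot phi phi.
Proof. by rewrite grid_normE sqr_sqrtr// rdot_ge0. Qed.

Lemma rdot_cauchy phi psi : rdot phi psi <= grid_norm phi * grid_norm psi.
Proof.
rewrite !grid_normE; apply: psd_cauchy => s t.
rewrite /rdot !mulr_sumr -!big_split /=; apply: sumr_ge0 => k _.
by rewrite -vdot_lin vdot_ge0.
Qed.

Lemma grid_normZ c phi : grid_norm (fun k => c%:C%C *: phi k) = `|c| * grid_norm phi.
Proof.
by rewrite !grid_normE rdotZr rdotC rdotZr mulrA -expr2 sqrtrM ?sqr_ge0// sqrtr_sqr.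
Qed.

Lemma grid_normD phi psi : grid_norm (fun k => phi k + psi k) <= grid_norm phi + grid_norm psi.
Proof.
rewrite -(@ler_pXn2r _ 2)// ?nnegrE ?addr_ge0 ?grid_norm_ge0//.
rewrite sqrrD !grid_norm_sqr rdotDr (rdotC _ phi) (rdotC _ psi) !rdotDr.
by have := rdot_cauchy phi psi; rewrite (rdotC psi phi); lra.
Qed.

(** Parseval for interpolates: distinct grid points have distinct frequencies, and the exponentials
    are orthonormal. *)
Lemma rdot_iso phi psi :
  rdot phi psi = gsc ^+ 2 * \sum_j (ip (iR phi j) (iR psi j) + ip (iI phi j) (iI psi j)).
Proof.
rewrite /rdot /vdot exchange_big/= big_distrr/=; apply: eq_bigr => j _.
rewrite !(iRE (creE _ j) (cimE _ j)) !(iIE (creE _ j) (cimE _ j)).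
rewrite !ipZl ?ipZr; try by [apply: l2Z; exact: l2_tsumR|apply: l2Z; exact: l2_tsumI|exact: l2_tsumR|exact: l2_tsumI].
rewrite -!mulrDr ip_tsum ?uniq_gfreq// big_map !mulrA expr2.
rewrite -(mulrA gsc) mulfV ?gt_eqF ?gsc_gt0// mulr1 mulfV ?gt_eqF ?gsc_gt0// mul1r.
by apply: eq_bigr => k _; rewrite /cre /cim !mrepK.
Qed.

Lemma nrm_iR phi j : gsc * nrm (iR phi j) <= grid_norm phi.
Proof.
rewrite -(@ler_pXn2r _ 2)// ?nnegrE ?mulr_ge0 ?grid_norm_ge0 ?nrm_ge0 ?(ltW gsc_gt0)//.
rewrite exprMn nrm_sqr grid_norm_sqr rdot_iso ler_wpM2l ?sqr_ge0//.
rewrite (bigD1 j)//= -addrA lerDl addr_ge0 ?ip_ge0// sumr_ge0// => i _.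
by rewrite addr_ge0 ?ip_ge0.
Qed.

Lemma nrm_iI phi j : gsc * nrm (iI phi j) <= grid_norm phi.
Proof.
rewrite -(@ler_pXn2r _ 2)// ?nnegrE ?mulr_ge0 ?grid_norm_ge0 ?nrm_ge0 ?(ltW gsc_gt0)//.
rewrite exprMn nrm_sqr grid_norm_sqr rdot_iso ler_wpM2l ?sqr_ge0//.
rewrite (bigD1 j)//= addrAC lerDr addr_ge0 ?ip_ge0// sumr_ge0// => i _.
by rewrite addr_ge0 ?ip_ge0.
Qed.

Section exact_source.
Local Notation exact_source F := (exact_source F : gfield).
Variable F : 'rV[R]_d -> 'cV[R]_d.
Hypothesis F2 : forall j, l2 (fun x => F x j 0).
Let f j x := F x j 0.

Lemma Re_exact_source k j :
  complex.Re (exact_source F k j 0) = gsc * ca (f j) (mrep k).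
Proof.
rewrite mxE ReZ /=; congr (_ * torus_int _); apply/funext => x.
by rewrite /fcos /trig phaseE /f /=; ring.
Qed.

Lemma Im_exact_source k j :
  complex.Im (exact_source F k j 0) = gsc * cb (f j) (mrep k).
Proof.
rewrite mxE ImZ /=; congr (_ * torus_int _); apply/funext => x.
by rewrite /fsin /trig phaseE /f /=; ring.
Qed.

(** The interpolate of [zeta] only has grid frequencies, so it does not see the truncation of [F].
    Its imaginary part is absent because [F] is real. *)
Lemma rdot_exact_source zeta :
  rdot zeta (exact_source F) = gsc ^+ 2 * \sum_j ip (iR zeta j) (f j).
Proof.
rewrite /rdot /vdot exchange_big/= big_distrr/=; apply: eq_bigr => j _.
rewrite (iRE (creE zeta j) (cimE zeta j)) ipZl; [|exact: l2_tsumR|exact: F2].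
rewrite ipC ip_tsumR//; last exact: F2.
rewrite mulrA (_ : gsc ^+ 2 / gsc = gsc) ?big_map; last first.
  by rewrite expr2 mulfK// gt_eqF// gsc_gt0.
rewrite big_distrr/=; apply: eq_bigr => k _.
by rewrite Re_exact_source Im_exact_source (creE zeta) (cimE zeta); ring.
Qed.

(** The interpolate of the exact coefficients is the Fourier sum of [F] over the grid, so the error
    is the discarded energy, by [dist_fourier]. *)
Lemma dist_exact_source j :
  ip (fun x => iR (exact_source F) j x - f j x) (fun x => iR (exact_source F) j x - f j x) +
  ip (iI (exact_source F) j) (iI (exact_source F) j) =
  ip (f j) (f j) - \sum_(m <- gfreq) en (f j) m.
Proof.
have gn0 : gsc != 0 by rewrite gt_eqF// gsc_gt0.
have -> : iR (exact_source F) j = tsumR gfreq (ca (f j)) (cb (f j)).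
  rewrite (@iRE (fun m => gsc * ca (f j) m) (fun m => gsc * cb (f j) m) (exact_source F) j
    (Re_exact_source^~ j) (Im_exact_source^~ j)).
  apply/funext => x; rewrite /tsumR big_distrr/=; apply: eq_bigr => m _.
  by rewrite /trig; field.
have -> : iI (exact_source F) j = tsumI gfreq (ca (f j)) (cb (f j)).
  rewrite (@iIE (fun m => gsc * ca (f j) m) (fun m => gsc * cb (f j) m) (exact_source F) j
    (Re_exact_source^~ j) (Im_exact_source^~ j)).
  apply/funext => x; rewrite /tsumI big_distrr/=; apply: eq_bigr => m _.
  by rewrite /trig; field.
rewrite -(dist_fourier (F2 j) uniq_gfreq); congr (torus_int _ + _).
by apply/funext => x; rewrite /f; ring.
Qed.

Lemma grid_norm_exact_source (M : R) : (forall j, nrm (f j) <= M) -> 0 <= M ->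
  grid_norm (exact_source F) <= gsc * (d%:R * M).
Proof.
move=> HM M0.
rewrite -(@ler_pXn2r _ 2)// ?nnegrE ?mulr_ge0 ?grid_norm_ge0 ?(ltW gsc_gt0)//.
rewrite grid_norm_sqr /rdot /vdot exchange_big/=.
apply: (@le_trans _ _ (\sum_(j < d) gsc ^+ 2 * M ^+ 2)).
  apply: ler_sum => j _; apply: (@le_trans _ _ (gsc ^+ 2 * ip (f j) (f j))).
    apply: le_trans (_ : gsc ^+ 2 * \sum_(m <- gfreq) en (f j) m <= _); last first.
      by rewrite ler_wpM2l ?sqr_ge0//; apply: bessel; [exact: F2|exact: uniq_gfreq].
    rewrite big_map big_distrr le_eqVlt /=; apply/orP; left; apply/eqP.
    by apply: eq_bigr => k _; rewrite Re_exact_source Im_exact_source /en; ring.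
  by rewrite ler_wpM2l ?sqr_ge0// -nrm_sqr lerXn2r ?nnegrE ?nrm_ge0.
rewrite sumr_const card_ord (_ : _ * _ *+ d = gsc ^+ 2 * (d%:R * M ^+ 2)); last first.
  by rewrite -[LHS]mulr_natl; ring.
rewrite !exprMn ler_wpM2l ?sqr_ge0//.
rewrite ler_wpM2r ?sqr_ge0// -natrX ler_nat; case: d => // n.
by rewrite expnS leq_pmulr.
Qed.

End exact_source.

End grid_fields.

(** * The Leray projector *)

Section matrix_bounds.
Context {R : realType} {d : nat}.
Local Notation cmx := (map_mx (real_complex R)).
Implicit Types (v w : 'cV[R[i]]_d).

Lemma Re_cmx_mul (B : 'M[R]_d) v i :
  complex.Re ((cmx B *m v) i 0) = \sum_j B i j * complex.Re (v j 0).
Proof. by rewrite mxE Re_sum; apply: eq_bigr => j _; rewrite mxE ReZ. Qed.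

Lemma Im_cmx_mul (B : 'M[R]_d) v i :
  complex.Im ((cmx B *m v) i 0) = \sum_j B i j * complex.Im (v j 0).
Proof. by rewrite mxE Im_sum; apply: eq_bigr => j _; rewrite mxE ImZ. Qed.

Lemma vdot_trmx (B : 'M[R]_d) v w : vdot v (cmx B *m w) = vdot (cmx B^T *m v) w.
Proof.
rewrite /vdot; under eq_bigr do rewrite Re_cmx_mul Im_cmx_mul !big_distrr -big_split /=.
under [RHS]eq_bigr do rewrite Re_cmx_mul Im_cmx_mul !big_distrl -big_split /=.
rewrite exchange_big; apply: eq_bigr => j _; apply: eq_bigr => i _.
by rewrite mxE; ring.
Qed.

Lemma cnormD v w : cnorm (v + w) <= cnorm v + cnorm w.
Proof.
rewrite -(@ler_pXn2r _ 2)// ?nnegrE ?addr_ge0 ?cnorm_ge0//.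
rewrite sqrrD !cnorm_sqr vdotDr (vdotC _ v) (vdotC _ w) !vdotDr.
by have := vdot_cauchy v w; rewrite (vdotC w v); lra.
Qed.

Lemma cnorm0 : cnorm (0 : 'cV[R[i]]_d) = 0.
Proof. by have := cnormZ 0 (0 : 'cV[R[i]]_d); rewrite scaler0 normr0 mul0r. Qed.

Lemma cnorm_sum I (r : seq I) (F : I -> 'cV[R[i]]_d) :
  cnorm (\sum_(i <- r) F i) <= \sum_(i <- r) cnorm (F i).
Proof.
elim: r => [|i r IH]; first by rewrite !big_nil cnorm0.
by rewrite !big_cons (le_trans (cnormD _ _))// lerD2l.
Qed.

Lemma ler_cnorm v i : `|complex.Re (v i 0)| + `|complex.Im (v i 0)| <= 2 * cnorm v.
Proof.
have H (x y : R) : `|x| <= Num.sqrt (x ^+ 2 + y ^+ 2).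
  by rewrite -sqrtr_sqr ler_wsqrtr// lerDl sqr_ge0.
suff : Num.sqrt (complex.Re (v i 0) ^+ 2 + complex.Im (v i 0) ^+ 2) <= cnorm v.
  have := H (complex.Re (v i 0)) (complex.Im (v i 0)).
  by have := H (complex.Im (v i 0)) (complex.Re (v i 0)); rewrite addrC; lra.
rewrite ler_wsqrtr// (bigD1 i)//= lerDl sumr_ge0// => j _.
by rewrite addr_ge0 ?sqr_ge0.
Qed.

Lemma cnorm_le_sum v : cnorm v <= \sum_i (`|complex.Re (v i 0)| + `|complex.Im (v i 0)|).
Proof.
rewrite -(@ler_pXn2r _ 2) ?nnegrE ?cnorm_ge0 ?sumr_ge0// cnorm_sqr.
rewrite expr2 big_distrl/=; apply: ler_sum => i _.
rewrite (le_trans _ (_ : (`|complex.Re (v i 0)| + `|complex.Im (v i 0)|) ^+ 2 <= _))//.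
  rewrite -!expr2 -(real_normK (num_real (complex.Re _))) -(real_normK (num_real (complex.Im _))).
  rewrite sqrrD addrAC lerDl mulrn_wge0// mulr_ge0//.
rewrite expr2 ler_wpM2l ?addr_ge0//.
by rewrite [leRHS](bigD1 i)//= lerDl sumr_ge0// => j _; rewrite addr_ge0.
Qed.

(** A crude entrywise bound: only finiteness matters, to make the suprema defining the operator
    norms meaningful. *)
Lemma mulmx_bounded (B : 'M[R[i]]_d) : exists2 M : R, 0 <= M &
  forall v, cnorm (B *m v) <= M * cnorm v.
Proof.
exists (\sum_(i < d) \sum_(j < d) (2 * (`|complex.Re (B i j)| + `|complex.Im (B i j)|))).
  by apply: sumr_ge0 => i _; apply: sumr_ge0 => j _; rewrite mulr_ge0// addr_ge0.
move=> v; apply: le_trans (cnorm_le_sum _) _; rewrite big_distrl/=; apply: ler_sum => i _.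
rewrite !mxE Re_sum Im_sum big_distrl/=.
apply: le_trans (lerD (ler_norm_sum _ _ _) (ler_norm_sum _ _ _)) _.
rewrite -big_split/=; apply: ler_sum => j _.
apply: (@le_trans _ _ ((`|complex.Re (B i j)| + `|complex.Im (B i j)|) *
    (`|complex.Re (v j 0)| + `|complex.Im (v j 0)|))); last first.
  by rewrite -mulrA mulrCA ler_wpM2l ?addr_ge0// ler_cnorm.
case: (B i j) (v j 0) => [a b] [x y] /=.
rewrite mulrDl !mulrDr -!normrM.
have := ler_normB (a * x) (b * y); have := ler_normD (a * y) (b * x); lra.
Qed.

End matrix_bounds.

Section leray.
Context {R : realType} {d L : nat}.
Local Notation cmx := (map_mx (real_complex R)).
Hypothesis L0 : (0 < L)%N.
Implicit Types k : grid L d.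

Lemma mrep0 : mrep (0 : grid L d) = 0.
Proof. by apply/rowP => i; rewrite !mxE /signed_rep /= expn_gt0. Qed.

Lemma wave_sqr_neq0 k : k != 0 -> \sum_i (wave k 0 i : R) ^+ 2 != 0.
Proof.
move=> k0; apply: contra k0 => /eqP H; rewrite -(inj_eq (can_inj (mrepK L0))) mrep0.
apply/eqP/rowP => i; have /eqP := psumr_eq0P (fun i _ => sqr_ge0 (wave k 0 i : R)) H isT (i := i).
rewrite sqrf_eq0 !mxE mulf_eq0 mulf_eq0 pnatr_eq0/= gt_eqF ?pi_gt0//= intr_eq0.
by move/eqP.
Qed.

Lemma wave_mul_trmx k :
  wave k *m (wave k)^T = (\sum_i (wave k 0 i : R) ^+ 2)%:M.
Proof.
apply/matrixP => i j; rewrite !ord1 !mxE mulr1n.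
by apply: eq_bigr => l _; rewrite [X in _ * X]mxE expr2.
Qed.

Lemma leray_sym k : (leray k : 'M[R[i]]_d)^T = leray k.
Proof.
rewrite /leray; case: ifP => _; first exact: trmx1.
by rewrite map_trmx raddfB/= linearZ/= trmx1 trmx_mul trmxK.
Qed.

Lemma leray_idem k : (leray k : 'M[R[i]]_d) *m leray k = leray k.
Proof.
rewrite /leray; case: ifP => k0; first exact: mul1mx.
have s0 := wave_sqr_neq0 (negbT k0).
rewrite -map_mxM; congr cmx; set s := \sum_i _ in s0 *; set K := _^T *m _.
have KK : K *m K = s *: K.
  rewrite /K mulmxA -(mulmxA _ (wave k)).
  by rewrite wave_mul_trmx mul_mx_scalar scalemxAl.
rewrite mulmxBl mul1mx mulmxBr mulmx1 -scalemxAl -scalemxAr KK !scalerA -mulrA mulVf// mulr1.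
by rewrite subrr subr0.
Qed.

(** A real symmetric idempotent matrix P satisfies v.Pv = Pv.Pv. *)
Lemma vdot_leray_ge0 k (v : 'cV[R[i]]_d) : 0 <= vdot v (leray k *m v).
Proof.
have [B BE] : exists B : 'M[R]_d, leray k = cmx B.
  rewrite /leray; case: ifP => _; last by eexists.
  by exists 1%:M; rewrite map_mx1.
have BT : cmx B^T = leray k by rewrite -map_trmx -BE leray_sym.
by rewrite -leray_idem -mulmxA {1}BE vdot_trmx BT vdot_ge0.
Qed.

(** For nonzero [k] the coefficient is a multiple of the wave vector. At [k = 0] the symbol is the
    identity, but a gradient has no mean. *)
Lemma leray_gradlike (F : 'rV[R]_d -> 'cV[R]_d) k :
  gradlike (fun i x => F x i 0) -> leray k *m exact_source F k = 0.
Proof.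
move=> GF; have [w1 [w2 H]] := GF (mrep k).
rewrite /leray; case: ifP => k0.
  rewrite mul1mx; apply/colP => j; rewrite [RHS]mxE; apply/eqP; rewrite eq_complex/=.
  rewrite Re_exact_source Im_exact_source; have [-> ->] := H j.
  by rewrite (eqP k0) mrep0 mxE !mul0r mulr0 eqxx.
have s0 := wave_sqr_neq0 (negbT k0).
pose c := gsc (R := R) (d := d) (L := L) / (2 * pi).
have -> : exact_source F k = (c * w1 +i* (c * w2))%C *: cmx (wave k)^T.
  apply/colP => j; rewrite [RHS]mxE [cmx _ _ _]mxE [_^T _ _]mxE; apply/eqP.
  have pi0 : (pi : R) != 0 by rewrite gt_eqF// pi_gt0.
  rewrite eq_complex Re_exact_source Im_exact_source/=; have [-> ->] := H j.
  have wE : wave k 0 j = 2 * pi * (mrep k 0 j)%:~R :> R by rewrite !mxE.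
  have cE : c * (2 * pi) = gsc (R := R) (d := d) (L := L).
    by rewrite divfK// mulf_neq0 ?pnatr_eq0.
  rewrite wE !mulr0 subr0 add0r -cE; move: (_%:~R) => x.
  by apply/andP; split; apply/eqP; ring.
rewrite -scalemxAr -map_mxM mulmxBl mul1mx -scalemxAl -mulmxA wave_mul_trmx.
by rewrite mul_mx_scalar scalerA mulVf// scale1r subrr map_mx0 scaler0.
Qed.

Lemma leray_divfree (F : 'rV[R]_d -> 'cV[R]_d) k :
  divfree (fun i x => F x i 0) -> leray k *m exact_source F k = exact_source F k.
Proof.
move=> /(_ (mrep k)) [H1 H2]; rewrite /leray; case: ifP => k0; first exact: mul1mx.
rewrite map_mxB map_mx1 map_mxZ map_mxM mulmxBl mul1mx -scalemxAl -mulmxA.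
suff -> : cmx (wave k) *m exact_source F k = 0 by rewrite mulmx0 scaler0 subr0.
apply/colP => i; rewrite ord1 [RHS]mxE mxE; apply/eqP.
rewrite eq_complex Re_sum Im_sum/=; apply/andP; split; apply/eqP.
- rewrite -[RHS](mulr0 (gsc (R := R) (d := d) (L := L) * (2 * pi))) -[in RHS]H1 big_distrr/=.
  by apply: eq_bigr => j _; rewrite [cmx _ _ _]mxE ReZ Re_exact_source !mxE; ring.
- rewrite -[RHS](mulr0 (gsc (R := R) (d := d) (L := L) * (2 * pi))) -[in RHS]H2 big_distrr/=.
  by apply: eq_bigr => j _; rewrite [cmx _ _ _]mxE ImZ Im_exact_source !mxE; ring.
Qed.

End leray.

(** * The exact operator *)

Section exact_operator.
Context {R : realType} {d L : nat}.
Local Notation gfield := (grid L d -> 'cV[R[i]]_d).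
Local Notation gsc := (gsc (R := R) (d := d) (L := L)).
Hypothesis L0 : (0 < L)%N.
Variables (a : 'rV[R]_d -> 'M[R]_d) (lam B : R).
Hypothesis pa : forall i j, torus_periodic (fun x => a x i j).
Hypothesis ma : forall i j, tmeas (fun x => a x i j).
Hypothesis ba : forall i j x, `|a x i j| <= B.
Hypothesis B0 : 0 <= B.
Hypothesis coer : forall x (xi : 'I_d -> R),
  lam^-1 * \sum_i xi i ^+ 2 <= \sum_i xi i * \sum_j a x i j * xi j.
Variable A : gfield -> gfield.
Hypothesis HA : exact_operator a A.
Implicit Types (phi psi zeta : gfield) (G H : 'I_d -> 'rV[R]_d -> R).

Definition amul G i x : R := \sum_j a x i j * G j x.

Lemma l2_amul G i : (forall j, l2 (G j)) -> l2 (amul G i).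
Proof. by move=> G2; apply: l2_sum => j _; exact: l2_mul_bounded (ba i j) (G2 j). Qed.

Lemma nrm_amul G i (e : R) : (forall j, l2 (G j)) -> (forall j, nrm (G j) <= e) ->
  nrm (amul G i) <= d%:R * (B * e).
Proof.
move=> G2 Ge; apply: le_trans (nrm_sum _ _) _.
  by move=> j; exact: l2_mul_bounded (ba i j) (G2 j).
apply: (@le_trans _ _ (\sum_(j < d) B * e)).
  apply: ler_sum => j _; apply: le_trans (nrm_mul_bounded (pa i j) (ma i j) (ba i j) (G2 j)) _.
  by rewrite ler_wpM2l.
by rewrite sumr_const card_ord -[leLHS]mulr_natl.
Qed.

Lemma rdot_exact_operator zeta phi :
  rdot zeta (A phi) = gsc ^+ 2 *
    \sum_i (ip (iR zeta i) (amul (iR phi) i) + ip (iI zeta i) (amul (iI phi) i)).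
Proof.
rewrite -rdotE HA ReZ -gsc_sqr; congr (_ * _); rewrite big_split/=.
pose U (s : 'I_d + 'I_d) := match s with inl i => iR zeta i | inr i => iI zeta i end.
pose V (s : 'I_d + 'I_d) :=
  match s with inl i => amul (iR phi) i | inr i => amul (iI phi) i end.
have := @torus_int_sum_mul R d _ (index_enum ('I_d + 'I_d)%type) U V.
rewrite big_sumType/= => ->; last 2 first.
- by case=> i; [exact: l2_iR|exact: l2_iI].
- by case=> i; apply: l2_amul => j; [exact: l2_iR|exact: l2_iI].
congr torus_int; apply/funext => x; rewrite big_sumType/= -big_split/=.
rewrite -mulmxA Re_adjoint_mul; apply: eq_bigr => i _.
by rewrite Re_cmx_mul Im_cmx_mul.
Qed.

(** Stated for arbitrary fields [G] and [H] to serve twice: with interpolates it bounds [A], with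
    interpolation errors it bounds the consistency term. In the constant, 2 counts real and
    imaginary parts and [d ^+ 2] the entries of [a]. *)
Lemma le_ip_amul zeta G H (e : R) : (forall j, l2 (G j)) -> (forall j, l2 (H j)) ->
  (forall j, nrm (G j) <= e) -> (forall j, nrm (H j) <= e) -> 0 <= e ->
  gsc ^+ 2 * \sum_i (ip (iR zeta i) (amul G i) + ip (iI zeta i) (amul H i)) <=
  grid_norm zeta * (gsc * (2 * d%:R ^+ 2 * B * e)).
Proof.
move=> G2 H2 Ge He e0; have gs0 : 0 <= gsc := ltW gsc_gt0.
rewrite big_distrr/=.
apply: (@le_trans _ _ (\sum_(i < d) 2 * (grid_norm zeta * gsc * (d%:R * (B * e))))).
  apply: ler_sum => i _; rewrite mulrDr mulr_natl mulr2n.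
  have main f F : l2 f -> l2 F -> gsc * nrm f <= grid_norm zeta ->
      nrm F <= d%:R * (B * e) ->
      gsc ^+ 2 * ip f F <= grid_norm zeta * gsc * (d%:R * (B * e)).
    move=> f2 F2 fz Fe; have /(ler_wpM2l (sqr_ge0 gsc)) := ler_ip_nrm f2 F2.
    move/le_trans; apply; rewrite [leLHS](_ : _ = gsc * nrm f * gsc * nrm F); last by ring.
    rewrite ler_pM ?mulr_ge0 ?nrm_ge0//; exact: ler_wpM2r.
  apply: lerD.
  - apply: main; [exact: l2_iR|exact: l2_amul|exact: nrm_iR|exact: nrm_amul].
  - apply: main; [exact: l2_iI|exact: l2_amul|exact: nrm_iI|exact: nrm_amul].
by rewrite sumr_const card_ord -[leLHS]mulr_natl le_eqVlt; apply/orP; left; apply/eqP; ring.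
Qed.

Lemma exact_operator_coercive zeta : lam^-1 * rdot zeta zeta <= rdot zeta (A zeta).
Proof.
rewrite rdot_exact_operator (rdot_iso L0) mulrCA ler_wpM2l ?sqr_ge0// !big_split/= mulrDr.
have main G : (forall i, l2 (G i)) ->
    lam^-1 * \sum_i ip (G i) (G i) <= \sum_i ip (G i) (amul G i).
  move=> G2; rewrite big_distrr/=.
  under eq_bigr do rewrite -ipZl//.
  apply: le_sum_ip => // [i|i|x]; [exact: l2Z|exact: l2_amul|].
  have := coer x (G^~ x); rewrite big_distrr/=.
  by under eq_bigr do rewrite expr2 mulrA.
by apply: lerD; apply: main => i; [exact: l2_iR|exact: l2_iI].
Qed.

Lemma le_rdot_exact_operator zeta phi :
  rdot zeta (A phi) <= grid_norm zeta * (2 * d%:R ^+ 2 * B * grid_norm phi).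
Proof.
have g0 : 0 < gsc := gsc_gt0.
have e0 : 0 <= grid_norm phi / gsc by rewrite divr_ge0 ?grid_norm_ge0 ?ltW.
rewrite rdot_exact_operator; apply: le_trans (le_ip_amul _ _ _ _ _ e0) _ => [j|j|j|j|].
- exact: l2_iR.
- exact: l2_iI.
- by rewrite ler_pdivlMr// mulrC nrm_iR.
- by rewrite ler_pdivlMr// mulrC nrm_iI.
rewrite le_eqVlt; apply/orP; left; apply/eqP; congr (_ * _).
by field; rewrite gt_eqF.
Qed.

(** The bound on the form is tested with [zeta := A phi]. *)
Lemma exact_operator_bounded phi : grid_norm (A phi) <= 2 * d%:R ^+ 2 * B * grid_norm phi.
Proof.
have [z|n0] := eqVneq (grid_norm (A phi)) 0.
  by rewrite z !mulr_ge0 ?grid_norm_ge0// ?sqr_ge0.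
have np : 0 < grid_norm (A phi) by rewrite lt_def n0 grid_norm_ge0.
by rewrite -(ler_pM2l np) -expr2 grid_norm_sqr le_rdot_exact_operator.
Qed.

(** [A] is given only through its form. The form is linear in [phi], so the defect of homogeneity is
    orthogonal to every grid field, in particular to itself. *)
Lemma exact_operatorZ (c : R) phi :
  A (fun k => c%:C%C *: phi k) = fun k => c%:C%C *: A phi k.
Proof.
have iRZ (z : gfield) j : iR (fun k => c%:C%C *: z k : 'cV[R[i]]_d) j = fun x => c * iR z j x.
  by apply/funext => x; rewrite /iR interpolateZ mxE ReZ.
have iIZ (z : gfield) j : iI (fun k => c%:C%C *: z k : 'cV[R[i]]_d) j = fun x => c * iI z j x.
  by apply/funext => x; rewrite /iI interpolateZ mxE ImZ.
have amZ G i : amul (fun j x => c * G j x) i = fun x => c * amul G i x.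
  apply/funext => x; rewrite /amul big_distrr/=; apply: eq_bigr => j _; ring.
pose D k := A (fun k => c%:C%C *: phi k) k - c%:C%C *: A phi k.
have D0 : rdot D D = 0.
  rewrite {2}/D rdotBr rdotZr !rdot_exact_operator mulrCA -mulrBr big_distrr/= -sumrB.
  rewrite big1 ?mulr0// => i _.
  have -> : iR (fun k => c%:C%C *: phi k : 'cV[R[i]]_d) = fun j x => c * iR phi j x.
    by apply/funext => j; rewrite iRZ.
  have -> : iI (fun k => c%:C%C *: phi k : 'cV[R[i]]_d) = fun j x => c * iI phi j x.
    by apply/funext => j; rewrite iIZ.
  have l2R i' : l2 (iR phi i') by exact: l2_iR.
  have l2I i' : l2 (iI phi i') by exact: l2_iI.
  rewrite !amZ !ipZr; [by ring|exact: l2_iI|exact: l2_amul|exact: l2_iR|exact: l2_amul].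
by apply/funext => k; have /funeqP/(_ k)/eqP := rdot_eq0 D0; rewrite subr_eq0 => /eqP.
Qed.

End exact_operator.

(** * Residuals *)

Section residuals.
Context {R : realType} {d L : nat}.
Local Notation gfield := (grid L d -> 'cV[R[i]]_d).
Implicit Types (phi psi zeta : gfield) (M : grid L d -> 'M[R[i]]_d).

Lemma abs_rdot phi psi : `|rdot phi psi| <= grid_norm phi * grid_norm psi.
Proof.
rewrite ler_norml rdot_cauchy andbT lerNl !grid_normE; apply: psd_cauchy => s t.
rewrite /rdot -sumrN !mulr_sumr -!big_split /=; apply: sumr_ge0 => k _.
apply: le_trans (vdot_ge0 (s%:C%C *: phi k + (- t)%:C%C *: psi k)) _.
by rewrite vdot_lin le_eqVlt; apply/orP; left; apply/eqP; ring.
Qed.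

Lemma cnorm_le_grid_norm phi k : cnorm (phi k) <= grid_norm phi.
Proof.
rewrite ler_wsqrtr// (bigD1 k)//= cnorm_sqr -[leLHS]addr0 lerD//.
by apply: sumr_ge0 => i _; exact: sqr_ge0.
Qed.

Lemma grid_norm_le_sum phi : grid_norm phi <= \sum_k cnorm (phi k).
Proof.
rewrite -(@ler_pXn2r _ 2) ?nnegrE ?grid_norm_ge0//; last first.
  by rewrite sumr_ge0// => k _; exact: cnorm_ge0.
rewrite sqr_sqrtr; last by apply: sumr_ge0 => k _; exact: sqr_ge0.
rewrite [leRHS]expr2 big_distrl/=; apply: ler_sum => k _.
rewrite expr2 ler_wpM2l ?cnorm_ge0// (bigD1 k)//= lerDl sumr_ge0// => i _.
exact: cnorm_ge0.
Qed.

Lemma grid_norm_mulmx M phi (c : R) : 0 <= c ->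
  (forall k v, cnorm (M k *m v) <= c * cnorm v) ->
  grid_norm (fun k => M k *m phi k) <= c * grid_norm phi.
Proof.
move=> c0 H; rewrite -(@ler_pXn2r _ 2) ?nnegrE ?mulr_ge0 ?grid_norm_ge0//.
rewrite exprMn !sqr_sqrtr; try by apply: sumr_ge0 => k _; exact: sqr_ge0.
rewrite big_distrr/=; apply: ler_sum => k _; rewrite -exprMn.
by rewrite lerXn2r ?nnegrE ?mulr_ge0 ?cnorm_ge0.
Qed.

Lemma convolD ah phi psi :
  convol ah (fun k => phi k + psi k) = fun k => convol ah phi k + convol ah psi k.
Proof.
apply/funext => k; rewrite /convol -big_split; apply: eq_bigr => l _.
by rewrite mulmxDr.
Qed.

Lemma convolZ ah (c : R[i]) phi :
  convol ah (fun k => c *: phi k) = fun k => c *: convol ah phi k.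
Proof.
apply/funext => k; rewrite /convol scaler_sumr; apply: eq_bigr => l _.
by rewrite scalemxAr.
Qed.

Lemma convol_bounded ah : exists2 M : R, 0 <= M &
  forall phi, grid_norm (convol ah phi) <= M * grid_norm phi.
Proof.
have H k := cid2 (mulmx_bounded (ah k)).
pose M k : R := s2val (H k).
have M0 k : 0 <= M k by exact: (s2valP (H k)).
have HM k v : cnorm (ah k *m v) <= M k * cnorm v by exact: (s2valP' (H k)).
exists (\sum_(k : grid L d) \sum_(l : grid L d) M (k - l)).
  by apply: sumr_ge0 => k _; exact: sumr_ge0.
move=> phi; apply: le_trans (grid_norm_le_sum _) _; rewrite big_distrl/=.
apply: ler_sum => k _; apply: le_trans (cnorm_sum _ _) _; rewrite big_distrl/=.
apply: ler_sum => l _; apply: le_trans (HM _ _) _.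
by rewrite ler_wpM2l// cnorm_le_grid_norm.
Qed.

Lemma nu_P_spec (ph : grid L d -> 'M[R[i]]_d) : 0 <= nu_P ph /\
  forall k v, cnorm ((ph k - leray k) *m v) <= nu_P ph * cnorm v.
Proof.
have op k : 0 <= opnorm (@cnorm R d) (mulmx (ph k - leray k)) /\
    forall v, cnorm ((ph k - leray k) *m v) <=
      opnorm (@cnorm R d) (mulmx (ph k - leray k)) * cnorm v.
  have [M M0 HM] := mulmx_bounded (ph k - leray k).
  have TZ (c : R) v : cnorm ((ph k - leray k) *m (c%:C%C *: v)) =
      `|c| * cnorm ((ph k - leray k) *m v) by rewrite -scalemxAr cnormZ.
  split; first exact: (opnorm_ge0 cnormZ cnorm_ge0 HM 0).
  exact: (le_opnorm cnormZ TZ cnorm_ge0 HM).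
have le_nu k : opnorm (@cnorm R d) (mulmx (ph k - leray k)) <= nu_P ph.
  exact: le_bigmax.
split; first by apply: le_trans (op 0).1 (le_nu 0).
by move=> k v; apply: le_trans ((op k).2 v) _; rewrite ler_wpM2r ?cnorm_ge0.
Qed.

Lemma nu_a_spec ah (A : gfield -> gfield) (c : R) :
  (forall phi, grid_norm (A phi) <= c * grid_norm phi) ->
  (forall (r : R) phi, A (fun k => r%:C%C *: phi k) = fun k => r%:C%C *: A phi k) ->
  0 <= nu_a ah A /\
  forall phi, grid_norm (fun k => convol ah phi k - A phi k) <= nu_a ah A * grid_norm phi.
Proof.
move=> Ac AZ; have [M M0 HM] := convol_bounded ah.
have TM phi : grid_norm (fun k => convol ah phi k - A phi k) <= (M + c) * grid_norm phi.
  rewrite mulrDl; apply: le_trans _ (lerD (HM phi) (Ac phi)).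
  have -> : grid_norm (A phi) = grid_norm (fun k => - A phi k).
    have := grid_normZ (- 1) (A phi); rewrite normrN1 mul1r => <-.
    by congr grid_norm; apply/funext => k; rewrite rmorphN1 scaleN1r.
  exact: grid_normD.
have TZ (r : R) phi : grid_norm (fun k => convol ah (fun k => r%:C%C *: phi k) k -
      A (fun k => r%:C%C *: phi k) k) =
    `|r| * grid_norm (fun k => convol ah phi k - A phi k).
  rewrite -grid_normZ convolZ AZ; congr grid_norm.
  by apply/funext => k; rewrite scalerBr.
split; first exact: (opnorm_ge0 (@grid_normZ R d L) (@grid_norm_ge0 R d L) TM (fun=> 0)).
exact: (le_opnorm (@grid_normZ R d L) TZ (@grid_norm_ge0 R d L) TM).
Qed.

End residuals.

(** * Energy estimate *)

Section torus_L2norm.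
Context {R : realType} {d : nat}.

Lemma torus_norm2_sum (I : Type) (r : seq I) (f : 'rV[R]_d -> R) (U : I -> 'rV[R]_d -> R) :
  (forall i, l2 (U i)) -> (forall x, f x ^+ 2 = \sum_(i <- r) U i x * U i x) ->
  torus_norm 2%:E f = (Num.sqrt (\sum_(i <- r) ip (U i) (U i)))%:E.
Proof.
move=> U2 fE; rewrite torus_int_sum_mul// /torus_norm unlock.
rewrite (_ : (\int[_]_t _)%E = (torus_int (fun x => \sum_(i <- r) U i x * U i x))%:E).
  rewrite poweR_EFin powR12_sqrt//.
  by apply: Rintegral_ge0 => t _; apply: sumr_ge0 => i _; rewrite -expr2 sqr_ge0.
rewrite /torus_int /Rintegral fineK; last first.
  by apply: integrable_fin_num => //; exact: integrable_sum_mul.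
apply: eq_integral => t _ /=.
by rewrite powR_mulrn// real_normK ?num_real// fE.
Qed.

(** There are 2d real components, and the square root of 2d is bounded by 2d. *)
Lemma torus_L2norm_le (F : 'rV[R]_d -> 'cV[R[i]]_d) (M : R) : 0 <= M ->
  (forall j, l2 (fun x => complex.Re (F x j 0)) /\
             nrm (fun x => complex.Re (F x j 0)) <= M) ->
  (forall j, l2 (fun x => complex.Im (F x j 0)) /\
             nrm (fun x => complex.Im (F x j 0)) <= M) ->
  (torus_L2norm F <= ((2 * d%:R) * M)%:E)%E.
Proof.
move=> M0 HR HI.
pose U (s : 'I_d + 'I_d) (x : 'rV[R]_d) : R :=
  match s with inl j => complex.Re (F x j 0) | inr j => complex.Im (F x j 0) end.
have U2 s : l2 (U s) by case: s => j; [exact: (HR j).1|exact: (HI j).1].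
have UM s : nrm (U s) <= M by case: s => j; [exact: (HR j).2|exact: (HI j).2].
rewrite /torus_L2norm (torus_norm2_sum (r := index_enum ('I_d + 'I_d)%type) U2); last first.
  by move=> x; rewrite cnorm_sqr big_sumType/= -big_split.
rewrite lee_fin -(@ler_pXn2r _ 2)// ?nnegrE ?sqrtr_ge0 ?mulr_ge0//.
rewrite sqr_sqrtr; last by apply: sumr_ge0 => s _; exact: ip_ge0.
apply: (@le_trans _ _ (\sum_(s : 'I_d + 'I_d) M ^+ 2)).
  by apply: ler_sum => s _; rewrite -nrm_sqr lerXn2r ?nnegrE ?nrm_ge0.
rewrite sumr_const card_sum !card_ord -[leLHS]mulr_natl exprMn ler_wpM2r ?sqr_ge0//.
rewrite -natrM -natrX ler_nat addnn -mul2n; case: (2 * d)%N => // n.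
by rewrite expnS leq_pmulr.
Qed.

End torus_L2norm.

Section energy_estimate.
Context {R : realType} {d L : nat}.
Local Notation gfield := (grid L d -> 'cV[R[i]]_d).
Local Notation gsc := (gsc (R := R) (d := d) (L := L)).
Local Notation exact_source F := (exact_source F : gfield).
Hypothesis L0 : (0 < L)%N.
Variables (a : 'rV[R]_d -> 'M[R]_d) (g Du : 'rV[R]_d -> 'cV[R]_d) (lam B K e mu : R).
Hypothesis lam0 : 0 < lam.
Hypothesis mu0 : 0 < mu.
Hypothesis pa : forall i j, torus_periodic (fun x => a x i j).
Hypothesis ma : forall i j, tmeas (fun x => a x i j).
Hypothesis ba : forall i j x, `|a x i j| <= B.
Hypothesis B0 : 0 <= B.
Hypothesis coer : forall x (xi : 'I_d -> R),
  lam^-1 * \sum_i xi i ^+ 2 <= \sum_i xi i * \sum_j a x i j * xi j.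
Hypothesis g2 : forall i, l2 (fun x => g x i 0).
Hypothesis D2 : forall i, l2 (fun x => Du x i 0).
Hypothesis gD : gradlike (fun i x => Du x i 0).
Hypothesis dQ : divfree (fun i x => \sum_j a x i j * Du x j 0 + g x i 0).
Hypothesis K0 : 0 <= K.
Hypothesis DK : forall i, nrm (fun x => Du x i 0) <= K.
Hypothesis gB : forall i, nrm (fun x => g x i 0) <= B.
Hypothesis e0 : 0 <= e.
Hypothesis tail : forall j, ip (fun x => Du x j 0) (fun x => Du x j 0) -
  \sum_(m <- gfreq (d := d) (L := L)) en (fun x => Du x j 0) m <= e ^+ 2.
Variables (ah ph : grid L d -> 'M[R[i]]_d) (gh psi : gfield) (A : gfield -> gfield).
Hypothesis HA : exact_operator a A.
Hypothesis Hpsi : discrete_minimizer mu ah ph gh psi.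
Hypothesis small : lam * nu_a ah A + lam * mu * nu_P ph <= 2^-1.

Let flux (x : 'rV[R]_d) : 'cV[R]_d := a x *m Du x + g x.
Let w := exact_source Du.
Let q := exact_source flux.
Let z : gfield := fun k => psi k - w k + (mu^-1)%:C%C *: q k.
Let c := 2 * d%:R ^+ 2 * B.
Let QB : R := d%:R * (B * K) + B.

Let fluxE i : (fun x => flux x i 0) = (fun x => amul a (fun j x => Du x j 0) i x + g x i 0).
Proof. by apply/funext => x; rewrite !mxE. Qed.

Let l2_flux i : l2 (fun x => flux x i 0).
Proof. by rewrite fluxE; apply: l2D => //; exact: l2_amul. Qed.

Let nrm_flux i : nrm (fun x => flux x i 0) <= QB.
Proof.
rewrite fluxE; apply: le_trans (nrmD _ (g2 i)) _; first exact: l2_amul.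
by apply: lerD => //; exact: nrm_amul.
Qed.

Let qE k : q k = exact_source (fun x => a x *m Du x) k + exact_source g k.
Proof.
have aD2 i : l2 (fun x => (a x *m Du x) i 0).
  have -> : (fun x => (a x *m Du x) i 0) = amul a (fun j x => Du x j 0) i.
    by apply/funext => x; rewrite !mxE.
  exact: l2_amul.
apply/colP => i; rewrite [RHS]mxE; apply/eqP.
rewrite eq_complex ReD ImD !Re_exact_source !Im_exact_source -!mulrDr /ca /cb.
have -> : (fun x => flux x i 0) = (fun x => (a x *m Du x) i 0 + g x i 0).
  by apply/funext => x; rewrite !mxE.
by rewrite !ipDl ?eqxx//; exact: l2_trig.
Qed.

Let leray_w k : leray k *m w k = 0. Proof. exact: leray_gradlike. Qed.

Let leray_q k : leray k *m q k = q k.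
Proof.
apply: leray_divfree => // m; have [H1 H2] := dQ m.
by split; [rewrite -[RHS]H1|rewrite -[RHS]H2]; apply: eq_bigr => i _; rewrite fluxE.
Qed.

Let dA (phi : gfield) : gfield := fun k => convol ah phi k - A phi k.
Let dP (phi : gfield) : gfield := fun k => (ph k - leray k) *m phi k.

(** Of [ph w] only [dP w] remains, and [ph q] is [q + dP q], where [q] is the coefficient of a Du
    plus that of g. These two meet [A w] and [gh], and only their differences survive. *)
Let residual_identity k :
  convol ah z k + mu%:C%C *: (ph k *m z k) =
  - (gh k - exact_source g k) - (A w k - exact_source (fun x => a x *m Du x) k)
  - dA w k - mu%:C%C *: dP w k + (mu^-1)%:C%C *: A q k + (mu^-1)%:C%C *: dA q k + dP q k.
Proof.
have Ez : z = (fun k => psi k + ((- 1)%:C%C *: w k + (mu^-1)%:C%C *: q k)).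
  by apply/funext => l; rewrite /z rmorphN1 scaleN1r addrA.
have mV : mu%:C%C * (mu^-1)%:C%C = 1 by rewrite -rmorphM /= divff ?gt_eqF.
rewrite Ez !convolD !convolZ !mulmxDr -!scalemxAr /dA /dP !mulmxBl leray_w leray_q.
have := Hpsi k; have := qE k; move: mV (convol ah psi k) (convol ah w k) (convol ah q k).
move: (q k) (A w k) (A q k) (ph k *m psi k) (ph k *m w k) (ph k *m q k).
move: mu%:C%C (mu^-1)%:C%C (exact_source _ k) (exact_source g k) (gh k).
move=> m m' s gk ghk qk Aw Aq pp pw pq mm cp cw cq -> H.
apply/colP => i; have /colP/(_ i) := H; rewrite !mxE => Hi.
rewrite -(opprK (ghk i 0)) -Hi rmorphN1.
rewrite (_ : m * (pp i 0 + (-1 * pw i 0 + m' * pq i 0)) =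
  m * pp i 0 - m * pw i 0 + (m * m') * pq i 0); last by ring.
by rewrite mm; ring.
Qed.

Let Z := grid_norm z.
Let na := nu_a ah A.
Let nP := nu_P ph.
Let ng := grid_norm (fun k => gh k - exact_source g k).

Let QB0 : 0 <= QB. Proof. by rewrite addr_ge0 ?mulr_ge0. Qed.

Let c0 : 0 <= c. Proof. by rewrite !mulr_ge0. Qed.

Let naP : 0 <= na /\ forall phi, grid_norm (dA phi) <= na * grid_norm phi.
Proof.
apply: (@nu_a_spec _ _ _ _ _ c) => [phi|r phi].
  exact: (exact_operator_bounded L0 pa ma ba B0 HA).
exact: (exact_operatorZ L0 pa ma ba HA).
Qed.

Let nPP : 0 <= nP /\ forall phi, grid_norm (dP phi) <= nP * grid_norm phi.
Proof.
have [n0 H] := nu_P_spec ph; split=> // phi.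
exact: grid_norm_mulmx.
Qed.

Let norm_w : grid_norm w <= gsc * (d%:R * K).
Proof. exact: grid_norm_exact_source. Qed.

Let norm_q : grid_norm q <= gsc * (d%:R * QB).
Proof. by apply: grid_norm_exact_source. Qed.

(** The real error and the imaginary part add up, in squares, to the Fourier tail, so each is
    bounded by it. *)
Let interpolation_error j : nrm (fun x => iR w j x - Du x j 0) <= e /\ nrm (iI w j) <= e.
Proof.
have := dist_exact_source L0 D2 j; rewrite -/w => H.
have := tail j; rewrite -H -(@ler_pXn2r _ 2 _ (nrm _))// ?nnegrE ?nrm_ge0//.
rewrite -(@ler_pXn2r _ 2 _ (nrm (iI w j)))// ?nnegrE ?nrm_ge0// !nrm_sqr.
have h1 := ip_ge0 (fun x => iR w j x - Du x j 0); have h2 := ip_ge0 (iI w j).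
by split; lra.
Qed.

(** By [rdot_exact_source] the truncated coefficients of a Du may be replaced by a Du itself when
    paired with [z]. What remains is the form of [a] applied to the errors [Du - iR w] and
    [- iI w]. *)
Let consistency :
  - rdot z (fun k => A w k - exact_source (fun x => a x *m Du x) k) <= Z * (gsc * (c * e)).
Proof.
have E j : (fun x => (a x *m Du x) j 0) = amul a (fun j x => Du x j 0) j.
  by apply/funext => x; rewrite !mxE.
have aD2 i : l2 (fun x => (a x *m Du x) i 0) by rewrite E; exact: l2_amul.
rewrite rdotBr (rdot_exact_operator L0 pa ma ba HA) rdot_exact_source//.
pose G j (x : 'rV[R]_d) := Du x j 0 - iR w j x.
pose H j (x : 'rV[R]_d) := - iI w j x.
have l2w j : l2 (iR w j) by exact: l2_iR.
have l2i j : l2 (iI w j) by exact: l2_iI.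
have G2 j : l2 (G j) by exact: l2B.
have H2 j : l2 (H j) by exact: l2N.
apply: le_trans (le_ip_amul L0 pa ma ba B0 z G2 H2 _ _ e0) => [|j|j].
- rewrite -mulrBr -mulrN -sumrB -sumrN le_eqVlt; apply/orP; left; apply/eqP.
  congr (_ * _); apply: eq_bigr => i _.
  have -> : amul a G i = fun x => amul a (fun j x => Du x j 0) i x - amul a (iR w) i x.
    by apply/funext => x; rewrite /amul -sumrB; apply: eq_bigr => j _; rewrite mulrBr.
  have -> : amul a H i = fun x => - amul a (iI w) i x.
    by apply/funext => x; rewrite /amul -sumrN; apply: eq_bigr => j _; rewrite mulrN.
  rewrite ipBr ?ipNr ?E; [by ring| | | | |]; try exact: l2_amul; try exact: l2_iR; exact: l2_iI.
- have [+ _] := interpolation_error j; rewrite -nrmN; last exact: l2B.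
  by under eq_fun do rewrite opprB.
- by have [_ +] := interpolation_error j; rewrite /H nrmN.
Qed.

Lemma discrete_stability : Z <= 2 * lam * (ng + gsc * (c * e) +
  (na + mu * nP) * (gsc * (d%:R * K)) +
  mu^-1 * ((c + lam^-1) * (gsc * (d%:R * QB)))).
Proof.
have [na0 Hna] := naP; have [nP0 HnP] := nPP.
have Z0 : 0 <= Z := grid_norm_ge0 z.
have lV : lam * lam^-1 = 1 by rewrite divff ?gt_eqF.
have mV : mu * mu^-1 = 1 by rewrite divff ?gt_eqF.
have muV0 : 0 <= mu^-1 by rewrite invr_ge0 ltW.
have lower : lam^-1 * Z ^+ 2 - (na + mu * nP) * Z ^+ 2 <=
    rdot z (fun k => convol ah z k + mu%:C%C *: (ph k *m z k)).
  have -> : (fun k => convol ah z k + mu%:C%C *: (ph k *m z k)) =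
      (fun k => A z k + (dA z k + mu%:C%C *: (leray k *m z k + dP z k))).
    apply/funext => k; by rewrite /dA /dP mulmxBl [RHS]addrA !subrKC.
  rewrite (rdotDr z (A z) (fun k => dA z k + _)) (rdotDr z (dA z) (fun k => _ *: _)).
  rewrite rdotZr (rdotDr z (fun k => leray k *m z k) (dP z)).
  have h1 := exact_operator_coercive L0 pa ma ba coer HA z.
  have h2 := abs_rdot z (dA z); have h3 := abs_rdot z (dP z).
  have h4 : 0 <= rdot z (fun k => leray k *m z k).
    by apply: sumr_ge0 => k _; exact: vdot_leray_ge0.
  have h5 := Hna z; have h6 := HnP z; rewrite -/Z in h2 h3 h5 h6.
  have h7 : - (na * Z ^+ 2) <= rdot z (dA z).
    rewrite lerNl; apply: le_trans (ler_norm _) _; rewrite normrN.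
    by apply: le_trans h2 _; rewrite expr2 mulrCA ler_wpM2l.
  have h8 : - (nP * Z ^+ 2) <= rdot z (dP z).
    rewrite lerNl; apply: le_trans (ler_norm _) _; rewrite normrN.
    by apply: le_trans h3 _; rewrite expr2 mulrCA ler_wpM2l.
  have h9 : - (mu * (nP * Z ^+ 2)) <= mu * (rdot z (fun k => leray k *m z k) + rdot z (dP z)).
    by rewrite -mulrN ler_pM2l//; lra.
  apply: le_trans (lerD h1 (lerD h7 h9)).
  by rewrite -grid_norm_sqr -/Z le_eqVlt; apply/orP; left; apply/eqP; ring.
have comb (X1 X2 X3 X4 X5 X6 X7 : gfield) (r1 r2 r3 r4 r5 r6 : R) :
    rdot z (fun k => r1%:C%C *: X1 k + (r2%:C%C *: X2 k + (r3%:C%C *: X3 k +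
      (r4%:C%C *: X4 k + (r5%:C%C *: X5 k + (r6%:C%C *: X6 k + X7 k)))))) =
    r1 * rdot z X1 + (r2 * rdot z X2 + (r3 * rdot z X3 +
      (r4 * rdot z X4 + (r5 * rdot z X5 + (r6 * rdot z X6 + rdot z X7))))).
  by rewrite !rdotDr !rdotZr.
have upper : rdot z (fun k => convol ah z k + mu%:C%C *: (ph k *m z k)) <=
    Z * (ng + gsc * (c * e) + (na + mu * nP) * (gsc * (d%:R * K)) +
      mu^-1 * ((c + (na + mu * nP)) * (gsc * (d%:R * QB)))).
  rewrite (_ : (fun k => _) = (fun k =>
    (- 1)%:C%C *: (gh k - exact_source g k) +
    ((- 1)%:C%C *: (A w k - exact_source (fun x => a x *m Du x) k) +
    ((- 1)%:C%C *: dA w k + ((- mu)%:C%C *: dP w k + ((mu^-1)%:C%C *: A q k +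
    ((mu^-1)%:C%C *: dA q k + dP q k))))))); last first.
    by apply/funext => k; rewrite residual_identity !rmorphN1 !scaleN1r rmorphN scaleNr !addrA.
  rewrite comb.
  have Zle X Y : grid_norm X <= Y -> `|rdot z X| <= Z * Y.
    by move=> XY; apply: le_trans (abs_rdot z X) _; rewrite ler_wpM2l.
  have sW x : 0 <= x -> x * grid_norm w <= x * (gsc * (d%:R * K)) by move=> ?; rewrite ler_wpM2l.
  have sQ x : 0 <= x -> x * grid_norm q <= x * (gsc * (d%:R * QB)) by move=> ?; rewrite ler_wpM2l.
  have t1 := abs_rdot z (fun k => gh k - exact_source g k).
  have t2 := consistency.
  have t3 := Zle _ _ (le_trans (Hna w) (sW _ na0)).
  have t4 := Zle _ _ (le_trans (HnP w) (sW _ nP0)).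
  have t5 := Zle _ _ (le_trans (exact_operator_bounded L0 pa ma ba B0 HA q) (sQ _ c0)).
  have t6 := Zle _ _ (le_trans (Hna q) (sQ _ na0)).
  have t7 := Zle _ _ (le_trans (HnP q) (sQ _ nP0)).
  have bd (x y r : R) : 0 <= r -> `|x| <= y -> r * x <= r * y /\ - r * x <= r * y.
    move=> r0 xy; rewrite mulNr -mulrN !ler_wpM2l//; apply: le_trans xy; rewrite ?ler_norm//.
    by rewrite -normrN ler_norm.
  have [_ u1] := bd _ _ _ ler01 t1; have [_ u3] := bd _ _ _ ler01 t3.
  have [_ u4] := bd _ _ _ (ltW mu0) t4; have [u5 _] := bd _ _ _ muV0 t5.
  have [u6 _] := bd _ _ _ muV0 t6; have [u7 _] := bd _ _ _ ler01 t7.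
  rewrite mul1r in u7; rewrite -mulN1r in t2.
  apply: le_trans (lerD u1 (lerD t2 (lerD u3 (lerD u4 (lerD u5 (lerD u6 u7)))))) _.
  rewrite !mul1r -/Z -/ng le_eqVlt; apply/orP; left; apply/eqP.
  by field; rewrite gt_eqF.
(* The smallness assumption divided by [lam]: it leaves half of the coercivity constant in [lower],
   and it bounds the residuals acting on [q / mu]. *)
have small' : na + mu * nP <= lam^-1 / 2.
  rewrite -(ler_pM2l lam0) mulrDr !mulrA lV mul1r; exact: small.
have gs0 : 0 <= gsc := ltW gsc_gt0.
have lV0 : 0 <= lam^-1 by rewrite invr_ge0 ltW.
have ng0 : 0 <= ng by exact: grid_norm_ge0.
have l20 : 0 <= 2 * lam by rewrite mulr_ge0// ltW.
have [z0|zn0] := eqVneq Z 0.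
  have s1 := mulr_ge0 gs0 (mulr_ge0 c0 e0).
  have s2 := mulr_ge0 (addr_ge0 na0 (mulr_ge0 (ltW mu0) nP0))
    (mulr_ge0 gs0 (mulr_ge0 (ler0n R d) K0)).
  have s3 := mulr_ge0 muV0 (mulr_ge0 (addr_ge0 c0 lV0)
    (mulr_ge0 gs0 (mulr_ge0 (ler0n R d) QB0))).
  by rewrite z0; exact: mulr_ge0 l20 (addr_ge0 (addr_ge0 (addr_ge0 ng0 s1) s2) s3).
have Zp : 0 < Z by rewrite lt_def zn0.
set S := (X in _ <= _ * X).
(* Next to [mu^-1] the residual sizes are replaced by [lam^-1], so that no product of the small
   quantities appears in the final bound. *)
have S1 : ng + gsc * (c * e) + (na + mu * nP) * (gsc * (d%:R * K)) +
      mu^-1 * ((c + (na + mu * nP)) * (gsc * (d%:R * QB))) <= S.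
  rewrite lerD2l ler_wpM2l// ler_wpM2r ?mulr_ge0 ?(ltW gsc_gt0)// lerD2l.
  have : 0 < lam^-1 by rewrite invr_gt0.
  by lra.
have : lam^-1 / 2 * Z ^+ 2 <= Z * S.
  apply: le_trans (_ : lam^-1 * Z ^+ 2 - (na + mu * nP) * Z ^+ 2 <= _).
    by rewrite -mulrBl ler_wpM2r ?sqr_ge0//; lra.
  by apply: le_trans lower _; apply: le_trans upper _; rewrite ler_pM2l.
rewrite expr2 mulrCA ler_pM2l// => H.
have := ler_wpM2l l20 H; rewrite (_ : 2 * lam * (lam^-1 / 2 * Z) = lam * lam^-1 * Z) ?lV ?mul1r//.
by field; rewrite gt_eqF.
Qed.

Let psiE : psi = (fun k => z k + (w k + (- mu^-1)%:C%C *: q k)).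
Proof.
by apply/funext => k; rewrite /z rmorphN scaleNr addrACA subrK subrr addr0.
Qed.

Let iR_psi j x : iR psi j x = iR z j x + iR w j x - mu^-1 * iR q j x.
Proof.
by have := iR_lin (- mu^-1) z w q j x; rewrite -psiE mulNr.
Qed.

Let iI_psi j x : iI psi j x = iI z j x + iI w j x - mu^-1 * iI q j x.
Proof.
by have := iI_lin (- mu^-1) z w q j x; rewrite -psiE mulNr.
Qed.

(** The error splits into the interpolates of [z], of [w] minus Du, and of [- q / mu], bounded by
    stability, by the Fourier tail and by the size of the flux. *)
Lemma discretization_error :
  (torus_L2norm (fun x => interpolate psi x - map_mx (real_complex R) (Du x))%R <=
   (2 * d%:R * (2 * lam * (nu_g g gh + c * e + (na + mu * nP) * (d%:R * K) +
      mu^-1 * ((c + lam^-1) * (d%:R * QB))) + e + mu^-1 * (d%:R * QB)))%:E)%E.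
Proof.
have gs0 : 0 < gsc := gsc_gt0.
have muV0 : 0 <= mu^-1 by rewrite invr_ge0 ltW.
set S := 2 * lam * _.
have zS : Z <= gsc * S.
  apply: le_trans discrete_stability _; rewrite /S /nu_g gscV le_eqVlt.
  by apply/orP; left; apply/eqP; rewrite -/ng; field; rewrite !gt_eqF.
have norm3 (f1 f2 f3 : 'rV[R]_d -> R) : l2 f1 -> l2 f2 -> l2 f3 ->
    gsc * nrm f1 <= Z -> nrm f2 <= e -> gsc * nrm f3 <= grid_norm q ->
    l2 (fun x => f1 x + f2 x - mu^-1 * f3 x) /\
    nrm (fun x => f1 x + f2 x - mu^-1 * f3 x) <= S + e + mu^-1 * (d%:R * QB).
  move=> h1 h2 h3 n1 n2 n3; have h12 := l2D h1 h2; have h3' := l2Z mu^-1 h3.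
  split; first exact: l2B.
  apply: le_trans (nrmB h12 h3') _; rewrite nrmZ// ger0_norm//; apply: lerD.
    apply: le_trans (nrmD h1 h2) _; apply: lerD => //.
    by rewrite -(ler_pM2l gs0); exact: le_trans n1 zS.
  by rewrite ler_wpM2l// -(ler_pM2l gs0); exact: le_trans n3 norm_q.
have errE x j : (interpolate psi x - map_mx (real_complex R) (Du x)) j 0 =
    interpolate psi x j 0 - (Du x j 0)%:C%C.
  by rewrite mxE; congr (_ + _); rewrite !mxE.
have HR j : l2 (fun x => complex.Re ((interpolate psi x - map_mx (real_complex R) (Du x)) j 0)) /\
    nrm (fun x => complex.Re ((interpolate psi x - map_mx (real_complex R) (Du x)) j 0)) <=
    S + e + mu^-1 * (d%:R * QB).
  have -> : (fun x => complex.Re ((interpolate psi x - map_mx (real_complex R) (Du x)) j 0)) =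
      (fun x => iR z j x + (iR w j x - Du x j 0) - mu^-1 * iR q j x).
    by apply/funext => x; rewrite errE ReD ReN -/(iR psi j x) iR_psi /= addrAC -(addrA (iR z j x)).
  apply: norm3; [exact: l2_iR|apply: l2B; [exact: l2_iR|exact: D2]|exact: l2_iR|exact: nrm_iR| |exact: nrm_iR].
  exact: (interpolation_error j).1.
have HI j : l2 (fun x => complex.Im ((interpolate psi x - map_mx (real_complex R) (Du x)) j 0)) /\
    nrm (fun x => complex.Im ((interpolate psi x - map_mx (real_complex R) (Du x)) j 0)) <=
    S + e + mu^-1 * (d%:R * QB).
  have -> : (fun x => complex.Im ((interpolate psi x - map_mx (real_complex R) (Du x)) j 0)) =
      (fun x => iI z j x + iI w j x - mu^-1 * iI q j x).
    by apply/funext => x; rewrite errE ImD ImN -/(iI psi j x) iI_psi /= oppr0 addr0.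
  apply: norm3; [exact: l2_iI|exact: l2_iI|exact: l2_iI|exact: nrm_iI| |exact: nrm_iI].
  exact: (interpolation_error j).2.
have S0 : 0 <= S by rewrite -(pmulr_rge0 _ gs0); exact: le_trans (grid_norm_ge0 _) zS.
apply: torus_L2norm_le => //.
exact: addr_ge0 (addr_ge0 S0 e0) (mulr_ge0 muV0 (mulr_ge0 (ler0n R d) QB0)).
Qed.

End energy_estimate.

(** * Collecting the constants *)

(** Here [x] stands for (2^L eps)^-p, [m] for mu^-1, [n] for nu_a + mu nu_P, [g] for nu_g and [t]
    for c + lam^-1; the excess of the right side is a sum of nonnegative cross terms. *)
Lemma error_constant (R : realType) (lam c P Q t x m n g : R) :
  0 <= lam -> 0 <= c -> 0 <= P -> 0 <= Q -> 0 <= t ->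
  0 <= x -> 0 <= m -> 0 <= n -> 0 <= g ->
  2 * lam * (g + c * (P * x) + n * P + m * (t * Q)) + P * x + m * Q <=
  (2 * lam * (1 + c * P + P + t * Q) + P + Q) * (x + m + n + g).
Proof.
move=> l0 c0 P0 Q0 t0 x0 m0 n0 g0.
have A : g + c * (P * x) + n * P + m * (t * Q) <=
    (1 + c * P + P + t * Q) * (x + m + n + g).
  have h1 := mulr_ge0 (mulr_ge0 c0 P0) (addr_ge0 (addr_ge0 m0 n0) g0).
  have h2 := mulr_ge0 P0 (addr_ge0 (addr_ge0 x0 m0) g0).
  have h3 := mulr_ge0 (mulr_ge0 t0 Q0) (addr_ge0 (addr_ge0 x0 n0) g0).
  lra.
have l20 : 0 <= 2 * lam by rewrite mulr_ge0.
have {}A := ler_wpM2l l20 A.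
have h1 := mulr_ge0 P0 (addr_ge0 (addr_ge0 m0 n0) g0).
have h2 := mulr_ge0 Q0 (addr_ge0 (addr_ge0 x0 n0) g0).
lra.
Qed.

Theorem proposition4p3 (R : realType) (d p : nat) (lam Lam Cp : R)
    (hlam : 1 < lam) (hLam : 1 < Lam) :
  exists C : R,
  forall (L : nat) (eps mu : R)
    (a : 'rV[R]_d -> 'M[R]_d) (g : 'rV[R]_d -> 'cV[R]_d)
    (u : 'rV[R]_d -> R) (Du : 'rV[R]_d -> 'cV[R]_d)
    (ah ph : grid L d -> 'M[R[i]]_d) (gh psi : grid L d -> 'cV[R[i]]_d)
    (A : (grid L d -> 'cV[R[i]]_d) -> (grid L d -> 'cV[R[i]]_d)),
  (1 <= L)%N -> 0 < eps -> 0 < mu ->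
  torus_periodic a -> torus_periodic g ->
  (forall x, (a x)^T = a x) ->
  (forall x xi, lam^-1 * dot xi xi <= dot xi (a x *m xi) <= Lam * dot xi xi) ->
  H1_gradient u Du -> elliptic_solution a g Du ->
  hermitian_operator (convol ah) ->
  (forall k, ph k \is hermsymmx) ->
  exact_operator a A ->
  discrete_minimizer mu ah ph gh psi ->
  (forall i j, classC p (fun x => a x i j)) ->
  (forall i, classC p (fun x => g x i 0)) ->
  (\sum_(k < p.+1) (eps ^+ k)%:E *
     (torus_norm +oo (nabla_norm k a) + torus_norm 2%:E (nabla_norm k g))
   <= Cp%:E)%E ->
  lam * nu_a ah A + lam * mu * nu_P ph <= 2^-1 ->
  (torus_L2norm (fun x => interpolate psi x - map_mx (real_complex R) (Du x))%R
   <= (C * ((2 ^+ L * eps) ^- p + mu^-1 + nu_a ah A + mu * nu_P ph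
            + nu_g g gh))%:E)%E.
Proof.
pose K := kreg (d := d) lam Cp p.+1; pose c := 2 * d%:R ^+ 2 * Cp.
pose Q := d%:R * (d%:R * (Cp * K) + Cp); pose P := d%:R * K.
(* The constant of [error_constant] times the factor 2d from [torus_L2norm_le], fixed before [L],
   [eps], [mu] and all fields are introduced. *)
exists (2 * d%:R * (2 * lam * (1 + c * P + P + (c + lam^-1) * Q) + P + Q)).
move=> L eps mu a g u Du ah ph gh psi A L0 e0 mu0 pa pg _ coer HDu Hell _ _ HA Hpsi ca cg Hnorm small.
have l0 : 0 < lam by exact: lt_trans hlam.
have coer1 x xi : lam^-1 * dot xi xi <= dot xi (a x *m xi) by have /andP[] := coer x xi.
have [Cp0 ba gB DK reg] := solution_bounds l0 e0 pa pg coer1 HDu Hell ca cg Hnorm.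
have pa' i j : torus_periodic (fun x => a x i j) by move=> k x; rewrite pa.
have cca i j : continuous (fun x => a x i j) by exact: ((ca i j).1 [::]).
have ma i j := tmeas_continuous (cca i j).
have g2 i : l2 (fun x => g x i 0).
  by apply: l2_continuous; [move=> k x; rewrite pg|exact: ((cg i).1 [::])].
have [D2 gD] := H1_gradlike HDu.
have aD2 i j : l2 (fun x => a x i j * Du x j 0).
  exact: (l2_mul_bounded (pa' i j) (ma i j) (ba i j)).
have K0 : 0 <= K := kreg_ge0 p.+1 (ltW l0) Cp0.
set X := (2 ^+ L * eps) ^- p.
have N0 : (0 : R) < 2 ^+ L * eps by rewrite mulr_gt0 ?exprn_gt0.
have X0 : 0 <= X by rewrite invr_ge0 exprn_ge0 ?ltW.
have tail j : ip (fun x => Du x j 0) (fun x => Du x j 0) -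
    \sum_(m <- gfreq (d := d) (L := L)) en (fun x => Du x j 0) m <= (P * X) ^+ 2.
  apply: le_trans (fourier_tail (D2 j) K0 e0 (_ : 0 < 2 ^+ L) (uniq_gfreq L0) _ _) _.
  - by rewrite exprn_gt0.
  - by move=> m mG; have [i Hi] := gfreq_notin (R := R) L0 mG; exists i; rewrite -natrX.
  - by move=> i r r01; exact: reg.
  (* The factor [d] of the tail bound is weakened to [d ^+ 2], which makes the bound a perfect
     square. *)
  - rewrite -/X (_ : (P * X) ^+ 2 = d%:R ^+ 2 * (K * X) ^+ 2); last by rewrite /P; ring.
    rewrite ler_wpM2r ?sqr_ge0// -natrX ler_nat.
    by case: (d) => // n; rewrite expnS leq_pmulr.
have PX0 : 0 <= P * X by rewrite !mulr_ge0.
have := @discretization_error R d L L0 a g Du lam Cp K (P * X) mu l0 mu0 pa' ma ba Cp0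
  (coercive_sum coer1) g2 D2 gD (elliptic_divfree aD2 g2 Hell) K0 DK gB PX0 tail
  ah ph gh psi A HA Hpsi small.
move=> /le_trans; apply; rewrite lee_fin -/c.
have c0 : 0 <= c by rewrite /c !mulr_ge0.
have P0 : 0 <= P by rewrite /P mulr_ge0.
have Q0 : 0 <= Q by rewrite /Q mulr_ge0// addr_ge0// mulr_ge0// mulr_ge0.
have t0 : 0 <= c + lam^-1 by rewrite addr_ge0// invr_ge0 ltW.
have m0 : 0 <= mu^-1 by rewrite invr_ge0 ltW.
have [na0 _] : 0 <= nu_a ah A /\ _ := nu_a_spec ah
  (exact_operator_bounded L0 pa' ma ba Cp0 HA) (exact_operatorZ L0 pa' ma ba HA).
have [nP0 _] := nu_P_spec ph.
have n0 : 0 <= nu_a ah A + mu * nu_P ph by rewrite addr_ge0// mulr_ge0// ltW.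
have g0 : 0 <= nu_g g gh by rewrite mulr_ge0 ?powR_ge0 ?grid_norm_ge0.
have d20 : (0 : R) <= 2 * d%:R by rewrite mulr_ge0.
have := ler_wpM2l d20 (error_constant (ltW l0) c0 P0 Q0 t0 X0 m0 n0 g0).
by rewrite !mulrA !addrA.
Qed.
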